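(* Let $\mathcal{A}$ be the operator of multiplication by the independent variable $z$ in $H=L^2(\nu)$, $\nu=\sum_n\nu_n\delta_{s_n}$, let $\mathcal{A}$ belong to the Schatten class $\mathfrak{S}_p$ for some $p>0$, let $t_n=s_n^{-1}$, let $a=(a_n),b=(b_n)\in L^2(\nu)$ and let $\mathcal{L}=\mathcal{A}+a\otimes b$. Assume that either $a_n\ne0$ for every $n$ and $a\in zL^2(\nu)$, or $b_n\ne0$ for every $n$ and $b\in zL^2(\nu)$. If $$\sum_n a_n\bar b_nt_n\nu_n\ne-1,$$ then $\mathcal{L}$ admits spectral synthesis.
   Context: Setting: $\{s_n\}\subset\mathbb{C}\setminus\{0\}$ is an infinite sequence of distinct points with $s_n\to0$, $\nu_n>0$, and $\nu=\sum_n\nu_n\delta_{s_n}$ is a finite measure; multiplication by $z$ in $L^2(\nu)$ is a cyclic compact normal operator with simple point spectrum $\{s_n\}$. Elements $a\in L^2(\nu)$ are identified with sequences $a=(a_n)$, $a_n=a(s_n)$. The operator is in $\mathfrak{S}_p$ iff $\sum_n|s_n|^p<\infty$. The rank one perturbation is $\mathcal{L}x=\mathcal{A}x+(x,b)a$, $x\in H$. $a\in zL^2(\nu)$ means $\sum_n|a_n|^2|t_n|^2\nu_n<\infty$ (similarly for $b$). Generalized eigenvectors of a bounded operator $\mathcal{U}$ are elements of $\ker(\mathcal{U}-\lambda I)^m$, $\lambda\in\mathbb{C}$, $m\in\mathbb{N}$. $\mathcal{U}$ admits spectral synthesis if every closed $\mathcal{U}$-invariant subspace $\mathcal{M}$ coincides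 with the closed linear span of the generalized eigenvectors of $\mathcal{U}$ that belong to $\mathcal{M}$. *)

(* Defs.v *)
From HB Require Import structures.
From mathcomp Require Import all_boot all_order all_algebra.
From mathcomp Require Import complex.
From mathcomp Require Import all_classical all_reals all_analysis.

Set Implicit Arguments.
Unset Strict Implicit.
Unset Printing Implicit Defensive.

Import Order.TTheory GRing.Theory Num.Theory.
Import numFieldNormedType.Exports.
Import Normc.

Local Open Scope classical_set_scope.
Local Open Scope ring_scope.

(* The usual topology of the complex field. *)
HB.instance Definition _ (R : realType) := NormedModule.copy R[i] R[i]^o.

Section SpectralSynthesis.
Context {K : numFieldType}.

Definition lin_span {V : lmodType K} (A : set V) : set V :=
  [set x | exists (n : nat) (c : 'I_n -> K) (v : 'I_n -> V),
     (forall i, A (v i)) /\ x = \sum_(i < n) c i *: v i].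

Definition linear_subspace {V : lmodType K} (M : set V) : Prop :=
  M 0 /\ forall (k : K) (x y : V), M x -> M y -> M (k *: x + y).

(* The zero vector counts as a generalized eigenvector. *)
Definition gen_eigenvector {V : lmodType K} (U : V -> V) (x : V) : Prop :=
  exists (lambda : K) (m : nat), iter m (fun y => U y - lambda *: y) x = 0.

Definition spectral_synthesis {V : normedModType K} (U : V -> V) : Prop :=
  forall M : set V, closed M -> linear_subspace M ->
    (forall x, M x -> M (U x)) ->
    M = closure (lin_span [set x | M x /\ gen_eigenvector U x]).

End SpectralSynthesis.

Section SquareSummable.
Context {R : realType} (nu : nat -> {posnum R}).
Implicit Types (x y : nat -> R[i]) (N : nat).

Definition sqnormE x : \bar R :=
  (\sum_(0 <= n <oo) (normc (x n) ^+ 2 * (nu n)%:num)%:E)%E.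

Definition square_summable x : Prop := (sqnormE x < +oo)%E.

Let ps x N : R := \sum_(0 <= n < N) normc (x n) ^+ 2 * (nu n)%:num.

Let term_ge0 x n : 0 <= normc (x n) ^+ 2 * (nu n)%:num.
Proof. by rewrite mulr_ge0// sqr_ge0. Qed.

Let ps_ge0 x N : 0 <= ps x N.
Proof. by apply: sumr_ge0 => n _; exact: term_ge0. Qed.

Lemma sqnormE_ge0 x : (0 <= sqnormE x)%E.
Proof. by apply: nneseries_ge0 => n _ _; rewrite lee_fin. Qed.

Lemma sqnormE_fin x : square_summable x -> sqnormE x \is a fin_num.
Proof. by move=> sx; rewrite ge0_fin_numE// sqnormE_ge0. Qed.

Let ps_le x N : ((ps x N)%:E <= sqnormE x)%E.
Proof.
rewrite /ps -sumEFin; apply: nneseries_lim_ge => n _ _.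
by rewrite lee_fin.
Qed.

Let sqnormE_le x (M : R) : (forall N, ps x N <= M) -> (sqnormE x <= M%:E)%E.
Proof.
move=> h; apply: lime_le.
  by apply: is_cvg_nneseries => n _ _; rewrite lee_fin.
by apply: nearW => N; rewrite sumEFin lee_fin; exact: h.
Qed.

Definition l2norm x : R := Num.sqrt (fine (sqnormE x)).

Let l2norm_ge0 x : 0 <= l2norm x. Proof. exact: sqrtr_ge0. Qed.

Let l2normK x : l2norm x ^+ 2 = fine (sqnormE x).
Proof. by rewrite sqr_sqrtr// fine_ge0// sqnormE_ge0. Qed.

Let sqrt_ps_le x N : square_summable x -> Num.sqrt (ps x N) <= l2norm x.
Proof.
move=> sx; apply: ler_wsqrtr.
by rewrite -lee_fin fineK ?sqnormE_fin// ps_le.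
Qed.

Let planar (a b c d : R) : Num.sqrt ((a + b) ^+ 2 + (c + d) ^+ 2) <=
  Num.sqrt (a ^+ 2 + c ^+ 2) + Num.sqrt (b ^+ 2 + d ^+ 2).
Proof. exact: (@le_normcD R (Complex a c) (Complex b d)). Qed.

Let psD x y N :
  Num.sqrt (ps (x + y) N) <= Num.sqrt (ps x N) + Num.sqrt (ps y N).
Proof.
elim: N => [|N IH]; first by rewrite /ps !big_geq// sqrtr0 addr0.
have psS z : ps z N.+1 =
    Num.sqrt (ps z N) ^+ 2 + (normc (z N) * Num.sqrt (nu N)%:num) ^+ 2.
  by rewrite {1}/ps big_nat_recr//= exprMn !sqr_sqrtr.
rewrite !psS; apply: le_trans (planar _ _ _ _).
apply: ler_wsqrtr; apply: lerD.
  by rewrite lerXn2r// ?nnegrE ?addr_ge0 ?sqrtr_ge0.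
have n0 z : 0 <= normc z :> R by case: z => ? ?; exact: sqrtr_ge0.
rewrite lerXn2r// ?nnegrE ?addr_ge0 ?mulr_ge0 ?sqrtr_ge0//.
by rewrite -mulrDl ler_wpM2r ?sqrtr_ge0// le_normcD.
Qed.

Let sqnormED x y : square_summable x -> square_summable y ->
  (sqnormE (x + y)%R <= ((l2norm x + l2norm y) ^+ 2)%:E)%E.
Proof.
move=> sx sy; apply: sqnormE_le => N.
rewrite -[leLHS]sqr_sqrtr// lerXn2r ?nnegrE ?addr_ge0 ?sqrtr_ge0//.
by apply: le_trans (psD _ _ _) _; rewrite lerD ?sqrt_ps_le.
Qed.

Lemma square_summableD x y :
  square_summable x -> square_summable y -> square_summable (x + y).
Proof. by move=> sx sy; apply: le_lt_trans (sqnormED sx sy) (ltry _). Qed.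

Lemma l2normD x y : square_summable x -> square_summable y ->
  l2norm (x + y) <= l2norm x + l2norm y.
Proof.
move=> sx sy; rewrite -(@ler_pXn2r _ 2)// ?nnegrE ?addr_ge0//.
rewrite l2normK -lee_fin fineK ?sqnormED//.
exact/sqnormE_fin/square_summableD.
Qed.

Lemma sqnormEZ (k : R[i]) x :
  (sqnormE (k *: x)%R = (normc k ^+ 2)%:E * sqnormE x)%E.
Proof.
rewrite /sqnormE -nneseriesZl; last by move=> n _; rewrite lee_fin.
apply: eq_eseriesr => n _; rewrite -EFinM; congr EFin.
by rewrite mulrA -exprMn -normcM.
Qed.

Lemma square_summableZ (k : R[i]) x :
  square_summable x -> square_summable (k *: x).
Proof.
move=> sx; rewrite /square_summable sqnormEZ -(fineK (sqnormE_fin sx)).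
by rewrite -EFinM ltry.
Qed.

Lemma l2normZ (k : R[i]) x : square_summable x ->
  l2norm (k *: x) = normc k * l2norm x.
Proof.
move=> sx; rewrite /l2norm sqnormEZ -{1}(fineK (sqnormE_fin sx)) -EFinM/=.
rewrite sqrtrM ?sqr_ge0// sqrtr_sqr ger0_norm//.
by case: k => ? ?; exact: sqrtr_ge0.
Qed.

Lemma square_summable0 : square_summable 0.
Proof.
apply: le_lt_trans (ltry 0); apply: sqnormE_le => N.
rewrite /ps big1// => n _.
by rewrite normc0 expr0n mul0r.
Qed.

Lemma l2norm_eq0 x : square_summable x -> l2norm x = 0 -> x = 0.
Proof.
move=> sx x0; apply/funext => n.
have : ps x n.+1 <= 0.
  by rewrite -lee_fin (le_trans (ps_le _ _))// -(fineK (sqnormE_fin sx))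
    -l2normK x0 expr0n.
rewrite /ps big_nat_recr//= => h.
have : normc (x n) ^+ 2 * (nu n)%:num == 0.
  rewrite eq_le term_ge0 andbT.
  by apply: le_trans h; rewrite lerDr; exact: ps_ge0.
by rewrite mulf_eq0 sqrf_eq0 (gt_eqF (gt0 _)) orbF => /eqP/eq0_normc.
Qed.

Definition l2mem : {pred nat -> R[i]} := fun x => `[< square_summable x >].

Lemma l2mem_submod_closed : submod_closed l2mem.
Proof.
split=> [|k x y /asboolP sx /asboolP sy]; apply/asboolP.
  exact: square_summable0.
exact/square_summableD/sy/square_summableZ.
Qed.

HB.instance Definition _ :=
  GRing.isSubmodClosed.Build _ _ l2mem l2mem_submod_closed.

End SquareSummable.

(* L^2 of the measure \sum_n nu_n \delta_(s_n), the s_n being distinct: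
   an element x is identified with the sequence of its values x(s_n). *)
Record L2 {R : realType} (nu : nat -> {posnum R}) := MkL2 {
  L2fun :> nat -> R[i];
  L2P : l2mem nu L2fun }.

Section L2.
Context {R : realType} (nu : nat -> {posnum R}).

HB.instance Definition _ := [isSub for @L2fun R nu].
HB.instance Definition _ := [Choice of L2 nu by <:].
HB.instance Definition _ := [SubChoice_isSubLmodule of L2 nu by <:].

Let nrm (x : L2 nu) : R[i] := (l2norm nu x)%:C%C.

Let sq (x : L2 nu) : square_summable nu x. Proof. exact/asboolP/(L2P x). Qed.

Let nrmD x y : nrm (x + y) <= nrm x + nrm y.
Proof. by rewrite /nrm -rmorphD/= lecR; exact: l2normD. Qed.

Let nrmZ (k : R[i]) x : nrm (k *: x) = `|k| * nrm x.
Proof.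
by rewrite /nrm [L2fun _]/(k *: L2fun x) l2normZ// rmorphM; case: k.
Qed.

Let nrm0 x : nrm x = 0 -> x = 0.
Proof. by move=> [] /(l2norm_eq0 (sq x)) x0; exact/val_inj. Qed.

HB.instance Definition _ :=
  @Lmodule_isNormed.Build R[i] (L2 nu) nrm nrmD nrmZ nrm0.

Definition dot (x y : L2 nu) : R[i] :=
  limn (series (fun n => x n * (y n)^*%C * ((nu n)%:num)%:C%C)).

Definition rank_one (a b : L2 nu) (x : L2 nu) : L2 nu := dot x b *: a.

Definition orthonormal (e : nat -> L2 nu) : Prop :=
  forall j k, dot (e j) (e k) = (j == k)%:R.

(* T has a Schmidt expansion with singular values mu_k; the systems e and f can
   be taken infinite, with mu_k = 0 allowed, because L2 nu is
   infinite-dimensional. *)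
Definition schatten (p : R) (T : L2 nu -> L2 nu) : Prop :=
  exists (mu : nat -> R) (e f : nat -> L2 nu),
    [/\ forall k, 0 <= mu k,
        orthonormal e /\ orthonormal f,
        forall x, series (fun k => ((mu k)%:C%C * dot x (e k)) *: f k) @ \oo
                    --> T x &
        (\sum_(0 <= k <oo) (mu k `^ p)%:E < +oo)%E].

End L2.

(* Main.v *)
Require Import Defs.
From mathcomp Require Import all_boot all_order all_algebra.
From mathcomp Require Import complex cyclic separable cyclotomic ring lra zify.
From mathcomp Require Import all_classical all_reals all_analysis.
Set Implicit Arguments.
Unset Strict Implicit.
Unset Printing Implicit Defensive.
Import Order.TTheory GRing.Theory Num.Theory.
Import numFieldNormedType.Exports.
Import Normc.
Local Open Scope classical_set_scope.
Local Open Scope ring_scope.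

(** Write L y = A y + (y, b) a, and let x belong to a closed invariant subspace M but not
    to the closure of the span of the generalized eigenvectors of L in M. By projection
    there is a vector f orthogonal to these eigenvectors with (x, f) <> 0. The proof shows
    that the orbit series g(l) = sum_k l^k (L^k x, f), which is ((I - l L)^-1 x, f) near 0,
    vanishes identically, and this contradicts g(0) = (x, f). The other inclusion only says
    that M is a closed subspace.

    g is an entire function of finite order (orbit_growth). In the disc of radius r let P be
    the product of the factors 1 - s_i l with r |s_i| > 1. Then P(l) (I - l A)^-1 has no pole
    there, and the resolvent formula for rank one perturbations writes g = F / u with explicit
    F and u, where u(0) = 1. As A is in a Schatten class, the number of factors is at most
    a multiple of a power of r (schatten_count), and this bounds F and u. The zeros of u do
    not create poles: at such a point the numerator is a vector y with (I - l L) y in the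
    span of the generalized eigenvectors, hence y is in that span too (lin_span_resolvent),
    and it is orthogonal to f. Removing the zeros one after another (resolvent_state_div), and then
    bounding the zero-free denominator from below on a circle by Cartan's lemma, one gets a
    bound for the coefficients of g (division_growth).

    g is small at most points of large circles (mostly_small_range, mostly_small_corange). By
    averaging over the centre of the circle, all the sums of |x_n f_n| nu_n / |1 - l s_n| and
    of similar terms are small at most of its points (good_points). At these points
    g(l) = (v, f) + l (v, b) (d, f) / (1 - l (d, b)), where v = (I - l A)^-1 x and
    d = (I - l A)^-1 a. Because a or b is in z L^2(nu), the factor l can be absorbed: the
    denominator is close to 1 + sum_n a_n b_n^* t_n nu_n, which is not 0, and the numerator is
    small.

    An entire function of finite order with this property is 0 (finite_order_vanish). A
    polynomial that is small at most points of a circle is bounded inside, up to a constant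
    factor, by a power of 4 whose exponent is the number of exceptions (remez). Applied to
    Taylor polynomials, this divides the exponent of growth by a large constant at each
    passage to a smaller circle, which finite order cannot compensate unless g is bounded,
    hence constant. *)

(** * The real norm and convergence *)

Section RealNorm.
Context {R : realType}.
Local Notation C := R[i].

(** The norm of a normed module over R[i] is an element of R[i] that happens to be
    real; estimates are carried out in R. *)
Definition rnorm {V : normedModType C} (x : V) : R := complex.Re `|x|.

Lemma normr_rnorm {V : normedModType C} (x : V) : `|x| = (rnorm x)%:C%C.
Proof.
by rewrite /rnorm; have := normr_ge0 x; case: `|x| => p q; rewrite lecE /= => /andP[/eqP-> _].
Qed.

Lemma rnormC (z : C) : rnorm z = normc z.
Proof. by case: z. Qed.

Section Gen.
Context {V : normedModType C}.
Implicit Types x y : V.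

Lemma rnorm_ge0 x : 0 <= rnorm x.
Proof. by have := normr_ge0 x; rewrite normr_rnorm lecR. Qed.

Lemma rnorm0 : rnorm (0 : V) = 0.
Proof. by rewrite /rnorm normr0. Qed.

Lemma rnorm_eq0 x : rnorm x = 0 -> x = 0.
Proof. by move=> h; apply/normr0_eq0; rewrite normr_rnorm h. Qed.

Lemma rnormD x y : rnorm (x + y) <= rnorm x + rnorm y.
Proof. by rewrite -lecR rmorphD /= -!normr_rnorm ler_normD. Qed.

Lemma rnormN x : rnorm (- x) = rnorm x.
Proof. by rewrite /rnorm normrN. Qed.

Lemma rnormB x y : rnorm (x - y) <= rnorm x + rnorm y.
Proof. by rewrite (le_trans (rnormD _ _))// rnormN. Qed.

Lemma rnorm_distC x y : rnorm (x - y) = rnorm (y - x).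
Proof. by rewrite -rnormN opprB. Qed.

Lemma rnormZ (k : C) x : rnorm (k *: x) = normc k * rnorm x.
Proof. by rewrite {1}/rnorm normrZ [`|x|]normr_rnorm; case: k => p q /=; rewrite mulr0 subr0. Qed.

Lemma rnorm_sum (I : Type) (r : seq I) (P : pred I) (F : I -> V) :
  rnorm (\sum_(i <- r | P i) F i) <= \sum_(i <- r | P i) rnorm (F i).
Proof.
elim/big_rec2: _ => [|i y1 y2 _ h]; first by rewrite rnorm0.
by rewrite (le_trans (rnormD _ _))// lerD2l.
Qed.

(** Balls over R[i] have radii in R[i]. Quantifying over real radii only makes the
    order of R available; tendsP relates the two. *)
Definition tends (u : nat -> V) (l : V) : Prop :=
  forall e : R, 0 < e -> exists N, forall n, (N <= n)%N -> rnorm (u n - l) < e.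

Lemma tendsP (u : nat -> V) (l : V) : (u @ \oo --> l) <-> tends u l.
Proof.
split => [/cvgrPdist_lt h e e0|h].
  have /h [N _ hN] : 0 < e%:C%C by rewrite ltcR.
  by exists N => n Nn; rewrite rnorm_distC -ltcR -normr_rnorm; exact: hN.
apply/cvgrPdist_lt => -[e e'] ; rewrite ltcE /= => /andP[/eqP-> e0].
have [N hN] := h e e0.
by exists N => // n /= Nn; rewrite normr_rnorm ltcR rnorm_distC; exact: hN.
Qed.

Lemma tends_squeeze (u : nat -> V) (l : V) (w : nat -> R) :
  w @ \oo --> (0 : R) -> (forall n, rnorm (u n - l) <= w n) -> tends u l.
Proof.
move=> /cvgrPdist_lt hw h e e0.
have [N _ hN] := hw _ e0.
exists N => n Nn; apply: le_lt_trans (h n) _; apply: le_lt_trans (hN n Nn).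
by rewrite sub0r normrN ler_norm.
Qed.

Lemma tends_dist (u : nat -> V) (l : V) :
  tends u l -> (fun n => rnorm (u n - l)) @ \oo --> (0 : R).
Proof.
move=> h; apply/cvgrPdist_lt => e /h[N hN]; exists N => // n /= Nn.
by rewrite sub0r normrN ger0_norm ?rnorm_ge0// hN.
Qed.

Lemma tends_rnorm (u : nat -> V) (l : V) :
  tends u l -> (fun n => rnorm (u n)) @ \oo --> rnorm l.
Proof.
move=> h; apply/cvgrPdist_lt => e e0.
have [N hN] := h e e0; exists N => // n /= Nn.
apply: le_lt_trans (hN n Nn); rewrite ler_norml.
have h1 := rnormD (u n - l) l; have h2 := rnormD (l - u n) (u n).
by rewrite !subrK in h1 h2; rewrite (rnorm_distC l) in h2; apply/andP; split; lra.
Qed.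

Lemma tends_rnorm_le (u : nat -> V) (l : V) (B : R) :
  tends u l -> (forall n, rnorm (u n) <= B) -> rnorm l <= B.
Proof.
move=> /tends_rnorm h hB; rewrite -(cvg_lim (@norm_hausdorff _ _) h).
by apply: limr_le; [exact: cvgP h|exact: nearW].
Qed.

Lemma tends_unique (u : nat -> V) (l l' : V) : tends u l -> tends u l' -> l = l'.
Proof.
move=> h h'; apply/eqP; rewrite -subr_eq0; apply/eqP/rnorm_eq0/eqP.
rewrite eq_le rnorm_ge0 andbT leNgt; apply/negP => d0.
have d2 : 0 < rnorm (l - l') / 2 by rewrite divr_gt0.
have [N hN] := h _ d2; have [N' hN'] := h' _ d2.
have := hN _ (leq_maxl N N'); have := hN' _ (leq_maxr N N').
set u' := u _ => h1 h2.
have := rnormB (u' - l') (u' - l); rewrite opprB addrC addrA subrK; lra.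
Qed.

Lemma tends_cst (l : V) : tends (fun=> l) l.
Proof. by move=> e e0; exists 0%N => n _; rewrite subrr rnorm0. Qed.

Lemma tendsD (u v : nat -> V) (l m : V) : tends u l -> tends v m ->
  tends (fun n => u n + v n) (l + m).
Proof.
move=> /tends_dist h /tends_dist h'; apply: (@tends_squeeze _ _ (fun n => rnorm (u n - l) + rnorm (v n - m))).
  by rewrite -(addr0 (0 : R)); exact: cvgD h h'.
by move=> n; rewrite opprD addrACA rnormD.
Qed.

Lemma tendsZ (k : C) (u : nat -> V) (l : V) : tends u l -> tends (fun n => k *: u n) (k *: l).
Proof.
move=> /tends_dist h; apply: (@tends_squeeze _ _ (fun n => normc k * rnorm (u n - l))).
  by rewrite -(mulr0 (normc k)); apply: cvgM => //; exact: cvg_cst.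
by move=> n; rewrite -scalerBr rnormZ.
Qed.

Lemma tendsB (u v : nat -> V) (l m : V) : tends u l -> tends v m ->
  tends (fun n => u n - v n) (l - m).
Proof.
move=> h h'; have := tendsD h (@tendsZ (-1) _ _ h').
by rewrite scaleN1r; congr tends; apply/funext => n; rewrite scaleN1r.
Qed.

Lemma tends_shift (u : nat -> V) (l : V) m : tends u l -> tends (fun n => u (n + m)%N) l.
Proof.
move=> h e e0; have [N hN] := h e e0; exists N => n Nn.
by apply: hN; rewrite (leq_trans Nn)// leq_addr.
Qed.

Lemma tends_eventually (u v : nat -> V) (l : V) m :
  (forall n, (m <= n)%N -> u n = v n) -> tends u l -> tends v l.
Proof.
move=> huv h e e0; have [N hN] := h e e0; exists (maxn N m) => n.
by rewrite geq_max => /andP[Nn mn]; rewrite -huv// hN.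
Qed.

End Gen.

Lemma normc_ge0 (z : C) : 0 <= normc z.
Proof. by rewrite -rnormC rnorm_ge0. Qed.

Lemma normc_real (x : R) : normc x%:C%C = `|x|.
Proof. by rewrite /= expr0n /= addr0 sqrtr_sqr. Qed.

Lemma normcX (z : C) n : normc (z ^+ n) = normc z ^+ n.
Proof. by elim: n => [|n IH]; rewrite ?expr0 ?normc1// !exprS normcM IH. Qed.

Lemma normcB (x y : C) : normc (x - y) <= normc x + normc y.
Proof. by rewrite -!rnormC rnormB. Qed.

Lemma normc_conj (z : C) : normc z^*%C = normc z.
Proof. by case: z => p q /=; rewrite sqrrN. Qed.

Lemma normc_gt0 (z : C) : z != 0 -> 0 < normc z.
Proof.
move=> z0; rewrite lt_neqAle normc_ge0 andbT eq_sym.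
by apply: contra z0 => /eqP/eq0_normc ->.
Qed.

Lemma normc_prod (I : Type) (r : seq I) (P : pred I) (F : I -> C) :
  normc (\prod_(i <- r | P i) F i) = \prod_(i <- r | P i) normc (F i).
Proof. by elim/big_rec2: _ => [|i y1 y2 _ <-]; rewrite ?normc1 ?normcM. Qed.

Lemma normc_Re (z : C) : `|complex.Re z| <= normc z.
Proof.
case: z => p q /=; rewrite -(@ler_pXn2r _ 2)// ?nnegrE ?sqrtr_ge0//.
by rewrite sqr_sqrtr ?addr_ge0 ?sqr_ge0// real_normK ?num_real// lerDl sqr_ge0.
Qed.

Lemma normc_Im (z : C) : `|complex.Im z| <= normc z.
Proof.
case: z => p q /=; rewrite -(@ler_pXn2r _ 2)// ?nnegrE ?sqrtr_ge0//.
by rewrite sqr_sqrtr ?addr_ge0 ?sqr_ge0// real_normK ?num_real// lerDr sqr_ge0.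
Qed.

Lemma normc_le_ReIm (z : C) : normc z <= `|complex.Re z| + `|complex.Im z|.
Proof.
case: z => p q /=; rewrite -(@ler_pXn2r _ 2)// ?nnegrE ?sqrtr_ge0 ?addr_ge0//.
rewrite sqr_sqrtr ?addr_ge0 ?sqr_ge0// sqrrD !real_normK ?num_real//.
have := mulr_ge0 (normr_ge0 p) (normr_ge0 q); lra.
Qed.

(** Completeness enters only through power series, so convergence of absolutely
    convergent series is the right form of it. *)
Definition summable_complete (V : normedModType C) :=
  forall (Y : nat -> V) (B : R), (forall n, \sum_(0 <= k < n) rnorm (Y k) <= B) ->
  exists y : V, tends (fun n => \sum_(0 <= k < n) Y k) y.

Lemma real_abs_summable (u : nat -> R) (B : R) :
  (forall n, \sum_(0 <= k < n) `|u k| <= B) -> cvgn (series u).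
Proof.
move=> h; apply: normed_cvg.
apply: nondecreasing_is_cvgn.
  by apply/nondecreasing_seqP => n; rewrite /= /series /= big_nat_recr//= lerDl.
by exists B => _ [n _ <-]; exact: h.
Qed.

Lemma real_summable_tail (u : nat -> R) (B : R) : (forall n, 0 <= u n) ->
  (forall n, \sum_(0 <= k < n) u k <= B) ->
  forall e, 0 < e -> exists N, forall m n, (N <= m)%N -> \sum_(m <= k < n) u k < e.
Proof.
move=> u0 h e e0.
have hl : cvgn (series u).
  apply: (@real_abs_summable _ B) => n.
  by rewrite (eq_bigr u) // => k _; rewrite ger0_norm.
set l := limn (series u) in hl.
move/cvgrPdist_lt : (hl) => /(_ _ e0)[N _ hN].
have nd : nondecreasing_seq (series u).
  by apply/nondecreasing_seqP => n; rewrite /series /= big_nat_recr//= lerDl.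
have le_l n : series u n <= l.
  exact: nondecreasing_cvgn_le.
exists N => m n Nm.
have [mn|nm] := leqP m n; last by rewrite big_geq// ltnW.
have := hN m Nm; rewrite ger0_norm ?subr_ge0//.
have := le_l n; rewrite /series /= (big_cat_nat (leq0n m) mn)//=; lra.
Qed.

Lemma cvg_dist0 (u : nat -> R) (l : R) :
  u @ \oo --> l -> (fun n => `|u n - l|) @ \oo --> (0 : R).
Proof.
move=> /cvgrPdist_lt h; apply/cvgrPdist_lt => e e0.
by apply: filterS (h e e0) => n; rewrite sub0r normrN normr_id distrC.
Qed.

Lemma complex_complete : summable_complete C.
Proof.
move=> Y B h.
have hRe : cvgn (series (fun k => complex.Re (Y k))).
  apply: (@real_abs_summable _ B) => n; apply: le_trans (h n).
  by apply: ler_sum => k _; rewrite rnormC normc_Re.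
have hIm : cvgn (series (fun k => complex.Im (Y k))).
  apply: (@real_abs_summable _ B) => n; apply: le_trans (h n).
  by apply: ler_sum => k _; rewrite rnormC normc_Im.
pose y := (limn (series (fun k => complex.Re (Y k))) +i* limn (series (fun k => complex.Im (Y k))))%C.
exists y.
apply: (@tends_squeeze _ _ _ (fun n => `|series (fun k => complex.Re (Y k)) n - complex.Re y| +
   `|series (fun k => complex.Im (Y k)) n - complex.Im y|)).
  rewrite -(addr0 (0 : R)); apply: cvgD.
  exact: cvg_dist0 hRe.
  exact: cvg_dist0 hIm.
move=> n; rewrite rnormC; apply: le_trans (normc_le_ReIm _) _.
by rewrite !raddfB /= !raddf_sum.
Qed.

End RealNorm.

(** * Power series with coefficients in a normed module *)

Section PowerSeries.
Context {R : realType}.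
Local Notation C := R[i].

Definition psum {V : normedModType C} (u : nat -> V) (z : C) (n : nat) : V :=
  \sum_(0 <= k < n) z ^+ k *: u k.

(** Cauchy's bounds, which stand for analyticity in the disc of radius r with values
    bounded by B: the two notions agree up to a constant factor in the radius. *)
Definition coef_le {V : normedModType C} (u : nat -> V) (r B : R) : Prop :=
  forall k, rnorm (u k) * r ^+ k <= B.

(** Cauchy product: the coefficients of the product of two power series. *)
Definition cprod {V : normedModType C} (u : nat -> C) (Y : nat -> V) (k : nat) : V :=
  \sum_(i < k.+1) u i *: Y (k - i)%N.

(** The coefficients of u(z) / (1 - z / l). *)
Fixpoint zero_quotient {V : normedModType C} (l : C) (u : nat -> V) (k : nat) : V :=
  if k is k'.+1 then u k + l^-1 *: zero_quotient l u k' else u 0%N.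

Lemma geo_sum_le (q : R) (n m : nat) : 0 <= q -> q < 1 ->
  \sum_(n <= k < m) q ^+ k <= q ^+ n / (1 - q).
Proof.
move=> q0 q1; have d0 : 0 < 1 - q by lra.
have [nm|/ltnW mn] := leqP n m; last by rewrite big_geq// divr_ge0 ?exprn_ge0// ltW.
rewrite ler_pdivlMr//.
suff -> : (\sum_(n <= k < m) q ^+ k) * (1 - q) = q ^+ n - q ^+ m.
  by have := exprn_ge0 m q0; lra.
elim: m nm => [|m IH]; first by rewrite leqn0 => /eqP ->; rewrite big_geq// mul0r subrr.
rewrite leq_eqVlt => /orP[/eqP ->|nm]; first by rewrite big_geq// mul0r subrr.
by rewrite big_nat_recr//= mulrDl IH// exprS; ring.
Qed.

Lemma cvg_half (B : R) : (fun n => B * 2^-1 ^+ n) @ \oo --> (0 : R).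
Proof.
rewrite -(mulr0 B); apply: cvgM; first exact: cvg_cst.
by apply: cvg_expr; rewrite ger0_norm; lra.
Qed.

Lemma succ_le_pow2 k : (k.+1%:R : R) <= 2 ^+ k.
Proof. by rewrite -natrX ler_nat ltn_expl. Qed.

Section Gen.
Context {V : normedModType C}.
Implicit Types (u Y : nat -> V) (r B D q : R) (z l : C) (y : V).

Lemma coef_leW u r r' B B' : 0 <= r' -> r' <= r -> B <= B' -> coef_le u r B -> coef_le u r' B'.
Proof.
move=> r0 rr BB h k; apply: le_trans (le_trans (h k) BB).
apply: ler_wpM2l; first exact: rnorm_ge0.
by apply: lerXn2r; rewrite ?nnegrE //; lra.
Qed.

Lemma coef_le_ge0 u r B : coef_le u r B -> 0 <= B.
Proof. by move/(_ 0%N); apply: le_trans; rewrite expr0 mulr1 rnorm_ge0. Qed.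

Lemma coef_le_term u r B z q k : 0 < r -> coef_le u r B -> normc z <= q * r ->
  0 <= q -> rnorm (z ^+ k *: u k) <= B * q ^+ k.
Proof.
move=> r0 h hz q0; rewrite rnormZ normcX.
apply: le_trans (_ : (q * r) ^+ k * rnorm (u k) <= _).
  apply: ler_wpM2r; first exact: rnorm_ge0.
  by apply: lerXn2r; rewrite ?nnegrE ?normc_ge0 ?mulr_ge0// ltW.
rewrite exprMn -mulrA [r ^+ k * _]mulrC mulrC.
rewrite [leRHS]mulrC [r ^+ k * _]mulrC; apply: ler_wpM2l; last exact: h.
exact: exprn_ge0.
Qed.

Lemma psum_abs u r B z q n m : 0 < r -> coef_le u r B -> normc z <= q * r ->
  0 <= q -> q < 1 -> \sum_(n <= k < m) rnorm (z ^+ k *: u k) <= B * (q ^+ n / (1 - q)).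
Proof.
move=> r0 h hz q0 q1.
apply: le_trans (_ : \sum_(n <= k < m) B * q ^+ k <= _).
  by apply: ler_sum => k _; exact: coef_le_term h hz q0.
rewrite -mulr_sumr; apply: ler_wpM2l; first exact: coef_le_ge0 h.
exact: geo_sum_le.
Qed.

Lemma psum_dist u r B z q n m : 0 < r -> coef_le u r B -> normc z <= q * r ->
  0 <= q -> q < 1 -> (n <= m)%N ->
  rnorm (psum u z m - psum u z n) <= B * (q ^+ n / (1 - q)).
Proof.
move=> r0 h hz q0 q1 nm.
rewrite /psum (big_cat_nat (leq0n n) nm)//= [X in rnorm X]addrC addKr.
by apply: le_trans (rnorm_sum _ _ _) _; exact: (psum_abs _ _ r0 h hz q0 q1).
Qed.

Lemma psum_tail u r B z q n y : 0 < r -> coef_le u r B -> normc z <= q * r ->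
  0 <= q -> q < 1 -> tends (psum u z) y ->
  rnorm (psum u z n - y) <= B * (q ^+ n / (1 - q)).
Proof.
move=> r0 h hz q0 q1 hy.
rewrite rnorm_distC; apply: (@tends_rnorm_le _ _ (fun m => psum u z (m + n)%N - psum u z n)).
  by apply: tendsB (tends_cst _); exact: tends_shift.
by move=> m; apply: (psum_dist r0 h hz q0 q1); rewrite leq_addl.
Qed.

Lemma psum_cvg u r B z q : summable_complete V -> 0 < r -> coef_le u r B ->
  normc z <= q * r -> 0 <= q -> q < 1 -> exists y, tends (psum u z) y.
Proof.
move=> cV r0 h hz q0 q1.
apply: (cV _ (B * (q ^+ 0 / (1 - q)))) => n.
exact: (psum_abs _ _ r0 h hz q0 q1).
Qed.

Lemma psum_lim_le u r B z q y : 0 < r -> coef_le u r B -> normc z <= q * r ->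
  0 <= q -> q < 1 -> tends (psum u z) y -> rnorm y <= B / (1 - q).
Proof.
move=> r0 h hz q0 q1 hy.
by have := psum_tail 0 r0 h hz q0 q1 hy; rewrite /psum big_geq// sub0r rnormN expr0 mul1r.
Qed.

Lemma zero_quotientE u l k : l != 0 -> l ^+ k *: zero_quotient l u k = psum u l k.+1.
Proof.
move=> l0; elim: k => [|k IH] /=.
  by rewrite /psum big_nat1.
rewrite scalerDr scalerA exprSr mulfK// IH /psum [in RHS]big_nat_recr//= addrC.
by rewrite exprSr.
Qed.

(** By zero_quotientE the left-hand side is a tail of the series for u(l), hence
    geometrically small. When u(l) = y = 0, the bound on the quotient is a third of the
    bound on u: this gain is what makes the successive removal of zeros stop. *)
Lemma zero_quotient_bound u l y r D k : l != 0 -> 0 < r -> normc l <= 4^-1 * r ->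
  coef_le u r D -> tends (psum u l) y ->
  rnorm (zero_quotient l u k - l ^- k *: y) * r ^+ k <= D / 3.
Proof.
move=> l0 r0 hl h hy.
have nl0 := normc_gt0 l0.
pose q := normc l / r.
have q0 : 0 <= q by rewrite divr_ge0 ?normc_ge0// ltW.
have q4 : q <= 4^-1 by rewrite ler_pdivrMr.
have hlq : normc l <= q * r by rewrite divfK// gt_eqF.
have -> : zero_quotient l u k - l ^- k *: y = l ^- k *: (psum u l k.+1 - y).
  by rewrite -zero_quotientE// scalerBr scalerA mulVf ?scale1r// expf_neq0.
have q1 : q < 1 by lra.
rewrite rnormZ normcV normcX.
have t := psum_tail k.+1 r0 h hlq q0 q1 hy.
have D0 := coef_le_ge0 h.
have -> : (normc l ^+ k)^-1 * rnorm (psum u l k.+1 - y) * r ^+ k =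
   rnorm (psum u l k.+1 - y) / q ^+ k.
  rewrite /q expr_div_n; field; rewrite ?expf_neq0 ?gt_eqF//.
have qk : 0 < q ^+ k by rewrite exprn_gt0// divr_gt0.
rewrite ler_pdivrMr//; apply: le_trans t _.
rewrite exprS -[leRHS]mulrA ler_wpM2l// mulrAC ler_wpM2r//; first exact: ltW.
have d0 : 0 < 1 - q by lra.
by rewrite ler_pdivrMr//; lra.
Qed.

End Gen.

Section Cprod.
Context {V : normedModType C}.
Implicit Types (u : nat -> C) (Y : nat -> V) (r B : R).

Lemma cprod_bound u Y r B1 B2 k : 0 < r -> coef_le u r B1 -> coef_le Y r B2 ->
  rnorm (cprod u Y k) * r ^+ k <= k.+1%:R * (B1 * B2).
Proof.
move=> r0 hu hY.
apply: le_trans (_ : (\sum_(i < k.+1) rnorm (u i *: Y (k - i)%N)) * r ^+ k <= _).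
  by apply: ler_wpM2r (rnorm_sum _ _ _); rewrite exprn_ge0// ltW.
rewrite mulr_suml mulr_natl -[X in _ *+ X]card_ord -sumr_const.
apply: ler_sum => i _; rewrite rnormZ -rnormC.
have := hu i; have := hY (k - i)%N.
have e : r ^+ k = r ^+ i * r ^+ (k - i) by rewrite -exprD subnKC// -ltnS.
rewrite e => h1 h2; rewrite mulrACA.
by apply: ler_pM => //; rewrite mulr_ge0 ?rnorm_ge0 ?exprn_ge0 ?ltW.
Qed.

(** The k + 1 terms of the k-th coefficient are absorbed by halving the radius, as
    k + 1 <= 2^k. *)
Lemma coef_le_cprod u Y r B1 B2 : 0 < r -> coef_le u r B1 -> coef_le Y r B2 ->
  coef_le (cprod u Y) (2^-1 * r) (B1 * B2).
Proof.
move=> r0 hu hY k; rewrite exprMn mulrCA.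
have h := cprod_bound k r0 hu hY.
have B0 : 0 <= B1 * B2 by apply: mulr_ge0; [exact: coef_le_ge0 hu|exact: coef_le_ge0 hY].
have p0 : 0 < (2 : R) ^+ k by rewrite exprn_gt0.
rewrite exprVn mulrC ler_pdivrMr//; apply: le_trans h _.
by rewrite mulrC ler_wpM2l// succ_le_pow2.
Qed.

End Cprod.

Lemma cprod_poly (u v : nat -> C) n k : (k < n)%N ->
  cprod u v k = (\poly_(i < n) u i * \poly_(i < n) v i)`_k.
Proof.
move=> kn; rewrite coefM; apply: eq_bigr => i _; rewrite !coef_poly.
have hi : (i < n)%N by apply: leq_trans kn; rewrite ltnS -ltnS.
by rewrite hi (leq_ltn_trans (leq_subr _ _) kn).
Qed.

Lemma psum_poly (u : nat -> C) z n : psum u z n = (\poly_(i < n) u i).[z].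
Proof.
rewrite horner_poly /psum big_mkord; apply: eq_bigr => i _.
by rewrite mulrC.
Qed.

Lemma complex_tendsM (u v : nat -> C) (a b : C) : tends u a -> tends v b ->
  tends (fun n => u n * v n) (a * b).
Proof.
move=> hu hv.
apply: (@tends_squeeze _ _ _ _ (fun n => rnorm (u n - a) * rnorm (v n) + normc a * rnorm (v n - b))).
  rewrite -[X in _ --> X](_ : 0 * rnorm b + normc a * 0 = 0); last by rewrite mul0r mulr0 addr0.
  apply: cvgD; first by apply: cvgM; [exact: tends_dist|exact: tends_rnorm].
  by apply: cvgM; [exact: cvg_cst|exact: tends_dist].
move=> n; rewrite !rnormC -!normcM.
have -> : u n * v n - a * b = (u n - a) * v n + a * (v n - b) by ring.
exact: le_normcD.
Qed.

(** The product of the partial sums is the partial sum of order 2n of the product of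
    the Taylor polynomials, whose terms of order at least n are negligible. *)
Lemma psum_cprod (u v : nat -> C) (r B1 B2 : R) (z a b : C) : 0 < r -> coef_le u r B1 -> coef_le v r B2 ->
  normc z <= 4^-1 * r -> tends (psum u z) a -> tends (psum v z) b ->
  tends (psum (cprod u v) z) (a * b).
Proof.
move=> r0 hu hv hz ha hb.
have hab : tends (fun n => psum u z n * psum v z n) (a * b) by exact: complex_tendsM.
have hd : tends (fun n => psum (cprod u v) z n - psum u z n * psum v z n) (0 : C).
  apply: (@tends_squeeze _ _ _ _ (fun n => (B1 * B2 * 2) * 2^-1 ^+ n)); first exact: cvg_half.
  move=> n; rewrite subr0 rnorm_distC.
  set U := \poly_(i < n) u i; set W := \poly_(i < n) v i.
  have hU : coef_le (fun i => U`_i) r B1.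
    move=> i; rewrite coef_poly; case: ifP => // _.
    by rewrite rnorm0 mul0r (coef_le_ge0 hu).
  have hW : coef_le (fun i => W`_i) r B2.
    move=> i; rewrite coef_poly; case: ifP => // _.
    by rewrite rnorm0 mul0r (coef_le_ge0 hv).
  have e1 : psum u z n * psum v z n = psum (cprod (fun i => U`_i) (fun i => W`_i)) z (n + n).
    rewrite (psum_poly u) (psum_poly v) -hornerM -/U -/W psum_poly; congr (_.[z]).
    apply/polyP => k; rewrite coef_poly; case: ltnP => h.
      by rewrite coefM.
    apply/nth_default; apply: leq_trans (size_polyMleq _ _) _.
    have := size_poly n u; have := size_poly n v; rewrite -/U -/W; lia.
  have e2 : psum (cprod u v) z n = psum (cprod (fun i => U`_i) (fun i => W`_i)) z n.
    rewrite /psum; apply: eq_big_nat => k /andP[_ kn]; congr (_ *: _).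
    by rewrite (cprod_poly _ _ kn) coefM.
  rewrite e1 e2.
  have hc := coef_le_cprod r0 hU hW.
  have r2 : 0 < 2^-1 * r by lra.
  have hz2 : normc z <= 2^-1 * (2^-1 * r) by lra.
  have h0 : 0 <= (2^-1 : R) by lra.
  have h1 : (2^-1 : R) < 1 by lra.
  apply: le_trans (psum_dist r2 hc hz2 h0 h1 (leq_addr n n)) _.
  have -> : 1 - 2^-1 = 2^-1 :> R by lra.
  by rewrite invrK mulrA mulrAC.
have := tendsD hd hab; rewrite add0r; apply: (tends_eventually (m := 0%N)) => n _.
by rewrite subrK.
Qed.

End PowerSeries.

(** * Roots of unity: Cauchy and Remez estimates *)

Section UnityRoots.
Context {R : realType}.
Local Notation C := R[i].

Lemma complex_prim_root n : (0 < n)%N -> exists w : C, n.-primitive_root w.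
Proof.
pose p : {poly C} := 'X^n - 1; have [r Dp] := closed_field_poly_normal p.
move=> n_gt0; rewrite (monicP _) ?monicXnsubC // scale1r in Dp.
have rn1 : all n.-unity_root r by apply/allP=> z; rewrite -root_prod_XsubC -Dp.
have sz_r : (n < (size r).+1)%N.
  by rewrite -(size_prod_XsubC r id) -Dp size_XnsubC.
have [|z] := hasP (has_prim_root n_gt0 rn1 _ sz_r); last by exists z.
by rewrite -separable_prod_XsubC -Dp separable_Xn_sub_1 // pnatr_eq0 -lt0n.
Qed.

Lemma normc_prim_root n (w : C) : n.-primitive_root w -> normc w = 1.
Proof.
move=> hw; have n0 := prim_order_gt0 hw.
have : normc w ^+ n = 1 by rewrite -normcX (prim_expr_order hw) normc1.
by move=> /eqP; rewrite (pexpr_eq1 n0 (normc_ge0 w)) => /eqP.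
Qed.

Lemma prim_root_neq0 n (w : C) : n.-primitive_root w -> w != 0.
Proof.
by move=> hw; apply/eqP => w0; have := normc_prim_root hw; rewrite w0 normc0 => /esym/eqP; rewrite oner_eq0.
Qed.

Lemma sum_prim_root n (w : C) i k : n.-primitive_root w -> (i < n)%N -> (k < n)%N ->
  \sum_(j < n) (w ^+ j) ^+ i * (w ^+ j) ^- k = (n * (i == k))%:R.
Proof.
move=> hw i_n kn; have w0 := prim_root_neq0 hw.
have [<-|ik] := eqVneq i k.
  rewrite muln1 (eq_bigr (fun=> 1)); first by rewrite sumr_const card_ord.
  by move=> j _; rewrite mulfV// expf_neq0// expf_neq0.
pose x := w ^+ i / w ^+ k.
rewrite muln0 (eq_bigr (fun j : 'I_n => x ^+ j)); last first.
  by move=> j _; rewrite /x expr_div_n -!exprM ![(j * _)%N]mulnC.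
have xn1 : x ^+ n = 1.
  rewrite /x expr_div_n -!exprM ![(_ * n)%N]mulnC !exprM (prim_expr_order hw).
  by rewrite !expr1n divr1.
have x1 : x - 1 != 0.
  rewrite subr_eq0; apply: contra ik => /eqP h.
  have : w ^+ i == w ^+ k by rewrite -[w ^+ i](divfK (expf_neq0 k w0)) -/x h mul1r.
  by rewrite (eq_prim_root_expr hw) !modn_small.
by apply: (mulfI x1); rewrite mulr0 -subrX1 xn1 subrr.
Qed.

(** Discrete Cauchy formula: averages over the n-th roots of unity separate the
    monomials of degree less than n. *)
Lemma unity_interpolation n (w : C) (a : nat -> C) y : n.-primitive_root w ->
  n%:R * psum a y n =
  \sum_(j < n) psum a (w ^+ j) n * \sum_(k < n) (y / w ^+ j) ^+ k.
Proof.
move=> hw.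
under eq_bigr => j _ do rewrite /psum big_mkord big_distrlr /=.
rewrite exchange_big /= /psum big_mkord mulr_sumr; apply: eq_bigr => i _.
rewrite exchange_big /= (bigD1 i)//= [X in _ + X]big1 ?addr0.
  rewrite (eq_bigr (fun j : 'I_n => (y ^+ i * a i) * ((w ^+ j) ^+ i * (w ^+ j) ^- i))).
    by rewrite -mulr_sumr sum_prim_root// eqxx muln1 mulrC.
  by move=> j _; rewrite /GRing.scale /= expr_div_n; ring.
move=> k ki.
rewrite (eq_bigr (fun j : 'I_n => (y ^+ k * a i) * ((w ^+ j) ^+ i * (w ^+ j) ^- k))).
  rewrite -mulr_sumr sum_prim_root// [(i == k :> nat)](_ : _ = false) ?muln0 ?mulr0//.
  by apply/negbTE; rewrite eq_sym.
by move=> j _; rewrite /GRing.scale /= expr_div_n; ring.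
Qed.

(** Cauchy's inequality for polynomials, with the integral replaced by an exact
    average over roots of unity. *)
Lemma cauchy_coef n (w : C) (a : nat -> C) (B : R) k : n.-primitive_root w ->
  (k < n)%N -> (forall j : 'I_n, normc (psum a (w ^+ j) n) <= B) -> normc (a k) <= B.
Proof.
move=> hw kn hB; have n0 := prim_order_gt0 hw; have w0 := prim_root_neq0 hw.
have e : n%:R * a k = \sum_(j < n) psum a (w ^+ j) n * (w ^+ j) ^- k.
  under eq_bigr => j _ do rewrite /psum big_mkord big_distrl /=.
  rewrite exchange_big /= (bigD1 (Ordinal kn))//= [X in _ + X]big1 ?addr0.
    rewrite (eq_bigr (fun j : 'I_n => a k * ((w ^+ j) ^+ k * (w ^+ j) ^- k))).
      by rewrite -mulr_sumr sum_prim_root// eqxx muln1 mulrC.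
    by move=> j _; rewrite /GRing.scale /=; ring.
  move=> i ik.
  rewrite (eq_bigr (fun j : 'I_n => a i * ((w ^+ j) ^+ i * (w ^+ j) ^- k))).
    rewrite -mulr_sumr sum_prim_root// [(i == k :> nat)](_ : _ = false) ?muln0 ?mulr0//.
    exact/negbTE.
  by move=> j _; rewrite /GRing.scale /=; ring.
have nn : normc (n%:R : C) = n%:R by rewrite -[n%:R](rmorph_nat (real_complex R)) normc_real normr_nat.
have n0R : 0 < n%:R :> R by rewrite ltr0n.
rewrite -(ler_pM2l n0R) -{1}nn -normcM e -rnormC.
apply: le_trans (rnorm_sum _ _ _) _.
rewrite mulr_natl -[X in _ *+ X]card_ord -sumr_const; apply: ler_sum => j _.
by rewrite rnormC normcM normcV !normcX (normc_prim_root hw) !expr1n invr1 mulr1.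
Qed.

(** Let W be the monic polynomial that vanishes at the bad points. Then p * W is
    controlled at all the sample points, so the discrete Cauchy formula bounds it at z.
    A factor of W is at most 2 * rho at a sample point and at least rho / 2 at z, which
    costs a factor 4 for each bad point. *)
Lemma remez (n : nat) (w c z : C) (rho B : R) (p : {poly C}) (bad : {set 'I_n}) :
  n.-primitive_root w -> 0 < rho -> 0 <= B -> (size p + #|bad| <= n)%N ->
  normc (z - c) <= rho / 2 ->
  (forall j : 'I_n, j \notin bad -> normc p.[c + rho%:C%C * w ^+ j] <= B) ->
  normc p.[z] <= 2 * B * 4 ^+ #|bad|.
Proof.
move=> hw rho0 B0 hsz hz hB; have n0 := prim_order_gt0 hw; have w0 := prim_root_neq0 hw.
have n0R : 0 < n%:R :> R by rewrite ltr0n.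
have rC0 : rho%:C%C != 0 :> C by rewrite eq_complex /= eqxx andbT gt_eqF.
pose zz j := c + rho%:C%C * w ^+ (j : 'I_n).
pose W := \prod_(j in bad) ('X - (zz j)%:P).
pose q := (p * W) \Po (rho%:C%C *: 'X + c%:P).
pose y := (z - c) / rho%:C%C.
have ny : normc y <= 2^-1.
  by rewrite /y normcM normcV normc_real gtr0_norm// ler_pdivrMr// mulrC.
have zE : rho%:C%C * y + c = z by rewrite /y mulrC divfK// subrK.
have qE x : q.[x] = (p * W).[rho%:C%C * x + c].
  by rewrite /q horner_comp hornerD hornerZ hornerX hornerC.
have sW : size W = #|bad|.+1 by rewrite /W -big_enum size_prod_XsubC -cardE.
have sq : (size q <= n)%N.
  apply: leq_trans (size_comp_poly_leq _ _) _.
  have s1 : ((size (rho%:C%C *: 'X + c%:P : {poly C})%R).-1 <= 1)%N.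
    rewrite -subn1 leq_subLR.
    apply: leq_trans (size_polyD _ _) _; rewrite geq_max size_polyC.
    by rewrite (leq_trans (size_scale_leq _ _))// ?size_polyX//; case: (c == 0).
  have [->|p0] := eqVneq p 0; first by rewrite mul0r size_poly0 mul0n.
  have := size_polyMleq p W; rewrite sW; have : (0 < size p)%N by rewrite size_poly_gt0.
  move=> h1 h2; apply: leq_ltn_trans (leq_mul (leqnn _) s1) _.
  move: h2; rewrite muln1 addnS /=; case: (size _) => [|k] h2; first exact: n0.
  exact: leq_trans h2 hsz.
have qps x : psum (fun i => q`_i) x n = q.[x].
  by rewrite psum_poly; congr (_.[x]); apply/polyP => i; rewrite coef_poly; case: ltnP => // h;
    rewrite nth_default// (leq_trans sq).
have := unity_interpolation (fun i => q`_i) y hw.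
rewrite qps qE zE => e.
have hK j : normc (\sum_(k < n) (y / w ^+ (j : 'I_n)) ^+ k) <= 2.
  rewrite -rnormC; apply: le_trans (rnorm_sum _ _ _) _.
  apply: le_trans (_ : \sum_(0 <= k < n) 2^-1 ^+ k <= _).
    rewrite big_mkord; apply: ler_sum => k _.
    rewrite rnormC normcX normcM normcV normcX (normc_prim_root hw) expr1n invr1 mulr1.
    by apply: lerXn2r; rewrite ?nnegrE ?normc_ge0.
  have := @geo_sum_le R 2^-1 0 n; rewrite expr0.
  have -> : 1 - 2^-1 = 2^-1 :> R by lra.
  by rewrite invrK mul1r; apply; lra.
have WE x : W.[x] = \prod_(j in bad) (x - zz j).
  by rewrite /W horner_prod; apply: eq_bigr => j _; rewrite hornerXsubC.
have zzE j : rho%:C%C * w ^+ (j : 'I_n) + c = zz j by rewrite addrC.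
have hmain : n%:R * (normc p.[z] * normc W.[z]) <= n%:R * (2 * B * (2 * rho) ^+ #|bad|).
  have nn : normc (n%:R : C) = n%:R.
    by rewrite -[n%:R](rmorph_nat (real_complex R)) normc_real normr_nat.
  rewrite -normcM -hornerM -{1}nn -normcM e -rnormC.
  apply: le_trans (rnorm_sum _ _ _) _.
  rewrite mulr_natl -[X in _ *+ X]card_ord -sumr_const; apply: ler_sum => j _.
  rewrite rnormC normcM qps qE hornerM zzE normcM.
  have [jb|jb] := boolP (j \in bad).
    rewrite WE (bigD1 j)//= subrr mul0r normc0 mulr0 mul0r.
    by rewrite !mulr_ge0// exprn_ge0// mulr_ge0// ltW.
  have hp := hB j jb.
  have hW : normc W.[zz j] <= (2 * rho) ^+ #|bad|.
    rewrite WE normc_prod -prodr_const; apply: ler_prod => i _.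
    rewrite normc_ge0 /=; have -> : zz j - zz i = rho%:C%C * (w ^+ j - w ^+ i).
      by rewrite /zz; ring.
    rewrite normcM normc_real gtr0_norm// mulrC ler_wpM2r ?(ltW rho0)//.
    apply: le_trans (normcB _ _) _.
    by rewrite !normcX (normc_prim_root hw) !expr1n.
  rewrite mulrC -[leRHS]mulrA; apply: ler_pM; rewrite ?normc_ge0 ?mulr_ge0 ?normc_ge0//.
  by apply: ler_pM; rewrite ?normc_ge0.
have hWz : (rho / 2) ^+ #|bad| <= normc W.[z].
  rewrite WE normc_prod -prodr_const; apply: ler_prod => i _.
  apply/andP; split; first by rewrite divr_ge0// ltW.
  have : normc (zz i - c) = rho.
    by rewrite /zz addrC addKr normcM normc_real gtr0_norm// normcX (normc_prim_root hw) expr1n mulr1.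
  have -> : zz i - c = (z - c) - (z - zz i) by ring.
  by have := normcB (z - c) (z - zz i); lra.
move: hmain; rewrite ler_pM2l// => hmain.
have r2 : 0 < (rho / 2) ^+ #|bad| by rewrite exprn_gt0// divr_gt0.
rewrite -(ler_pM2r r2).
apply: le_trans (_ : normc p.[z] * normc W.[z] <= _).
  by rewrite ler_wpM2l ?normc_ge0.
apply: le_trans hmain _; rewrite -[leRHS]mulrA -exprMn.
by have -> : 4 * (rho / 2) = 2 * rho by field.
Qed.

End UnityRoots.

(** * Division of power series by polynomials *)

Section Division.
Context {R : realType}.
Local Notation C := R[i].

(** The Taylor polynomials of g satisfy the estimate up to an error that vanishes
    with the degree, and cauchy_coef applies to them. *)
Lemma cauchy_estimate (g : nat -> C) (r B rho M : R) : 0 < r -> 0 < rho ->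
  coef_le g r B -> rho <= 2^-1 * r ->
  (forall z y, normc z = rho -> tends (psum g z) y -> normc y <= M) ->
  coef_le g rho M.
Proof.
move=> r0 rho0 hg hr hM k; rewrite rnormC.
have B0 := coef_le_ge0 hg.
have h n : (k < n)%N -> normc (g k) * rho ^+ k <= M + B * 2 * 2^-1 ^+ n.
  move=> kn; have n0 : (0 < n)%N by apply: leq_ltn_trans kn.
  have [w hw] := @complex_prim_root R _ n0.
  have -> : normc (g k) * rho ^+ k = normc (rho%:C%C ^+ k * g k).
    by rewrite normcM normcX normc_real gtr0_norm// mulrC.
  apply: (@cauchy_coef _ n w (fun i => rho%:C%C ^+ i * g i) _ k hw kn) => j.
  have -> : psum (fun i => rho%:C%C ^+ i * g i) (w ^+ j) n = psum g (rho%:C%C * w ^+ j) n.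
    by apply: eq_bigr => i _; rewrite exprMn /GRing.scale /= mulrA [w ^+ j ^+ i * _]mulrC.
  set z := _ * w ^+ j.
  have nz : normc z = rho.
    by rewrite normcM normc_real gtr0_norm// normcX (normc_prim_root hw) expr1n mulr1.
  have hz : normc z <= 2^-1 * r by rewrite nz.
  have h0 : 0 <= (2^-1 : R) by lra.
  have h1 : (2^-1 : R) < 1 by lra.
  have [y hy] := psum_cvg (@complex_complete R) r0 hg hz h0 h1.
  have := psum_tail n r0 hg hz h0 h1 hy.
  have := hM z y nz hy.
  have -> : 1 - 2^-1 = 2^-1 :> R by lra.
  rewrite rnormC invrK => m1 m2; rewrite -[psum g z n](subrK y).
  apply: le_trans (le_normcD _ _) _; rewrite addrC lerD// (le_trans m2)//.
  by rewrite mulrA mulrAC.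
rewrite leNgt; apply/negP => hlt.
pose e := normc (g k) * rho ^+ k - M.
have e0 : 0 < e by rewrite subr_gt0.
have := @cvg_half R (B * 2) => /cvgrPdist_lt /(_ _ e0) [n _ hn].
have := hn (maxn n k.+1) (leq_maxl _ _); have := h (maxn n k.+1) (leq_maxr _ _).
rewrite sub0r normrN /e => h1 h2.
by have := le_lt_trans (ler_norm _) h2; lra.
Qed.

(** Dividing by 1 - t X amounts to multiplying by a geometric series of ratio at most
    1 / 2. Only the first K + 1 coefficients are involved, which allows for a bound that
    is not known to be uniform. *)
Lemma linear_factor_inverse_bound (t : C) (g : nat -> C) (rho W : R) K : 0 < rho -> 0 <= W ->
  normc t * rho <= 2^-1 ->
  (forall k, (k <= K)%N -> normc (g k - (if k is k'.+1 then t * g k' else 0)) * rho ^+ k <= W) ->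
  forall k, (k <= K)%N -> normc (g k) * rho ^+ k <= 2 * W.
Proof.
move=> rho0 W0 ht h; elim=> [|k IH] kK.
  by have := h 0%N kK; rewrite subr0; lra.
have := h k.+1 kK; have := IH (ltnW kK) => h1 h2.
have e := le_normcD (g k.+1 - t * g k) (t * g k); rewrite subrK normcM in e.
have p0 : 0 <= rho ^+ k by rewrite exprn_ge0// ltW.
have g0 := normc_ge0 (g k).
have : normc (g k.+1) * rho ^+ k.+1 <= (normc (g k.+1 - t * g k) + normc t * normc (g k)) * rho ^+ k.+1.
  by rewrite ler_wpM2r// exprn_ge0// ltW.
move/le_trans; apply; rewrite mulrDl.
have : normc t * normc (g k) * rho ^+ k.+1 <= 2^-1 * (2 * W); last by lra.
rewrite exprS [rho * _]mulrC -mulrA [normc (g k) * _]mulrA [_ * rho]mulrC mulrA.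
by apply: ler_pM; rewrite ?mulr_ge0// ?normc_ge0// ltW.
Qed.

Lemma cprod_linear_factor (t : C) (p : {poly C}) (g : nat -> C) k :
  cprod (fun i => ((1 - t *: 'X) * p)`_i) g k =
  cprod (fun i => p`_i) g k - (if k is k'.+1 then t * cprod (fun i => p`_i) g k' else 0).
Proof.
rewrite /cprod.
have e i : ((1 - t *: 'X) * p)`_i = p`_i - (if i is i'.+1 then t * p`_i' else 0).
  rewrite mulrBl mul1r -scalerAl coefB coefZ coefXM.
  by case: i => //=; rewrite mulr0.
under eq_bigr => i _ do rewrite e scalerBl.
rewrite sumrB; congr (_ - _).
rewrite big_ord_recl scale0r add0r.
case: k => [|k]; first by rewrite big_ord0.
rewrite mulr_sumr; apply: eq_bigr => i _.
by rewrite /= /bump /= add1n subSS /GRing.scale /= mulrA.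
Qed.

(** The factors are undone one at a time by linear_factor_inverse_bound, each at the cost
    of a factor 2. *)
Lemma cprod_prod_bound (zs : seq C) (g : nat -> C) (rho W : R) K : 0 < rho -> 0 <= W ->
  (forall z, z \in zs -> 2 * rho <= normc z) ->
  (forall k, (k <= K)%N ->
     normc (cprod (fun i => (\prod_(z <- zs) (1 - z^-1 *: 'X))`_i) g k) * rho ^+ k <= W) ->
  forall k, (k <= K)%N -> normc (g k) * rho ^+ k <= 2 ^+ size zs * W.
Proof.
move=> rho0; elim: zs W => [|z zs IH] W W0 hz h k kK.
  have := h k kK; rewrite expr0 mul1r /cprod big_ord_recl big_nil coef1 scale1r subn0.
  by rewrite big1 ?addr0// => i _; rewrite coef1 scale0r.
rewrite /= exprSr -mulrA; apply: IH => //; first by rewrite mulr_ge0.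
  by move=> x hx; apply: hz; rewrite inE hx orbT.
apply: (@linear_factor_inverse_bound z^-1) => //.
  rewrite normcV; have h2 := hz z (mem_head _ _).
  have z0 : 0 < normc z by apply: lt_le_trans h2; rewrite mulr_gt0.
  by rewrite mulrC ler_pdivrMr//; lra.
move=> j jK; rewrite -cprod_linear_factor.
by have := h j jK; rewrite big_cons.
Qed.

Lemma poly_unit_factor (p : {poly C}) : p`_0 = 1 ->
  exists zs : seq C, [/\ p = \prod_(z <- zs) (1 - z^-1 *: 'X),
    (size zs < size p)%N & forall z, z \in zs -> root p z].
Proof.
move=> p0.
have pn0 : p != 0 by apply/eqP => h; move/eqP: p0; rewrite h coef0 eq_sym oner_eq0.
have [zs hp] := closed_field_poly_normal p.
have lc0 : lead_coef p != 0 by rewrite lead_coef_eq0.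
have hroot z : z \in zs -> root p z.
  by move=> hz; rewrite hp rootZ// root_prod_XsubC.
have hz0 z : z \in zs -> z != 0.
  move=> /hroot; apply: contraTneq => ->.
  by rewrite rootE horner_coef0 p0 oner_eq0.
exists zs; split => //; last first.
  by rewrite hp size_scale// size_prod_XsubC.
have e : \prod_(z <- zs) ('X - z%:P) = (\prod_(z <- zs) (- z)) *: \prod_(z <- zs) (1 - z^-1 *: 'X) :> {poly C}.
  rewrite -scaler_prod; apply: eq_big_seq => z hz.
  by rewrite scalerBr scalerA mulNr divff ?hz0// scaleN1r opprK addrC alg_polyC polyCN.
rewrite e scalerA in hp.
have : p`_0 = lead_coef p * (\prod_(z <- zs) (- z)).
  rewrite {1}hp coefZ -horner_coef0 horner_prod [X in _ * X]big1 ?mulr1// => z _.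
  by rewrite !(hornerE, mulr0, subr0).
by rewrite p0 => h; rewrite {1}hp -h scale1r.
Qed.

End Division.

(** * Sums of inverse square roots and Cartan's lemma *)

Section Grid.
Context {R : realType}.
Implicit Types (x t a : R).

Lemma sqrt_sub_le (a b : R) : b <= a -> Num.sqrt a - Num.sqrt b <= Num.sqrt (a - b).
Proof.
move=> ba; have [b0|b0] := leP b 0.
  by rewrite (ler0_sqrtr b0) subr0 ler_wsqrtr//; lra.
have s1 := sqrtr_ge0 b; have s2 := sqrtr_ge0 (a - b); have s3 := sqrtr_ge0 a.
rewrite lerBlDr -(@ler_pXn2r _ 2)// ?nnegrE ?addr_ge0//.
rewrite sqrrD !sqr_sqrtr ?subr_ge0//; try lra.
by have := mulr_ge0 s2 s1; lra.
Qed.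

Lemma sqrt_incr_ge a : 1 <= a -> (Num.sqrt a)^-1 <= 2 * Num.sqrt a - 2 * Num.sqrt (a - 1).
Proof.
move=> a1; have s0 : 0 < Num.sqrt a by rewrite sqrtr_gt0; lra.
have s2 := sqrtr_ge0 (a - 1).
have e1 : Num.sqrt a ^+ 2 = a by rewrite sqr_sqrtr; lra.
have e2 : Num.sqrt (a - 1) ^+ 2 = a - 1 by rewrite sqr_sqrtr; lra.
rewrite -[_^-1]mul1r ler_pdivrMr//.
by have := sqr_ge0 (Num.sqrt a - Num.sqrt (a - 1)); nra.
Qed.

Lemma sqrt_incr_ge0 a : 0 <= 2 * Num.sqrt a - 2 * Num.sqrt (a - 1).
Proof.
have h : Num.sqrt (a - 1) <= Num.sqrt a by apply: ler_wsqrtr; lra.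
lra.
Qed.

Lemma sum_sqrt_incr x Q :
  \sum_(0 <= u < Q) (2 * Num.sqrt (u%:R - x) - 2 * Num.sqrt (u%:R - x - 1)) <= 2 * Num.sqrt Q%:R.
Proof.
have -> : \sum_(0 <= u < Q) (2 * Num.sqrt (u%:R - x) - 2 * Num.sqrt (u%:R - x - 1)) =
    2 * Num.sqrt (Q%:R - x - 1) - 2 * Num.sqrt (0%:R - x - 1).
  rewrite -(@telescope_sumr _ 0 Q (fun u : nat => 2 * Num.sqrt (u%:R - x - 1)))//.
  by apply: eq_bigr => u _; rewrite -natr1; congr (2 * Num.sqrt _ - _); lra.
have := @sqrt_sub_le (Q%:R - x - 1) (0%:R - x - 1).
have -> : Q%:R - x - 1 - (0%:R - x - 1) = Q%:R :> R by rewrite mulr0n; lra.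
by move=> h; have := h ltac:(have := ler0n R Q; rewrite mulr0n; lra); lra.
Qed.

Lemma sum_sqrt_decr x Q :
  \sum_(0 <= u < Q) (2 * Num.sqrt (x - u%:R) - 2 * Num.sqrt (x - u%:R - 1)) <= 2 * Num.sqrt Q%:R.
Proof.
have -> : \sum_(0 <= u < Q) (2 * Num.sqrt (x - u%:R) - 2 * Num.sqrt (x - u%:R - 1)) =
    - (2 * Num.sqrt (x - Q%:R)) + 2 * Num.sqrt (x - 0%:R).
  rewrite addrC -[_ - _]opprB -(@telescope_sumr _ 0 Q (fun u : nat => 2 * Num.sqrt (x - u%:R)))//.
  rewrite -sumrN; apply: eq_bigr => u _; rewrite opprB -natr1; congr (_ - 2 * Num.sqrt _); lra.
have := @sqrt_sub_le (x - 0%:R) (x - Q%:R).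
have -> : x - 0%:R - (x - Q%:R) = Q%:R :> R by rewrite mulr0n; lra.
by move=> h; have := h ltac:(have := ler0n R Q; rewrite mulr0n; lra); lra.
Qed.

(** By concavity the inverse square root of a is at most the increment
    2 sqrt a - 2 sqrt (a - 1), and these increments telescope on either side of x. *)
Lemma sum_rsqrt_far x Q :
  \sum_(0 <= u < Q | 1 <= `|u%:R - x|) (Num.sqrt `|u%:R - x|)^-1 <= 4 * Num.sqrt Q%:R.
Proof.
apply: le_trans (_ : \sum_(0 <= u < Q) ((2 * Num.sqrt (u%:R - x) - 2 * Num.sqrt (u%:R - x - 1)) +
   (2 * Num.sqrt (x - u%:R) - 2 * Num.sqrt (x - u%:R - 1))) <= _).
  rewrite big_mkcond; apply: ler_sum => u _.
  have p1 := sqrt_incr_ge0 (u%:R - x); have p2 := sqrt_incr_ge0 (x - u%:R).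
  case: ifP => h; last exact: addr_ge0.
  have [h0|h0] := leP 0 (u%:R - x).
    by rewrite ger0_norm// in h *; have := sqrt_incr_ge h; lra.
  rewrite ltr0_norm// in h *; rewrite opprB in h *.
  by have := sqrt_incr_ge h; lra.
by rewrite big_split /=; have := sum_sqrt_incr x Q; have := sum_sqrt_decr x Q; lra.
Qed.

(** The truncation of u - x to [-2, 2] grows by 1 at each u that is counted, and by at
    most 4 altogether. *)
Lemma count_near x Q : \sum_(0 <= u < Q | `|u%:R - x| < 1) (1 : R) <= 4.
Proof.
pose chi t : R := Num.min (Num.max t (-2)) 2.
have chi2 t : -2 <= chi t <= 2.
  rewrite /chi; apply/andP; split; first by rewrite le_min le_max lexx orbT /=; lra.
  by rewrite ge_min lexx orbT.
apply: le_trans (_ : \sum_(0 <= u < Q) (chi (u.+1%:R - x) - chi (u%:R - x)) <= _).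
  rewrite big_mkcond; apply: ler_sum => u _; rewrite -natr1.
  case: ifP => [|_].
    rewrite ltr_norml => /andP[h1 h2]; rewrite /chi.
    rewrite (max_l (_ : -2 <= u%:R + 1 - x)); last by lra.
    rewrite (max_l (_ : -2 <= u%:R - x)); last by lra.
    by rewrite !min_l; lra.
  rewrite subr_ge0 /chi; apply: le_min2 => //; apply: le_max2 => //; lra.
rewrite (@telescope_sumr _ 0 Q (fun u : nat => chi (u%:R - x)))//.
by have := chi2 (Q%:R - x); have := chi2 (0%:R - x); lra.
Qed.

Lemma exists_le_average (I : finType) (f : I -> R) (B : R) : (0 < #|I|)%N ->
  \sum_(i : I) f i <= #|I|%:R * B -> exists i, f i <= B.
Proof.
move=> I0 h; apply/not_existsP => hn.
have : \sum_(i : I) B < \sum_(i : I) f i.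
  apply: ltr_sum.
    by apply/hasP; have /card_gt0P[i _] := I0; exists i; rewrite ?mem_index_enum.
  by move=> i _; rewrite ltNge; apply/negP/hn.
by rewrite sumr_const -mulr_natl => /(le_lt_trans h); rewrite ltxx.
Qed.

Lemma max1_sqr_le_exp (y : R) : 0 <= y -> Num.max 1 (y ^+ 2) <= expR (2 * y) :> R.
Proof.
move=> y0; rewrite ge_max; apply/andP; split.
  by have := expR_ge1Dx (2 * y); lra.
have : y <= expR y by have := expR_ge1Dx y; lra.
move=> h; rewrite expRM_natl; by apply: lerXn2r; rewrite ?nnegrE ?expR_ge0.
Qed.

(** Cartan's lemma on the line. The weight wt is the inverse square root of
    |t - x|, and the large value Q when t is next to x; its average over the grid is bounded
    independently of the mesh, which would fail for the inverse itself. Some grid point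
    thus has total weight at most 8 d, and max 1 (y ^ 2) <= exp (2 y) turns the sum of
    the weights into a bound for the product. *)
Lemma cartan (xs : seq R) : exists t, [/\ 0 <= t <= 1, t \notin xs &
  \prod_(x <- xs) Num.max 1 (`|t - x|^-1) <= expR 16 ^+ size xs].
Proof.
(* As Q exceeds 8 * d, a point of total weight at most 8 * d is not next to any x. *)
set d := size xs; pose Q := (8 * d).+1; have Q0 : 0 < Q%:R :> R by rewrite ltr0n.
pose wt (u x : R) := if `|u - x * Q%:R| < 1 then Q%:R else Num.sqrt Q%:R / Num.sqrt `|u - x * Q%:R|.
have wt0 u x : 0 <= wt u x by rewrite /wt; case: ifP => _; rewrite ?ler0n// divr_ge0// sqrtr_ge0.
have hw x : \sum_(u < Q) wt u%:R x <= 8 * Q%:R.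
  rewrite -(big_mkord xpredT (fun u => wt u%:R x)) (bigID (fun u => `|u%:R - x * Q%:R| < 1))/=.
  have h1 : \sum_(0 <= u < Q | `|u%:R - x * Q%:R| < 1) wt u%:R x <= 4 * Q%:R.
    apply: le_trans (_ : \sum_(0 <= u < Q | `|u%:R - x * Q%:R| < 1) 1 * Q%:R <= _).
      by apply: ler_sum => u h; rewrite /wt h mul1r.
    by rewrite -mulr_suml ler_wpM2r ?ler0n// count_near.
  have h2 : \sum_(0 <= u < Q | ~~ (`|u%:R - x * Q%:R| < 1)) wt u%:R x <= 4 * Q%:R.
    under eq_bigl => u do rewrite -leNgt.
    apply: le_trans (_ : \sum_(0 <= u < Q | 1 <= `|u%:R - x * Q%:R|)
       Num.sqrt Q%:R * (Num.sqrt `|u%:R - x * Q%:R|)^-1 <= _).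
      by apply: ler_sum => u h; rewrite /wt ltNge h.
    rewrite -mulr_sumr.
    have := sum_rsqrt_far (x * Q%:R) Q => h; apply: le_trans (ler_wpM2l _ h) _.
      exact: sqrtr_ge0.
    by rewrite mulrCA -expr2 sqr_sqrtr ?ler0n.
  lra.
have [u hu] : exists u : 'I_Q, \sum_(x <- xs) wt u%:R x <= 8 * d%:R.
  apply: exists_le_average; first by rewrite card_ord.
  rewrite exchange_big /= card_ord.
  apply: le_trans (_ : \sum_(x <- xs) 8 * Q%:R <= _); first exact: ler_sum.
  by rewrite big_const_seq count_predT iter_addr_0 -/d -mulr_natl; lra.
have hle x : x \in xs -> wt u%:R x <= 8 * d%:R.
  by move=> hx; apply: le_trans hu; rewrite (big_rem _ hx)/= lerDl sumr_ge0.
have hfar x : x \in xs -> 1 <= `|u%:R - x * Q%:R|.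
  move=> hx; have := hle x hx; rewrite /wt; case: ltP => // _.
  by rewrite /Q -natr1 natrM; lra.
pose t : R := u%:R / Q%:R.
have tE x : `|t - x| = `|u%:R - x * Q%:R| / Q%:R.
  have -> : t - x = (u%:R - x * Q%:R) / Q%:R by rewrite /t mulrBl mulfK// gt_eqF.
  by rewrite normf_div [`|Q%:R|]gtr0_norm.
exists t; split.
- rewrite /t divr_ge0 ?ler0n//= ler_pdivrMr// mul1r ler_nat.
  exact/ltnW/ltn_ord.
- apply/negP => /hfar; have := tE t; rewrite subrr normr0 => /esym/eqP.
  rewrite mulf_eq0 invr_eq0 (gt_eqF Q0) orbF => /eqP ->; lra.
- have -> : expR 16 ^+ d = expR (2 * (8 * d%:R)) :> R.
    by rewrite -expRM_natl; congr expR; lra.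
  apply: le_trans (_ : expR (2 * \sum_(x <- xs) wt u%:R x) <= _); last first.
    by rewrite ler_expR; lra.
  rewrite mulr_sumr expR_sum big_seq [leRHS]big_seq; apply: ler_prod => x hx.
  rewrite le_max ler01 /= tE invf_div.
  apply: le_trans (max1_sqr_le_exp (wt0 _ _)).
  rewrite /wt ltNge hfar//= expr_div_n !sqr_sqrtr ?ler0n//.
Qed.

End Grid.

(** * Growth of a quotient whose poles cancel *)

Section Growth.
Context {R : realType}.
Local Notation C := R[i].

Lemma bounded_cluster (z : nat -> C) (r : R) : (forall n, normc (z n) <= r) ->
  exists c : C, normc c <= 2 * r /\
    forall e N, 0 < e -> exists2 n, (N <= n)%N & normc (z n - c) < e.
Proof.
move=> hz; pose K : set (R * R) := `[- r, r]%classic `*` `[- r, r]%classic.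
have cK : compact K by apply: compact_setX; exact: segment_compact.
pose f n : R * R := (complex.Re (z n), complex.Im (z n)).
have fK : (f @ \oo) K.
  exists 0%N => // n _; split; rewrite /= in_itv /= -ler_norml.
    exact: le_trans (normc_Re _) (hz n).
  exact: le_trans (normc_Im _) (hz n).
have [[p q] [[/= Kp Kq] clpq]] := cK (f @ \oo) _ fK.
exists (p +i* q)%C; split.
  apply: le_trans (normc_le_ReIm _) _ => /=.
  by move: Kp Kq; rewrite /= !in_itv /= -!ler_norml; lra.
move=> e N e0; pose e2 := e / 2; have e20 : 0 < e2 by rewrite divr_gt0.
have h1 : (f @ \oo) [set x | exists2 n, (N <= n)%N & f n = x].
  by exists N => // n Nn /=; exists n.
have h2 : nbhs (p, q) [set x : R * R | `|p - x.1| < e2 /\ `|q - x.2| < e2].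
  exists ([set x | `|p - x| < e2], [set x | `|q - x| < e2]) => /=.
    by split; apply/nbhs_ballP; exists e2 => // x.
  by move=> [x1 x2] /= [].
have [x [[n Nn <-] /= [hp hq]]] := clpq _ _ h1 h2.
exists n => //; apply: le_lt_trans (normc_le_ReIm _) _.
move: hp hq; rewrite ![`|_ - complex.Re _|]distrC ![`|_ - complex.Im _|]distrC /f /=.
by rewrite !raddfB /= /e2; lra.
Qed.

Lemma subrX_bound (z w : C) (b : R) k : normc z <= b -> normc w <= b ->
  normc (z ^+ k - w ^+ k) * b <= normc (z - w) * (k%:R * b ^+ k).
Proof.
move=> hz hw; have b0 := le_trans (normc_ge0 _) hz.
case: k => [|k]; first by rewrite !expr0 subrr normc0 !mul0r mulr_ge0// normc_ge0.
rewrite subrXX normcM -mulrA ler_wpM2l ?normc_ge0//.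
rewrite exprSr mulrA ler_wpM2r// -rnormC.
apply: le_trans (rnorm_sum _ _ _) _.
rewrite mulr_natl -[X in _ *+ X]card_ord -sumr_const; apply: ler_sum => i _.
rewrite rnormC normcM !normcX.
have -> : b ^+ k = b ^+ (k - i) * b ^+ i by rewrite -exprD subnK// -ltnS.
by apply: ler_pM; rewrite ?exprn_ge0 ?normc_ge0//; apply: lerXn2r; rewrite ?nnegrE ?normc_ge0.
Qed.

(** Equicontinuity of the Taylor polynomials, used to pass to the limit in their
    zeros. *)
Lemma psum_lipschitz (u : nat -> C) (r D : R) z w n : 0 < r -> coef_le u r D ->
  normc z <= 4^-1 * r -> normc w <= 4^-1 * r ->
  normc (psum u z n - psum u w n) <= normc (z - w) * (8 * D / r).
Proof.
move=> r0 hu hz hw; have D0 := coef_le_ge0 hu.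
pose b := 4^-1 * r; have b0 : 0 < b by rewrite /b mulr_gt0.
rewrite -(ler_pM2r b0).
have -> : normc (z - w) * (8 * D / r) * b = normc (z - w) * (D * 2).
  by rewrite /b; field; rewrite gt_eqF.
rewrite -sumrB -rnormC.
apply: le_trans (_ : (\sum_(0 <= k < n) rnorm (z ^+ k *: u k - w ^+ k *: u k)) * b <= _).
  by rewrite ler_wpM2r ?(ltW b0)// rnorm_sum.
rewrite mulr_suml.
apply: le_trans (_ : \sum_(0 <= k < n) normc (z - w) * D * 2^-1 ^+ k <= _).
  apply: ler_sum => k _.
  rewrite -scalerBl rnormZ rnormC mulrAC.
  apply: le_trans (_ : normc (z - w) * (k%:R * b ^+ k) * normc (u k) <= _).
    by rewrite ler_wpM2r ?normc_ge0// subrX_bound.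
  rewrite -!mulrA ler_wpM2l ?normc_ge0//.
  have := hu k; rewrite rnormC => h.
  have -> : k%:R * (b ^+ k * normc (u k)) = (k%:R * 4^-1 ^+ k) * (normc (u k) * r ^+ k).
    by rewrite /b exprMn; ring.
  rewrite [leRHS]mulrC; apply: ler_pM => //; rewrite ?mulr_ge0 ?normc_ge0 ?exprn_ge0 ?(ltW r0)//.
  have -> : 4^-1 = 2^-1 * 2^-1 :> R by lra.
  rewrite exprMn mulrA ler_piMl ?exprn_ge0// exprVn ler_pdivrMr ?exprn_gt0// mul1r.
  by apply: le_trans (succ_le_pow2 k); rewrite ler_nat.
rewrite -mulr_sumr -mulrA ler_wpM2l ?normc_ge0// ler_wpM2l//.
have := @geo_sum_le R 2^-1 0 n; rewrite expr0.
have -> : 1 - 2^-1 = 2^-1 :> R by lra.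
by rewrite invrK mul1r; apply; lra.
Qed.

Definition zero_free (u : nat -> C) (r : R) :=
  forall z, normc z <= r -> ~ tends (psum u z) 0.

(** Otherwise zeros of Taylor polynomials of arbitrarily high degree would accumulate
    at a zero of u. *)
Lemma taylor_zero_free (u : nat -> C) (r D : R) T0 : 0 < r -> coef_le u r D ->
  zero_free u (4^-1 * r) ->
  exists2 T, (T0 <= T)%N & forall z, normc z <= 8^-1 * r -> psum u z T != 0.
Proof.
move=> r0 hu hz; apply: contrapT => hn.
have hbad T : exists z, normc z <= 8^-1 * r /\ psum u z (T0 + T) = 0.
  apply/not_existsP => h; apply: hn; exists (T0 + T)%N; first exact: leq_addr.
  move=> z nz; apply/eqP => z0; exact: (h z).
have [z hzz] := choice hbad.
have [c [nc clc]] := @bounded_cluster z (8^-1 * r) (fun n => (hzz n).1).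
have nc4 : normc c <= 4^-1 * r by lra.
apply: (hz c nc4) => e e0.
have h0 : 0 <= (4^-1 : R) by lra.
have h1 : (4^-1 : R) < 1 by lra.
have [y hy] := psum_cvg (@complex_complete R) r0 hu nc4 h0 h1.
suff y0 : y = 0 by rewrite -y0; exact: hy.
apply/eqP; apply: contraT => /normc_gt0 ny; exfalso.
pose L := 8 * D / r.
have L0 : 0 <= L by rewrite /L divr_ge0 ?(ltW r0)// mulr_ge0// (coef_le_ge0 hu).
have e3 : 0 < normc y / 2 by rewrite divr_gt0.
have [N hN] := hy _ e3.
have e4 : 0 < normc y / (2 * (L + 1)) by rewrite divr_gt0// mulr_gt0//; lra.
have [n Nn hn'] := clc _ N e4.
have := hN (T0 + n)%N (leq_trans Nn (leq_addl _ _)).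
have nz4 : normc (z n) <= 4^-1 * r by have := (hzz n).1; lra.
have := @psum_lipschitz u r D (z n) c (T0 + n)%N r0 hu nz4 nc4.
rewrite (hzz n).2 sub0r normcN -/L => hl hd.
have : normc (z n - c) * L <= normc y / 2.
  have L1 : 0 < L + 1 by lra.
  apply: le_trans (_ : normc y / (2 * (L + 1)) * (L + 1) <= _).
    by apply: ler_pM; rewrite ?normc_ge0 ?(ltW hn')//; lra.
  by rewrite le_eqVlt; apply/orP; left; apply/eqP; field; rewrite gt_eqF.
have := normcB (psum u c (T0 + n)%N) (psum u c (T0 + n)%N - y).
rewrite subKr -[normc (_ - y)]rnormC; lra.
Qed.

(** The bound is not explicit; it only makes g analytic up to the circle on which
    zero_free_growth estimates it. A Taylor polynomial q of u of high degree T has no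
    zero in a fixed disc, so that dividing by q costs at most 2^T. The remainder u - q
    contributes a small multiple of the largest of the coefficients of g under
    consideration, which is absorbed in the left-hand side. *)
Lemma quotient_analytic (u g F : nat -> C) (r D E : R) : 0 < r -> u 0%N = 1 ->
  coef_le u r D -> coef_le F r E -> (forall k, cprod u g k = F k) ->
  zero_free u (4^-1 * r) -> exists B, coef_le g (16^-1 * r) B.
Proof.
move=> r0 u0 hu hF hg hz; have D0 := coef_le_ge0 hu; have E0 := coef_le_ge0 hF.
have [T0 hT0] : exists T0 : nat, 4 * D <= 8 ^+ T0.
  exists (Num.bound (4 * D)).
  have := archi_boundP (mulr_ge0 (ler0n R 4) D0) => /ltW/le_trans; apply.
  apply: le_trans (_ : 2 ^+ Num.bound (4 * D) <= _).
    by apply: le_trans (succ_le_pow2 _); rewrite ler_nat.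
  by apply: lerXn2r; rewrite ?nnegrE //; lra.
have [T hTT0 hT] := @taylor_zero_free u r D T0.+1 r0 hu hz.
have T1 : (0 < T)%N by apply: leq_trans hTT0.
pose q := \poly_(i < T) u i.
have q0 : q`_0 = 1 by rewrite coef_poly T1.
have [zs [qE szs hroot]] := poly_unit_factor q0.
pose rho := 16^-1 * r; have rho0 : 0 < rho by rewrite /rho mulr_gt0.
have hzs z : z \in zs -> 2 * rho <= normc z.
  move=> /hroot; rewrite leNgt rootE => /eqP h; apply/negP => hlt.
  have := hT z; rewrite psum_poly -/q h eqxx => hh.
  by have := hh ltac:(rewrite /rho in hlt; lra).
have size_zs : (size zs <= T)%N.
  by apply: ltnW; apply: leq_trans szs (size_poly _ _).
exists (2 ^+ T.+1 * E) => K.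
pose f (k : 'I_K.+1) := rnorm (g k) * rho ^+ k.
pose k0 := [arg max_(k > ord0) f k]%O.
have hk0 k : f k <= f k0 by rewrite /k0; case: arg_maxP => // i _; apply.
pose M := f k0.
have M0 : 0 <= M by rewrite /M /f mulr_ge0 ?rnorm_ge0// exprn_ge0// ltW.
have hM k : (k <= K)%N -> rnorm (g k) * rho ^+ k <= M.
  by rewrite -ltnS => kK; exact: (hk0 (Ordinal kK)).
(* The loss 2^T of the division against the gain 16^-T of the Taylor remainder. *)
have h16 : 4 * D * 16^-1 ^+ T * 2 ^+ T <= 1.
  have -> : 4 * D * 16^-1 ^+ T * 2 ^+ T = 4 * D / 8 ^+ T.
    rewrite -mulrA -exprMn; have -> : 16^-1 * 2 = 8^-1 :> R by lra.
    by rewrite exprVn.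
  rewrite ler_pdivrMr ?exprn_gt0// mul1r (le_trans hT0)// ler_weXn2l//; first by lra.
  exact: ltnW.
have hW k : (k <= K)%N -> normc (cprod (fun i => (\prod_(z <- zs) (1 - z^-1 *: 'X))`_i) g k) * rho ^+ k
    <= E + 2 * D * 16^-1 ^+ T * M.
  move=> kK; rewrite -qE.
  have -> : cprod (fun i => q`_i) g k = F k - \sum_(i < k.+1 | (T <= i)%N) u i *: g (k - i)%N.
    rewrite -hg /cprod [X in _ = X - _](bigID (fun i : 'I_k.+1 => (T <= i)%N)) /= addrC addrK.
    rewrite [RHS]big_mkcond /=; apply: eq_bigr => i _.
    by rewrite coef_poly ltnNge; case: leqP => //= _; rewrite scale0r.
  rewrite -rnormC.
  apply: le_trans (ler_wpM2r (exprn_ge0 _ (ltW rho0)) (rnormB _ _)) _.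
  rewrite mulrDl; apply: lerD.
    have := @coef_leW _ _ F r rho E E (ltW rho0) _ (lexx _) hF k; apply.
    by rewrite /rho; lra.
  apply: le_trans (ler_wpM2r (exprn_ge0 _ (ltW rho0)) (rnorm_sum _ _ _)) _.
  rewrite mulr_suml.
  apply: le_trans (_ : \sum_(i < k.+1 | (T <= i)%N) (D * M) * 16^-1 ^+ i <= _).
    apply: ler_sum => i Ti; rewrite rnormZ -rnormC.
    have ik : (i <= k)%N by rewrite -ltnS.
    have -> : rho ^+ k = rho ^+ i * rho ^+ (k - i) by rewrite -exprD subnKC.
    rewrite mulrACA [leRHS]mulrAC; apply: ler_pM; rewrite ?mulr_ge0 ?rnorm_ge0 ?exprn_ge0 ?(ltW rho0)//.
      by rewrite /rho exprMn mulrCA mulrC ler_wpM2r ?exprn_ge0//; exact: hu.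
    by apply: hM; apply: leq_trans (leq_subr _ _) kK.
  rewrite -mulr_sumr.
  have -> : 2 * D * 16^-1 ^+ T * M = (D * M) * (2 * 16^-1 ^+ T) by ring.
  apply: ler_wpM2l; first by rewrite mulr_ge0.
  have -> : \sum_(i < k.+1 | (T <= i)%N) 16^-1 ^+ i = \sum_(T <= i < k.+1) 16^-1 ^+ i :> R.
    by rewrite big_geq_mkord.
  apply: le_trans (@geo_sum_le R 16^-1 T k.+1 _ _) _; [lra|lra|].
  rewrite mulrC ler_wpM2r ?exprn_ge0//.
  have -> : 1 - 16^-1 = 15 / 16 :> R by lra.
  by rewrite invf_div; lra.
have W0 : 0 <= E + 2 * D * 16^-1 ^+ T * M.
  apply: addr_ge0 => //; apply: mulr_ge0 => //; apply: mulr_ge0; first by rewrite mulr_ge0.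
  by rewrite exprn_ge0.
have := @cprod_prod_bound R zs g rho _ K rho0 W0 hzs hW k0 (ltn_ord k0).
rewrite -rnormC -/(f k0) -/M => hMM.
apply: le_trans (hM K (leqnn K)) _.
have hM2 : M <= 2 ^+ T * (E + 2 * D * 16^-1 ^+ T * M).
  by apply: le_trans hMM _; rewrite ler_wpM2r// ler_weXn2l//; lra.
have : 2 ^+ T * (2 * D * 16^-1 ^+ T * M) <= 2^-1 * M.
  have -> : 2 ^+ T * (2 * D * 16^-1 ^+ T * M) = 2^-1 * M * (4 * D * 16^-1 ^+ T * 2 ^+ T) by field.
  by rewrite ler_piMr// mulr_ge0.
by move: hM2; rewrite mulrDr exprS; lra.
Qed.

(** A polynomial of degree N with constant coefficient 1 is at least cartan_cst^-N in
    modulus on some circle, see circle_lower_bound. *)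
Definition cartan_cst : R := 4 * expR 16.
(** After shrinking the radius by this factor, a Taylor remainder of order N is
    negligible with respect to cartan_cst^-N. *)
Definition shrink_cst : R := 128 * cartan_cst.

Lemma cartan_cst_ge4 : 4 <= cartan_cst.
Proof. by rewrite /cartan_cst; have := expR_ge1Dx (16 : R); lra. Qed.

Lemma prod_ge1 (T : eqType) (xs : seq T) (f : T -> R) :
  (forall x, x \in xs -> 1 <= f x) -> 1 <= \prod_(x <- xs) f x.
Proof.
by move=> h; rewrite big_seq; elim/big_ind: _ => // x y; exact: mulr_ege1.
Qed.

(** Cartan's lemma is applied to the moduli of the zeros x, since
    |1 - z / x| >= ||x| - |z|| / |x|. The zeros with |x| >= 4 * rho1 are harmless: each
    of their factors is at least 1 / 2. *)
Lemma circle_lower_bound (q : {poly C}) (rho1 : R) (N : nat) : 0 < rho1 ->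
  q`_0 = 1 -> (size q <= N.+1)%N ->
  exists2 rho, rho1 <= rho <= 2 * rho1 &
    forall z, normc z = rho -> 1 <= normc q.[z] * cartan_cst ^+ N.
Proof.
move=> rho10 q0 sq.
have [zs [qE szs hroot]] := poly_unit_factor q0.
have size_zs : (size zs <= N)%N by rewrite -ltnS; apply: leq_trans szs sq.
have [t [/andP[t0 t1] txs ht]] := cartan [seq normc z / rho1 - 1 | z <- zs].
exists (rho1 * (1 + t)).
  rewrite ler_peMr ?(ltW rho10)//=; last by lra.
  by rewrite mulrC ler_wpM2r ?(ltW rho10)//; lra.
move=> z nz; have L4 := cartan_cst_ge4.
apply: le_trans (_ : normc q.[z] * cartan_cst ^+ size zs <= _); last first.
  by rewrite ler_wpM2l ?normc_ge0// ler_weXn2l//; move: L4; clear; lra.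
have -> : cartan_cst ^+ size zs = \prod_(x <- zs) 4 * expR 16 ^+ size zs.
  by rewrite /cartan_cst exprMn big_const_seq count_predT iter_mulr_1.
rewrite size_map in ht; rewrite big_map in ht.
apply: le_trans (_ : normc q.[z] * (\prod_(x <- zs) 4 *
   \prod_(x <- zs) Num.max 1 `|t - (normc x / rho1 - 1)|^-1) <= _); last first.
  by rewrite ler_wpM2l ?normc_ge0// ler_wpM2l// prodr_ge0.
rewrite {1}qE horner_prod normc_prod -!big_split /=.
apply: prod_ge1 => x hx.
have x0 : x != 0.
  apply/eqP => x0; have := hroot x hx; rewrite x0 rootE horner_coef0 q0.
  by rewrite oner_eq0.
have nx := normc_gt0 x0.
have -> : (1 - x^-1 *: 'X).[z] = (x - z) / x.
  by rewrite !hornerE mulrBl divff// mulrC.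
rewrite normcM normcV.
have hxz : `|normc x - rho1 * (1 + t)| <= normc (x - z).
  rewrite -nz ler_norml; have h1 := le_normcD (x - z) z; have h2 := le_normcD (z - x) x.
  rewrite !subrK in h1 h2; rewrite -opprB normcN in h2.
  by move: h1 h2; clear => h1 h2; apply/andP; split; lra.
set m := Num.max _ _.
have m1 : 1 <= m by rewrite le_max lexx.
have [x4|x4] := leP (4 * rho1) (normc x).
  have h : 2^-1 <= normc (x - z) / normc x.
    rewrite ler_pdivlMr//; have : rho1 * (1 + t) <= rho1 * 2 by rewrite ler_wpM2l ?(ltW rho10)//; lra.
    have := le_trans (ler_norm _) hxz.
    by move: x4; clear; lra.
  apply: le_trans (_ : 2^-1 * (4 * 1) <= _); first by clear; lra.
  by apply: ler_pM => //; rewrite ler_pM2l.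
have tx : 0 < `|t - (normc x / rho1 - 1)|.
  rewrite normr_gt0 subr_eq0; apply: contra txs => /eqP ->.
  by apply/mapP; exists x.
have e : `|normc x - rho1 * (1 + t)| = rho1 * `|t - (normc x / rho1 - 1)|.
  rewrite -[X in X * `|_|](gtr0_norm rho10) -normrM distrC; congr `|_|.
  by field; rewrite gt_eqF.
apply: le_trans (_ : (`|t - (normc x / rho1 - 1)| / 4) * (4 * `|t - (normc x / rho1 - 1)|^-1) <= _).
  by rewrite le_eqVlt; apply/orP; left; apply/eqP; field; rewrite gt_eqF.
apply: ler_pM.
- by rewrite divr_ge0.
- by rewrite mulr_ge0// invr_ge0.
- rewrite ler_pdivlMr// (le_trans _ hxz)// e mulrAC ler_pdivrMr// [leRHS]mulrAC mulrC.
  by rewrite ler_wpM2r//; move: x4; clear; lra.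
- by rewrite ler_wpM2l// le_max lexx orbT.
Qed.

(** On the circle of circle_lower_bound the Taylor polynomial of degree N of u
    dominates the remainder, so u is bounded below there by cartan_cst^-N / 2, and
    |F / u| is bounded on that circle. *)
Lemma zero_free_growth (u g F : nat -> C) (r : R) (N : nat) : 0 < r -> u 0%N = 1 ->
  coef_le u r (2 ^+ N) -> coef_le F r (2 ^+ N) -> (forall k, cprod u g k = F k) ->
  zero_free u (4^-1 * r) -> coef_le g (shrink_cst^-1 * r) (4 * (2 * cartan_cst) ^+ N).
Proof.
move=> r0 u0 hu hF hg hz.
have [B hB] := quotient_analytic r0 u0 hu hF hg hz.
have B0 := coef_le_ge0 hB.
have L4 := cartan_cst_ge4.
have th0 : 0 < shrink_cst by rewrite /shrink_cst; lra.
pose rho1 := shrink_cst^-1 * r.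
have rho10 : 0 < rho1 by rewrite /rho1 mulr_gt0// invr_gt0.
have rho1E : rho1 * (128 * cartan_cst) = r.
  by rewrite /rho1 mulrC mulrA divff ?mul1r// gt_eqF.
pose q := \poly_(i < N.+1) u i.
have q0 : q`_0 = 1 by rewrite coef_poly.
have [rho /andP[rho_ge rho_le] hq] := circle_lower_bound rho10 q0 (size_poly _ _).
have rho0 : 0 < rho := lt_le_trans rho10 rho_ge.
rewrite -/rho1; move: cartan_cst L4 rho1E hq => L L4 rho1E hq.
have rho_small : 2 * rho1 * (64 * L) <= r by lra.
have rho_r : 2 * rho1 * 256 <= r.
  have : rho1 * 4 <= rho1 * L by rewrite ler_pM2l.
  by move: rho_small; clear; lra.
suff : coef_le g rho (4 * (2 * L) ^+ N).
  by apply: coef_leW => //; rewrite ltW.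
apply: (@cauchy_estimate R g (16^-1 * r) B) => //; first by rewrite mulr_gt0.
  by move: rho_le rho_r r0; clear; lra.
move=> z y nz hy.
have r160 : 0 < 16^-1 * r by rewrite mulr_gt0.
(* An upper bound for the ratio of the radius of the circle to r. *)
pose q1 : R := (64 * L)^-1.
have q1_gt0 : 0 < q1 by rewrite invr_gt0; move: L4; clear; lra.
have q1E : q1 * (64 * L) = 1 by rewrite mulVf// gt_eqF//; move: L4; clear; lra.
have q1_le : q1 <= 256^-1.
  have : q1 * 4 <= q1 * L by rewrite ler_pM2l.
  by move: q1E; rewrite mulrCA; clear; lra.
have hzq : normc z <= q1 * r.
  rewrite nz /q1 mulrC ler_pdivlMr; last by move: L4; clear; lra.
  by apply: le_trans rho_small; rewrite ler_wpM2r//; move: L4; clear; lra.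
have q1lt : q1 < 1 by move: q1_le; clear; lra.
have q1ge := ltW q1_gt0.
have [d hd] := psum_cvg (@complex_complete R) r0 hu hzq q1ge q1lt.
have [f hf] := psum_cvg (@complex_complete R) r0 hF hzq q1ge q1lt.
have r16r : 16^-1 * r <= r by move: r0; clear; lra.
have hu16 : coef_le u (16^-1 * r) (2 ^+ N) := coef_leW (ltW r160) r16r (lexx _) hu.
have fE : f = d * y.
  apply: tends_unique hf _; rewrite (_ : F = cprod u g); last by apply/funext => k; rewrite hg.
  apply: (psum_cprod r160 hu16 hB) => //.
  by rewrite nz; move: rho_le rho_r r0; clear; lra.
have nf : normc f <= 2 * 2 ^+ N.
  have := psum_lim_le r0 hF hzq q1ge q1lt hf; rewrite rnormC => /le_trans; apply.
  rewrite ler_pdivrMr ?subr_gt0// mulrAC ler_peMl ?exprn_ge0//.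
  by move: q1_le; clear; lra.
have hLN := hq z nz.
have LN0 : 0 < L ^+ N by rewrite exprn_gt0//; move: L4; clear; lra.
have htail : rnorm (psum u z N.+1 - d) * L ^+ N <= 2^-1.
  have h := psum_tail N.+1 r0 hu hzq q1ge q1lt hd.
  apply: le_trans (ler_wpM2r (ltW LN0) h) _.
  rewrite exprS.
  have -> : 2 ^+ N * (q1 * q1 ^+ N / (1 - q1)) * L ^+ N = (q1 / (1 - q1)) * (2 * q1 * L) ^+ N.
    by rewrite !exprMn; ring.
  have -> : 2 * q1 * L = 32^-1 by move: q1E; clear; lra.
  apply: le_trans (_ : q1 / (1 - q1) * 1 <= _).
    rewrite ler_wpM2l ?divr_ge0 ?subr_ge0 ?(ltW q1lt)// exprn_ile1//; clear; lra.
  rewrite mulr1 ler_pdivrMr ?subr_gt0//; move: q1_le; clear; lra.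
have hdl : 2^-1 <= normc d * L ^+ N.
  have := le_normcD (psum u z N.+1 - d) d; rewrite subrK psum_poly -/q => h.
  have := ler_wpM2r (ltW LN0) h; rewrite mulrDl.
  by move: hLN htail; rewrite rnormC psum_poly -/q; clear; lra.
have : normc d * L ^+ N * normc y <= 2 * 2 ^+ N * L ^+ N.
  by rewrite mulrAC -normcM -fE ler_wpM2r// ltW.
rewrite [(2 * L) ^+ N]exprMn => h.
have := ler_wpM2r (normc_ge0 y) hdl; move: h; clear; lra.
Qed.

(** St is a class of representations g = F / u that is stable under the removal of a
    zero of u in the disc. Each removal divides the bound on u by 3 although u(0) = 1,
    so that a zero-free denominator is reached after finitely many of them. *)
Lemma division_growth (g : nat -> C) (r : R) (N : nat)
    (St : (nat -> C) -> (nat -> C) -> Prop) : 0 < r ->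
  (forall u F, St u F -> u 0%N = 1) ->
  (forall u F, St u F -> forall k, cprod u g k = F k) ->
  (forall u F l, St u F -> l != 0 -> normc l <= 4^-1 * r -> tends (psum u l) 0 ->
     tends (psum F l) 0 /\ St (zero_quotient l u) (zero_quotient l F)) ->
  forall u F, St u F -> coef_le u r (2 ^+ N) -> coef_le F r (2 ^+ N) ->
  coef_le g (shrink_cst^-1 * r) (4 * (2 * cartan_cst) ^+ N).
Proof.
move=> r0 h1 hg hdiv.
suff main j u F D : D <= 2 ^+ N -> D < 3 ^+ j -> St u F -> coef_le u r D ->
    coef_le F r (2 ^+ N) -> coef_le g (shrink_cst^-1 * r) (4 * (2 * cartan_cst) ^+ N).
  move=> u F hS hu hF; apply: (@main N.+1 u F (2 ^+ N)) => //.
  apply: le_lt_trans (_ : 3 ^+ N < _); last by rewrite ltr_eXn2l// ltr1n.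
  by apply: lerXn2r; rewrite ?nnegrE// ler_nat.
elim: j u F D => [|j IH] u F D DN Dj hS hu hF.
  by have := hu 0%N; rewrite (h1 u F hS) rnormC normc1 expr0 mulr1 leNgt Dj.
have [hz|hz] := pselect (zero_free u (4^-1 * r)).
  apply: (zero_free_growth r0 (h1 u F hS) _ hF (hg u F hS) hz).
  exact: coef_leW (ltW r0) (lexx _) DN hu.
have [l nl hl] : exists2 l, normc l <= 4^-1 * r & tends (psum u l) 0.
  apply: contrapT => hn; apply: hz => z nz tz; apply: hn; by exists z.
have l0 : l != 0.
  apply/eqP => le; move: hl; rewrite le => hl.
  have : tends (psum u 0) (1 : C).
    apply: (tends_eventually (m := 1%N)) (tends_cst _) => -[//|n] _.
    rewrite /psum big_nat_recl//= expr0 scale1r (h1 u F hS) big1 ?addr0// => k _.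
    by rewrite expr0n scale0r.
  by move=> /(tends_unique hl)/esym/eqP; rewrite oner_eq0.
have [hFl hS'] := hdiv u F l hS l0 nl hl.
have hdvb E v : coef_le v r E -> tends (psum v l) 0 -> coef_le (zero_quotient l v) r (E / 3).
  by move=> hv tv k; have := zero_quotient_bound k l0 r0 nl hv tv; rewrite scaler0 subr0.
have D0 := coef_le_ge0 hu.
have p0 : 0 <= (2 : R) ^+ N by rewrite exprn_ge0.
apply: (IH (zero_quotient l u) (zero_quotient l F) (D / 3) _ _ hS' (hdvb _ _ _ hu hl)).
- by lra.
- by rewrite ltr_pdivrMr// -exprSr.
- by apply: coef_leW (hdvb _ _ _ hF hFl); rewrite ?(ltW r0)//; lra.
Qed.

End Growth.

(** * A Liouville theorem for functions that are small at most points *)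

Section Liouville.
Context {R : realType}.
Local Notation C := R[i].

(** The Taylor polynomial of degree less than d is within 1 of g on the sample circle,
    hence at most 2 at the good points, and Remez inequality bounds it in the disc of
    radius r. The coefficients of higher order are small by the bound at radius 16 r. *)
Lemma remez_step (g : nat -> C) (r : R) (M n d : nat) (w c : C) (bad : {set 'I_n}) :
  0 < r -> coef_le g (16 * r) (2 ^+ M) -> n.-primitive_root w -> normc c <= 2 * r ->
  (M < d)%N -> (d + #|bad| <= n)%N ->
  (forall j : 'I_n, j \notin bad -> forall y,
     tends (psum g (c + (6 * r)%:C%C * w ^+ j)) y -> normc y <= 1) ->
  coef_le g r (4 ^+ #|bad|.+1).
Proof.
move=> r0 hg hw hc Md dn hgood.
have d0 : (0 < d)%N by apply: leq_ltn_trans Md.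
have r16 : 0 < 16 * r by rewrite mulr_gt0.
have half0 : 0 <= (2^-1 : R) by rewrite invr_ge0.
have half1 : (2^-1 : R) < 1 by rewrite invf_lt1// ltr1n.
pose p := \poly_(i < d) g i.
have pE z : p.[z] = psum g z d by rewrite psum_poly.
have hp z : normc z <= r -> normc p.[z] <= 4 ^+ #|bad|.+1.
  move=> hz; have r6 : 0 < 6 * r by rewrite mulr_gt0.
  have -> : 4 ^+ #|bad|.+1 = 2 * 2 * 4 ^+ #|bad| :> R by rewrite exprS; ring.
  apply: (remez hw r6) => //.
  - by apply: leq_trans dn; rewrite leq_add2r size_poly.
  - by have := normcB z c; move: hz hc; clear; lra.
  move=> j hj; set x := c + _.
  have nx : normc x <= 2^-1 * (16 * r).
    have := le_normcD c ((6 * r)%:C%C * w ^+ j).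
    rewrite normcM normcX (normc_prim_root hw) expr1n mulr1 normc_real gtr0_norm//.
    by rewrite -/x; move: hc; clear; lra.
  have [y hy] := psum_cvg (@complex_complete R) r16 hg nx half0 half1.
  have := hgood j hj y hy.
  have := psum_tail d r16 hg nx half0 half1 hy.
  have h1 : 2 ^+ M * (2^-1 ^+ d / (1 - 2^-1)) <= 1 :> R.
    have -> : 1 - 2^-1 = 2^-1 :> R by clear; lra.
    rewrite invrK exprVn -(subnKC Md) exprD exprS !invfM.
    have -> : 2 ^+ M * ((2^-1 / 2 ^+ M) / 2 ^+ (d - M.+1) * 2) = (2 ^+ (d - M.+1))^-1 :> R.
      by field; rewrite !expf_neq0 ?pnatr_eq0.
    by rewrite invf_le1 ?exprn_gt0// exprn_ege1// ler1n.
  have := le_normcD (psum g x d - y) y; rewrite subrK pE => h2 h3 h4.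
  by move: h1 h2 h3 h4; rewrite rnormC; clear; lra.
move=> k; rewrite rnormC.
have [kd|dk] := ltnP k d.
  have [v hv] := @complex_prim_root R _ d0.
  have -> : normc (g k) * r ^+ k = normc (r%:C%C ^+ k * g k).
    by rewrite normcM normcX normc_real gtr0_norm// mulrC.
  apply: (@cauchy_coef _ d v (fun i => r%:C%C ^+ i * g i) _ k hv kd) => j.
  have -> : psum (fun i => r%:C%C ^+ i * g i) (v ^+ j) d = psum g (r%:C%C * v ^+ j) d.
    by apply: eq_bigr => i _; rewrite exprMn /GRing.scale /= mulrA [v ^+ j ^+ i * _]mulrC.
  rewrite -pE; apply: hp.
  by rewrite normcM normcX (normc_prim_root hv) expr1n mulr1 normc_real gtr0_norm.
apply: le_trans (_ : 1 <= _); last by rewrite exprn_ege1// ler1n.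
have h16 : 0 < (16 : R) ^+ k by rewrite exprn_gt0.
rewrite -(ler_pM2r h16) mul1r -mulrA -exprMn [r * _]mulrC.
have := hg k; rewrite rnormC => /le_trans; apply.
apply: le_trans (_ : 2 ^+ k <= _).
  by rewrite ler_weXn2l ?ler1n// ltnW// (leq_trans Md).
by apply: lerXn2r; rewrite ?nnegrE ?ler_nat.
Qed.

(** The points c + 6 r w^j sample a circle that surrounds the disc of radius r; at most
    a proportion 1 / K of them is exceptional. *)
Definition mostly_small (g : nat -> C) :=
  forall (e : R) (K : nat), 0 < e -> (0 < K)%N ->
  exists r0 : nat, forall r : nat, (r0 <= r)%N -> forall n (w : C), n.-primitive_root w ->
  exists (c : C) (bad : {set 'I_n}), [/\ normc c <= 2 * r%:R, (K * #|bad| <= n)%N &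
    forall j : 'I_n, j \notin bad -> forall y,
      tends (psum g (c + (6 * r%:R)%:C%C * w ^+ j)) y -> normc y <= e].

(** By remez_step, passing from radius 16 r to r divides the exponent M of the bound by
    K = 4 * 16^q, up to an additive constant, whereas finite order only allows it to
    grow by a factor 16^q in the other direction. Starting from the radius 16^k r with k
    large gives a bound at r that does not depend on r. So g is constant, and the
    constant is 0 because it is small somewhere. *)
Lemma finite_order_vanish (g : nat -> C) (A q : nat) :
  (forall r : nat, (0 < r)%N -> coef_le g r%:R (2 ^+ (A * r ^ q))) ->
  mostly_small g -> g 0%N = 0.
Proof.
move=> hgrow hsm.
(* The factor 4 makes K^k exceed the initial exponent for k large. *)
pose K := (4 * 16 ^ q)%N.
have K3 : (3 <= K)%N by apply: (@leq_trans 4) => //; rewrite /K leq_pmulr// expn_gt0.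
have K2 : (2 <= K)%N := ltnW K3.
have [r0 hr0] := hsm 1 (4 * K)%N ltr01 ltac:(by rewrite muln_gt0 (leq_trans _ K2)).
pose r1 := maxn r0 1.
have step r M : (r1 <= r)%N -> coef_le g (16 * r%:R) (2 ^+ M) ->
    exists M', coef_le g r%:R (2 ^+ M') /\ (K * (M' - 4) <= M - 4)%N.
  rewrite geq_max => /andP[rr0 r_gt0] hg.
  pose n := (2 * M.+1)%N; have n0 : (0 < n)%N by rewrite muln_gt0.
  have [w hw] := @complex_prim_root R _ n0.
  have [c [bad [hc hbad hgood]]] := hr0 r rr0 n w hw.
  have rR : 0 < r%:R :> R by rewrite ltr0n.
  have hb1 : (K * (2 * #|bad|) <= M.+1)%N.
    have aux (a b m : nat) : (4 * a * b <= 2 * m.+1)%N -> (a * (2 * b) <= m.+1)%N by clear; nia.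
    exact: aux hbad.
  have hb : (M.+1 + #|bad| <= n)%N.
    have : (#|bad| <= M.+1)%N.
      by apply: leq_trans hb1; rewrite mulnCA mulnA leq_pmull// muln_gt0 (leq_trans _ K2).
    by rewrite /n; clear; lia.
  have := remez_step rR hg hw hc (ltnSn M) hb hgood.
  have -> : 4 ^+ #|bad|.+1 = 2 ^+ (2 * #|bad|.+1) :> R by rewrite exprM; congr (_ ^+ _); rewrite -natrX.
  move=> h; exists (2 * #|bad|.+1)%N; split => //.
  have aux (a b m : nat) : (3 <= a)%N -> (a * (2 * b) <= m.+1)%N ->
      (a * (2 * b.+1 - 4) <= m - 4)%N.
    clear; case: b => [|b] a3 h; first by rewrite muln0.
    have e1 : (a * (2 * b.+1) = a * (2 * b) + 2 * a)%N by ring.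
    have -> : (2 * b.+2 - 4 = 2 * b)%N by lia.
    by lia.
  exact: aux hb1.
have iter_step k : forall r M, (r1 <= r)%N -> coef_le g (16 ^+ k * r%:R) (2 ^+ M) ->
    exists M', coef_le g r%:R (2 ^+ M') /\ (K ^ k * (M' - 4) <= M - 4)%N.
  elim: k => [|k IH] r M rr hg.
    by exists M; rewrite expr0 mul1r in hg; rewrite expn0 mul1n.
  have hg' : coef_le g (16 ^+ k * (16 * r)%:R) (2 ^+ M) by rewrite natrM mulrA -exprSr.
  have rr' : (r1 <= 16 * r)%N by apply: leq_trans rr _; rewrite leq_pmull.
  have [M1 [h1 e1]] := IH _ M rr' hg'.
  rewrite natrM in h1.
  have [M2 [h2 e2]] := step r M1 rr h1.
  exists M2; split => //; apply: leq_trans e1.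
  by rewrite expnSr -mulnA leq_mul2l e2 orbT.
have hbd r : (r1 <= r)%N -> coef_le g r%:R (2 ^+ 4).
  move=> rr; have r_gt0 : (0 < r)%N by apply: leq_trans rr; rewrite leq_max orbT.
  pose k := (A * r ^ q)%N.
  have hg : coef_le g (16 ^+ k * r%:R) (2 ^+ (A * (16 ^ k * r) ^ q)).
    have := hgrow (16 ^ k * r)%N; rewrite natrM natrX; apply.
    by rewrite muln_gt0 expn_gt0.
  have [M' [hM' eM']] := iter_step k r _ rr hg.
  suff M4 : (M' <= 4)%N.
    apply: coef_leW hM' => //; by rewrite ler_weXn2l// ler1n.
  rewrite -subn_eq0 eqn0Ngt; apply/negP => M'0.
  have : (K ^ k * 1 <= A * (16 ^ k * r) ^ q)%N.
    apply: leq_trans (leq_trans eM' (leq_subr _ _)).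
    by rewrite leq_mul2l M'0 orbT.
  rewrite muln1 /K !expnMn -!expnM mulnCA [(q * k)%N]mulnC mulnC leq_pmul2l ?expn_gt0//.
  by rewrite -/k leqNgt ltn_expl.
have hk0 k : (0 < k)%N -> g k = 0.
  move=> k0; apply/eq0_normc/eqP; rewrite eq_le normc_ge0 andbT leNgt.
  apply/negP => gk0.
  pose r := maxn r1 (Num.bound (16 / normc (g k))).
  have r_ge1 : (1 <= r)%N by rewrite /r /r1 !leq_max orbT.
  have := hbd r (leq_maxl _ _) k; rewrite rnormC leNgt => /negP; apply.
  have h := archi_boundP (divr_ge0 (ler0n R 16) (ltW gk0)).
  rewrite ltr_pdivrMr// in h.
  have -> : 2 ^+ 4 = 16 :> R by rewrite -natrX.
  apply: lt_le_trans h _; rewrite mulrC ler_wpM2l ?(ltW gk0)//.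
  apply: le_trans (_ : r%:R <= _); first by rewrite ler_nat leq_maxr.
  by rewrite -natrX ler_nat -{1}[r]expn1 leq_pexp2l.
have gcst z n : (0 < n)%N -> psum g z n = g 0%N.
  case: n => // n _; rewrite /psum big_nat_recl//= expr0 scale1r big1 ?addr0// => k _.
  by rewrite hk0// scaler0.
apply/eq0_normc/eqP; rewrite eq_le normc_ge0 andbT leNgt; apply/negP => g0.
have e0 : 0 < normc (g 0%N) / 2 by rewrite divr_gt0.
have [r2 hr2] := hsm _ 2%N e0 isT.
have w1 : 1.-primitive_root (1 : C).
  by apply/andP; split => //; apply/forallP => i; rewrite ord1 unity_rootE eqxx.
have [c [bad [_ hb hg]]] := hr2 r2 (leqnn _) 1%N 1 w1.
have bad0 : ord0 \notin bad.
  apply/negP => h; move: hb; rewrite leqNgt (cardD1 ord0) h mulnDr; by [].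
have := hg ord0 bad0 (g 0%N); have : tends (psum g (c + (6 * r2%:R)%:C%C * 1 ^+ (ord0 : 'I_1))) (g 0%N).
  apply: (tends_eventually (m := 1%N)) (tends_cst _) => n n0.
  by rewrite gcst.
move=> ht /(_ ht); move: g0; clear; lra.
Qed.

End Liouville.

(** * Points at which a sum of simple fractions is small *)

Section GoodPoints.
Context {R : realType}.
Local Notation C := R[i].

(** The points in a row or column next to (x, y) number at most 8 Q. For the others the
    double sum is dominated by a product of two sums as in sum_rsqrt_far. *)
Lemma sum_grid (x y a : R) (Q : nat) : 0 <= a ->
  \sum_(u < Q) \sum_(v < Q)
    (if (`|u%:R - x| < 1) || (`|v%:R - y| < 1) then 1
     else a * ((Num.sqrt `|u%:R - x|)^-1 * (Num.sqrt `|v%:R - y|)^-1)) <=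
  8 * Q%:R + 16 * a * Q%:R.
Proof.
move=> a0.
pose N (x : R) (u : nat) : R := if `|u%:R - x| < 1 then 1 else 0.
pose F (x : R) (u : nat) : R := if 1 <= `|u%:R - x| then (Num.sqrt `|u%:R - x|)^-1 else 0.
have F0 z u : 0 <= F z u by rewrite /F; case: ifP => // _; rewrite invr_ge0 sqrtr_ge0.
have N0 z u : 0 <= N z u by rewrite /N; case: ifP.
have sN z : \sum_(u < Q) N z u <= 4.
  by have := count_near z Q; rewrite big_mkcond big_mkord.
have sF z : \sum_(u < Q) F z u <= 4 * Num.sqrt Q%:R.
  by have := sum_rsqrt_far z Q; rewrite big_mkcond big_mkord.
apply: le_trans (_ : \sum_(u < Q) \sum_(v < Q) (N x u + N y v + a * (F x u * F y v)) <= _).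
  apply: ler_sum => u _; apply: ler_sum => v _.
  have h3 : 0 <= a * (F x u * F y v) by rewrite !mulr_ge0.
  case: ifPn => [/orP[h|h]|].
  - by rewrite {1}/N h; have := N0 y v; move: h3; clear; lra.
  - by rewrite {2}/N h; have := N0 x u; move: h3; clear; lra.
  rewrite negb_or -!leNgt => /andP[h1 h2].
  by rewrite {1}/F {1}/F h1 h2; have := N0 x u; have := N0 y v; clear; lra.
under eq_bigr => u _ do rewrite big_split /= big_split /= sumr_const card_ord -mulr_sumr -mulr_sumr.
rewrite !big_split /= sumr_const card_ord -mulr_sumr -mulr_suml sumrMnl -[X in X <= _]addrA.
have h1 := sN x; have h2 := sN y; have h3 := sF x; have h4 := sF y.
have Q0 := ler0n R Q.
rewrite -(mulr_natr (\sum_(i < Q) N x i)) -(mulr_natr (\sum_(i < Q) N y i)).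
have h5 : (\sum_(i < Q) F x i) * (\sum_(i < Q) F y i) <= 16 * Q%:R.
  apply: le_trans (_ : (4 * Num.sqrt Q%:R) * (4 * Num.sqrt Q%:R) <= _).
    by apply: ler_pM => //; apply: sumr_ge0.
  have -> : 4 * Num.sqrt Q%:R * (4 * Num.sqrt Q%:R) = 16 * (Num.sqrt Q%:R ^+ 2) :> R by ring.
  by rewrite sqr_sqrtr.
have := ler_wpM2l a0 h5; have := ler_wpM2r Q0 h1; have := ler_wpM2r Q0 h2.
by clear; lra.
Qed.

(** It bounds 1 / |z| by a product of functions of the two coordinates, so that the
    sums over a square grid factor. *)
Lemma normc_ge_sqrt (z : C) : Num.sqrt `|complex.Re z| * Num.sqrt `|complex.Im z| <= normc z.
Proof.
case: z => p q /=; rewrite -sqrtrM//; apply: ler_wsqrtr.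
have := sqr_ge0 (`|p| - `|q|); rewrite sqrrB !real_normK ?num_real//.
have := mulr_ge0 (normr_ge0 p) (normr_ge0 q); have := sqr_ge0 p; have := sqr_ge0 q.
by clear; lra.
Qed.

(** The first terms are small because of 1 / r, the others because m is summable. *)
Lemma weighted_sum_small (t m : nat -> R) (Bm e : R) :
  (forall n, 0 <= m n) -> (forall N, \sum_(0 <= n < N) m n <= Bm) ->
  (forall n, 0 < t n) -> 0 < e ->
  exists r0 : nat, forall r : nat, (r0 <= r)%N -> (0 < r)%N ->
    forall N, \sum_(0 <= n < N) m n * Num.min 1 (r%:R * t n)^-1 <= e.
Proof.
move=> m0 hm t0 e0.
have e2 : 0 < e / 2 by rewrite divr_gt0.
have [N1 hN1] := real_summable_tail m0 hm e2.
pose S := \sum_(0 <= n < N1) m n / t n.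
have S0 : 0 <= S by apply: sumr_ge0 => n _; rewrite divr_ge0// ltW.
exists (Num.bound (S / (e / 2))) => r hr r0 N.
have rR : 0 < r%:R :> R by rewrite ltr0n.
have hS : S <= r%:R * (e / 2).
  rewrite -ler_pdivrMr//; have := archi_boundP (divr_ge0 S0 (ltW e2)) => /ltW/le_trans; apply.
  by rewrite ler_nat.
have w0 n : 0 <= m n * Num.min 1 (r%:R * t n)^-1.
  by rewrite mulr_ge0// le_min ler01 invr_ge0 mulr_ge0// ?ler0n// ltW.
apply: le_trans (_ : \sum_(0 <= n < maxn N N1) m n * Num.min 1 (r%:R * t n)^-1 <= _).
  by rewrite (big_cat_nat (leq0n N) (leq_maxl N N1))/= lerDl sumr_ge0.
rewrite (big_cat_nat (leq0n N1) (leq_maxr N N1))/=.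
have h1 : \sum_(0 <= n < N1) m n * Num.min 1 (r%:R * t n)^-1 <= e / 2.
  apply: le_trans (_ : S / r%:R <= _); last by rewrite ler_pdivrMr// mulrC.
  rewrite mulr_suml; apply: ler_sum => n _; rewrite -mulrA ler_wpM2l//.
  by rewrite ge_min invfM [(t n)^-1 * _]mulrC lexx orbT.
have h2 : \sum_(N1 <= n < maxn N N1) m n * Num.min 1 (r%:R * t n)^-1 <= e / 2.
  apply: le_trans (ltW (hN1 N1 (maxn N N1) (leqnn _))).
  by apply: ler_sum => n _; rewrite ler_piMr// ge_min lexx.
by have := lerD h1 h2; clear; lra.
Qed.

(** Average over the centres c = (u + i v) r / Q of a square grid. When |s_i| is small
    compared to 1 / r the denominator is at least 1 / 2, and weighted_sum_small
    applies. For the finitely many other i, normc_ge_sqrt bounds 1 / |1 / s_i - l| by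
    quantities whose sums over the grid are controlled by sum_grid. So some centre has a
    small total over j of the weights W, and the bad points are those where W >= 1. *)
Lemma good_points (s : nat -> C) (m : nat -> R) (Bm e : R) (K : nat) :
  (forall n, 0 <= m n) -> (forall N, \sum_(0 <= n < N) m n <= Bm) ->
  (forall n, s n != 0) -> tends s 0 -> 0 < e -> (0 < K)%N ->
  exists r0 : nat, forall r : nat, (r0 <= r)%N -> forall n (w : C), n.-primitive_root w ->
  exists (c : C) (bad : {set 'I_n}), [/\ normc c <= 2 * r%:R, (K * #|bad| <= n)%N &
    forall j : 'I_n, j \notin bad -> let l := c + (6 * r%:R)%:C%C * w ^+ j in
      (forall i, 1 - l * s i != 0) /\
      forall N, \sum_(0 <= i < N) m i / normc (1 - l * s i) <= e].
Proof.
move=> m0 hm s0 hs e0 K0.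
have KR : 0 < K%:R :> R by rewrite ltr0n.
have ns0 n : 0 < normc (s n) by exact: normc_gt0.
(* Small enough for 2 * eta <= e / 2 and for the average of the weights of the far points
   to be at most 1 / (2 * K). *)
pose eta := e / (32 * (32 * K%:R)).
have eta0 : 0 < eta by rewrite /eta divr_gt0 ?mulr_gt0 ?ltr0n.
have [r0 hr0] := weighted_sum_small m0 hm ns0 eta0.
exists (maxn r0 1) => r; rewrite geq_max => /andP[rr0 r_gt0] n w hw.
have n_gt0 := prim_order_gt0 hw.
have rR : 0 < r%:R :> R by rewrite ltr0n.
have hw' := hr0 r rr0 r_gt0.
pose mu i := m i * Num.min 1 (r%:R * normc (s i))^-1.
have mu0 i : 0 <= mu i by rewrite mulr_ge0// le_min ler01 invr_ge0 mulr_ge0// ltW.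
have [n0 hn0] : exists n0, forall i, (n0 <= i)%N -> 16 * r%:R * normc (s i) <= 1.
  have e1 : 0 < (16 * r%:R)^-1 :> R by rewrite invr_gt0 mulr_gt0.
  have [N hN] := hs _ e1; exists N => i Ni.
  have := hN i Ni; rewrite subr0 rnormC => /ltW.
  by rewrite -[_^-1]mul1r ler_pdivlMr ?mulr_gt0// mulrC.
pose big i := 1 < 16 * r%:R * normc (s i).
have bign0 i : big i -> (i < n0)%N.
  by rewrite /big ltNge => h; rewrite ltnNge; apply: contra h => /hn0.
(* The rows and columns next to a pole take up at most 8 * n0 / Q of the grid, hence
   at most 1 / (2 * K). *)
pose Q := (16 * n0 * K).+1.
have QR : 0 < Q%:R :> R by rewrite ltr0n.
pose cc (p : 'I_Q * 'I_Q) : C := ((p.1%:R * (r%:R / Q%:R)) +i* (p.2%:R * (r%:R / Q%:R)))%C.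
pose lam p (j : 'I_n) := cc p + (6 * r%:R)%:C%C * w ^+ j.
(* The position of 1 / s_i with respect to the grid, for the j-th point of the circle. *)
pose xy i (j : 'I_n) : C := ((s i)^-1 - (6 * r%:R)%:C%C * w ^+ j) * (Q%:R / r%:R)%:C%C.
pose al i : R := 2 / e * (m i * Q%:R / (r%:R * normc (s i))).
have al0 i : 0 <= al i.
  by rewrite /al mulr_ge0 ?divr_ge0 ?mulr_ge0 ?(ltW e0) ?(ltW rR) ?(ltW QR) ?(ltW (ns0 _)).
pose near i j (p : 'I_Q * 'I_Q) :=
  (`|p.1%:R - complex.Re (xy i j)| < 1) || (`|p.2%:R - complex.Im (xy i j)| < 1).
pose f i j p : R := if near i j p then 1 else
  al i * ((Num.sqrt `|p.1%:R - complex.Re (xy i j)|)^-1 *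
          (Num.sqrt `|p.2%:R - complex.Im (xy i j)|)^-1).
have f0 i j p : 0 <= f i j p.
  rewrite /f; case: ifP => // _; apply: mulr_ge0; first exact: al0.
  by apply: mulr_ge0; rewrite invr_ge0 sqrtr_ge0.
have hf i j : \sum_(p : 'I_Q * 'I_Q) f i j p <= 8 * Q%:R + 16 * al i * Q%:R.
  have := @sum_grid (complex.Re (xy i j)) (complex.Im (xy i j)) (al i) Q (al0 i).
  by rewrite pair_big.
have hal i : big i -> al i <= 32 / e * Q%:R * mu i.
  move=> hb; rewrite /al /mu.
  have -> : 32 / e * Q%:R * (m i * Num.min 1 (r%:R * normc (s i))^-1) =
    2 / e * (m i * Q%:R * (16 * Num.min 1 (r%:R * normc (s i))^-1)) by ring.
  rewrite ler_wpM2l ?divr_ge0 ?(ltW e0)// ler_wpM2l ?mulr_ge0 ?(ltW QR)//.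
  have h1 : 0 < r%:R * normc (s i) by rewrite mulr_gt0.
  have [h|h] := leP 1 ((r%:R * normc (s i))^-1).
    by rewrite mulr1 -[_^-1]mul1r ler_pdivrMr//; move: hb; rewrite /big -mulrA => /ltW.
  by rewrite ler_peMl ?invr_ge0 ?(ltW h1)// ler1n.
pose W p j := \sum_(i < n0 | big i) f i j p.
have W0 p j : 0 <= W p j by apply: sumr_ge0.
have [p hp] : exists p, \sum_(j < n) W p j <= n%:R / K%:R.
  apply: exists_le_average; first by rewrite card_prod !card_ord muln_gt0.
  rewrite exchange_big /= card_prod !card_ord.
  apply: le_trans (_ : \sum_(j < n) (Q * Q)%:R / K%:R <= _); last first.
    by rewrite sumr_const card_ord -mulr_natr; rewrite le_eqVlt; apply/orP; left; apply/eqP; ring.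
  apply: ler_sum => j _; rewrite exchange_big /=.
  apply: le_trans (_ : \sum_(i < n0 | big i) (8 * Q%:R + 16 * (32 / e * Q%:R * mu i) * Q%:R) <= _).
    apply: ler_sum => i hb; apply: le_trans (hf i j) _.
    by rewrite lerD2l ler_wpM2r ?(ltW QR)// ler_wpM2l// hal.
  apply: le_trans (_ : \sum_(i < n0) (8 * Q%:R + 16 * (32 / e * Q%:R * mu i) * Q%:R) <= _).
    rewrite big_mkcond; apply: ler_sum => i _; case: ifP => // _.
    have he : 0 <= 32 / e by rewrite divr_ge0// ltW.
    apply: addr_ge0; first by apply: mulr_ge0; [exact: ler0n|exact: ltW QR].
    apply: mulr_ge0 (ltW QR); apply: mulr_ge0; first exact: ler0n.
    exact: (mulr_ge0 (mulr_ge0 he (ltW QR)) (mu0 i)).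
  rewrite big_split /= sumr_const card_ord -!mulr_suml -!mulr_sumr.
  have := hw' n0; rewrite big_mkord -/mu => hS.
  have h1 : 16 * (32 / e * Q%:R * \sum_(i < n0) mu i) * Q%:R <= (Q * Q)%:R / K%:R / 2.
    apply: le_trans (_ : 16 * (32 / e * Q%:R * eta) * Q%:R <= _).
      rewrite ler_wpM2r ?(ltW QR)// ler_wpM2l// ler_wpM2l ?mulr_ge0 ?invr_ge0 ?(ltW QR) ?(ltW e0)//.
    rewrite natrM /eta le_eqVlt; apply/orP; left; apply/eqP; field.
    by rewrite !gt_eqF.
  have h2 : 8 * Q%:R *+ n0 <= (Q * Q)%:R / K%:R / 2 :> R.
    rewrite -mulr_natr natrM.
    have -> : Q%:R * Q%:R / K%:R / 2 = Q%:R * (Q%:R / K%:R / 2) :> R by ring.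
    rewrite mulrAC mulrC ler_wpM2l ?(ltW QR)// ler_pdivlMr// ler_pdivlMr//.
    have : (16 * n0 * K)%:R <= Q%:R :> R by rewrite ler_nat.
    by rewrite !natrM; clear; lra.
  by have := lerD h2 h1; clear; lra.
have hcc : normc (cc p) <= 2 * r%:R.
  have hu (u : 'I_Q) : 0 <= (u%:R : R) * (r%:R / Q%:R) <= r%:R.
    rewrite mulr_ge0 ?divr_ge0 ?(ltW rR) ?(ltW QR)//= mulrCA ler_piMr ?(ltW rR)//.
    by rewrite ler_pdivrMr// mul1r ler_nat ltnW.
  have /andP[h1 h2] := hu p.1; have /andP[h3 h4] := hu p.2.
  apply: le_trans (normc_le_ReIm _) _; rewrite /= !ger0_norm//.
  by move: h2 h4; clear; lra.
exists (cc p), [set j | 1 <= W p j]%SET; split => //.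
  have : \sum_(j < n | j \in [set j | 1 <= W p j]%SET) (1 : R) <= n%:R / K%:R.
    apply: le_trans hp; rewrite big_mkcond; apply: ler_sum => j _.
    by rewrite inE; case: ifP.
  by rewrite sumr_const ler_pdivlMr// -natrM ler_nat mulnC.
move=> j; rewrite inE -ltNge => hW l.
have hWi i : big i -> f i j p <= W p j.
  move=> hb; rewrite /W (bigD1 (Ordinal (bign0 i hb)))//= lerDl.
  by apply: sumr_ge0.
have hnear i : big i -> near i j p = false.
  move=> hb; apply/negP => h; have := hWi i hb; rewrite /f h.
  by rewrite leNgt hW.
have nl : normc l <= 8 * r%:R.
  apply: le_trans (le_normcD _ _) _.
  rewrite normcM normcX (normc_prim_root hw) expr1n mulr1 normc_real ger0_norm ?mulr_ge0//.
  by move: hcc; clear; lra.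
have hsmall i : ~~ big i -> 2^-1 <= normc (1 - l * s i).
  rewrite -leNgt => h.
  have h1 : normc (l * s i) <= 2^-1.
    by rewrite normcM; have := ler_wpM2r (ltW (ns0 i)) nl; move: h; clear; lra.
  by have := le_normcD (1 - l * s i) (l * s i); rewrite subrK normc1; move: h1; clear; lra.
have hbig i : big i -> 0 < normc (1 - l * s i) /\
    2 / e * (m i / normc (1 - l * s i)) <= f i j p.
  move=> hb; have := hnear i hb; rewrite /f => hn; rewrite hn.
  move: hn => /negbT; rewrite negb_or -!leNgt.
  set a := `|_ - _|; set b := `|_ - _| => /andP[a1 b1].
  pose q : R := r%:R / Q%:R; have q0 : 0 < q by rewrite divr_gt0.
  have DE : (s i)^-1 - l = xy i j * q%:C%C - cc p.
    have e1 : (Q%:R / r%:R)%:C%C * q%:C%C = 1 :> C.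
      apply/eqP; rewrite eq_complex /= !mul0r !mulr0 subr0 addr0 eqxx andbT /q.
      by apply/eqP; field; rewrite !gt_eqF.
    by rewrite /xy -mulrA e1 mulr1 /l opprD addrA addrAC.
  have aE : `|complex.Re ((s i)^-1 - l)| = a * q.
    have -> : complex.Re ((s i)^-1 - l) = (complex.Re (xy i j) - p.1%:R) * q.
      by rewrite DE raddfB /=; case: (xy i j) => x y /=; rewrite /q; ring.
    by rewrite normrM (gtr0_norm q0) distrC.
  have bE : `|complex.Im ((s i)^-1 - l)| = b * q.
    have -> : complex.Im ((s i)^-1 - l) = (complex.Im (xy i j) - p.2%:R) * q.
      by rewrite DE raddfB /=; case: (xy i j) => x y /=; rewrite /q; ring.
    by rewrite normrM (gtr0_norm q0) distrC.
  have := normc_ge_sqrt ((s i)^-1 - l); rewrite aE bE.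
  have -> : Num.sqrt (a * q) * Num.sqrt (b * q) = Num.sqrt a * Num.sqrt b * q.
    rewrite (sqrtrM q (le_trans ler01 a1)) (sqrtrM q (le_trans ler01 b1)).
    by rewrite -[in RHS](sqr_sqrtr (ltW q0)); ring.
  have sa : 0 < Num.sqrt a by rewrite sqrtr_gt0 (lt_le_trans ltr01).
  have sb : 0 < Num.sqrt b by rewrite sqrtr_gt0 (lt_le_trans ltr01).
  move=> hD.
  have -> : 1 - l * s i = s i * ((s i)^-1 - l) by rewrite mulrBr divff// mulrC.
  rewrite normcM.
  have hpos : 0 < normc (s i) * (Num.sqrt a * Num.sqrt b * q) :=
    mulr_gt0 (ns0 i) (mulr_gt0 (mulr_gt0 sa sb) q0).
  have hle : normc (s i) * (Num.sqrt a * Num.sqrt b * q) <= normc (s i) * normc ((s i)^-1 - l).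
    by rewrite ler_wpM2l// ltW.
  split; first exact: lt_le_trans hle.
  apply: le_trans (_ : 2 / e * (m i / (normc (s i) * (Num.sqrt a * Num.sqrt b * q))) <= _).
    rewrite ler_wpM2l ?divr_ge0 ?(ltW e0)// ler_wpM2l// lef_pV2 ?posrE//.
    exact: lt_le_trans hle.
  rewrite le_eqVlt; apply/orP; left; apply/eqP; rewrite /al /q; field.
  by rewrite !gt_eqF.
split=> [i|N].
  have h : 0 < normc (1 - l * s i).
    have [/hbig[]//|/hsmall] := boolP (big i).
    by apply: lt_le_trans; rewrite invr_gt0.
  by apply/eqP => h0; move: h; rewrite h0 normc0 ltxx.
have mm0 i : 0 <= m i / normc (1 - l * s i) by rewrite divr_ge0// normc_ge0.
rewrite (bigID big) /=.
have h1 : \sum_(0 <= i < N | big i) m i / normc (1 - l * s i) <= e / 2.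
  apply: le_trans (_ : \sum_(0 <= i < maxn N n0 | big i) m i / normc (1 - l * s i) <= _).
    by rewrite (big_cat_nat (leq0n N) (leq_maxl N n0))/= lerDl sumr_ge0.
  rewrite (big_cat_nat (leq0n n0) (leq_maxr N n0))/= [X in _ + X]big_nat_cond [X in _ + X]big_pred0.
    rewrite addr0 big_mkord.
    apply: le_trans (_ : \sum_(i < n0 | big i) (e / 2) * f i j p <= _).
      apply: ler_sum => i hb; have [_] := hbig i hb.
      move=> h; have := ler_wpM2l (_ : 0 <= e / 2) h; rewrite mulrA.
      have -> : e / 2 * (2 / e) = 1 by field; rewrite gt_eqF.
      by rewrite mul1r; apply; rewrite divr_ge0// ltW.
    by rewrite -mulr_sumr -/(W p j) ler_piMr ?divr_ge0// ltW.
  move=> i; apply/negbTE/negP => /andP[/andP[h2 _] /bign0].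
  by rewrite ltnNge h2.
have h2 : \sum_(0 <= i < N | ~~ big i) m i / normc (1 - l * s i) <= e / 2.
  apply: le_trans (_ : \sum_(0 <= i < N) 2 * mu i <= _).
    rewrite big_mkcond; apply: ler_sum => i _; case: ifP => [hb|_]; last first.
      by rewrite mulr_ge0.
    have -> : mu i = m i.
      have h0 : 0 < r%:R * normc (s i) := mulr_gt0 rR (ns0 i).
      rewrite /mu min_l ?mulr1// invf_ge1//.
      by move: hb h0; rewrite -leNgt; clear; lra.
    rewrite mulrC ler_wpM2r//; have := hsmall i hb => h.
    by rewrite -[2]invrK lef_pV2 ?posrE ?invr_gt0//; apply: lt_le_trans h; rewrite invr_gt0.
  rewrite -mulr_sumr; have := hw' N; rewrite -/mu => hS.
  apply: le_trans (_ : 2 * eta <= _); first by rewrite ler_wpM2l.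
  rewrite /eta; have -> : 2 * (e / (32 * (32 * K%:R))) = (e / 2) * (16 * (16 * K%:R))^-1.
    by field; rewrite gt_eqF.
  rewrite ler_piMr ?divr_ge0 ?(ltW e0)// invf_le1 ?mulr_gt0//.
  by have : 1 <= K%:R :> R by [rewrite ler1n]; clear; lra.
by have := lerD h1 h2; clear; lra.
Qed.

End GoodPoints.

(** * Spans of generalized eigenvectors *)

Section Span.
Context {K : numFieldType} {V : lmodType K}.
Implicit Types (S : set V) (x y : V).

Lemma lin_span_subset S x : S x -> lin_span S x.
Proof.
move=> Sx; exists 1%N, (fun=> 1), (fun=> x); split => //.
by rewrite big_ord1 scale1r.
Qed.

Lemma lin_span_subspace S : linear_subspace (lin_span S).
Proof.
split; first by exists 0%N, (fun=> 0), (fun=> 0); split; [case|rewrite big_ord0].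
move=> k x y [n [c [v [hv ->]]]] [m [d [w [hw ->]]]].
exists (n + m)%N,
  (fun i => match fintype.split i with inl j => k * c j | inr j => d j end),
  (fun i => match fintype.split i with inl j => v j | inr j => w j end); split.
  by move=> i; case: (fintype.split i).
rewrite big_split_ord /= scaler_sumr; congr (_ + _).
  apply: eq_bigr => i _; rewrite scalerA.
  by case: splitP => j //= ij; [rewrite (ord_inj ij)|have := ltn_ord i; rewrite ij ltnNge leq_addr].
apply: eq_bigr => i _.
case: splitP => j /= ij; last by move/addnI: ij => /ord_inj ->.
by have := ltn_ord j; rewrite -ij ltnNge leq_addr.
Qed.

Lemma lin_span_ind S (P : V -> Prop) : linear_subspace P -> (forall x, S x -> P x) ->
  forall x, lin_span S x -> P x.
Proof.
move=> [P0 PD] hS x [n [c [v [hv ->]]]].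
elim: n c v hv => [|n IH] c v hv; first by rewrite big_ord0.
by rewrite big_ord_recl; apply: PD; [exact: hS|exact: IH].
Qed.

Lemma linear_subspaceZ (N : set V) (k : K) x : linear_subspace N -> N x -> N (k *: x).
Proof. by move=> [h0 h] hx; have := h k x 0 hx h0; rewrite addr0. Qed.

Lemma linear_subspaceD (N : set V) x y : linear_subspace N -> N x -> N y -> N (x + y).
Proof. by move=> [h0 h] hx hy; have := h 1 x y hx hy; rewrite scale1r. Qed.

Lemma linear_subspaceB (N : set V) x y : linear_subspace N -> N x -> N y -> N (x - y).
Proof.
by move=> hN hx hy; apply: linear_subspaceD => //; rewrite -scaleN1r; exact: linear_subspaceZ.
Qed.

Context (U : V -> V) (M : set V).
Context (U_lin : forall k x y, U (k *: x + y) = k *: U x + U y).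
Context (M_sub : linear_subspace M) (M_inv : forall x, M x -> M (U x)).

Let T mu y := U y - mu *: y.

Lemma linear_mapD x y : U (x + y) = U x + U y.
Proof. by have := U_lin 1 x y; rewrite !scale1r. Qed.

Lemma linear_map0 : U 0 = 0.
Proof. by have := U_lin (-1) 0 0; rewrite scaler0 addr0 scaleN1r addNr. Qed.

Lemma linear_mapZ k x : U (k *: x) = k *: U x.
Proof. by have := U_lin k x 0; rewrite linear_map0 !addr0. Qed.

Lemma linear_mapB x y : U (x - y) = U x - U y.
Proof. by rewrite -[- y]scaleN1r -[- U y]scaleN1r addrC U_lin addrC. Qed.

Let T_lin mu k x y : T mu (k *: x + y) = k *: T mu x + T mu y.
Proof. by rewrite /T U_lin scalerDr scalerBr !scalerA [mu * k]mulrC opprD addrACA. Qed.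

Let iterT_lin mu m k x y : iter m (T mu) (k *: x + y) = k *: iter m (T mu) x + iter m (T mu) y.
Proof. by elim: m => //= m ->; exact: T_lin. Qed.

Let iterT_0 mu m : iter m (T mu) 0 = 0.
Proof. by elim: m => //= m ->; rewrite /T linear_map0 scaler0 subr0. Qed.

Let T_M mu x : M x -> M (T mu x).
Proof. by move=> Mx; apply: linear_subspaceB => //; [exact: M_inv|exact: linear_subspaceZ]. Qed.

Local Notation W := [set x | M x /\ gen_eigenvector U x]%classic.

Lemma gen_eigenvector_in_span mu m x : M x -> iter m (T mu) x = 0 -> lin_span W x.
Proof. by move=> Mx hx; apply: lin_span_subset; split => //; exists mu, m. Qed.

(** The operator I - l U is invertible on the generalized eigenvectors of eigenvalue mu
    if l * mu <> 1; the induction is on the order of nilpotency. *)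
Lemma resolvent_gen_eigenvector (l mu : K) m v : M v -> iter m (T mu) v = 0 -> 1 - l * mu != 0 ->
  exists w, [/\ M w, iter m (T mu) w = 0 & w - l *: U w = v].
Proof.
move=> + + lmu; elim: m v => [|m IH] v Mv hv.
  by exists 0; split=> //; [exact: M_sub.1|rewrite linear_map0 scaler0 subr0; rewrite /= in hv; rewrite hv].
rewrite iterSr in hv.
have [w [Mw hw ew]] := IH _ (T_M mu Mv) hv.
exists ((1 - l * mu)^-1 *: (l *: w + v)); split.
- by apply: linear_subspaceZ => //; exact: M_sub.2.
- rewrite iterSr -[_ *: _]addr0 T_lin /T linear_map0 scaler0 subr0 addr0 -/(T mu _).
  rewrite -[_ *: T mu _]addr0 iterT_lin iterT_0 addr0 T_lin iterT_lin hv addr0.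
  by rewrite -iterSr iterS hw /T linear_map0 scaler0 subr0 !scaler0.
set k1 := (1 - l * mu)^-1.
transitivity (k1 *: (l *: w + v - l *: (l *: U w + U v))).
  by rewrite scalerBr linear_mapZ U_lin !scalerA [l * k1]mulrC.
have -> : l *: w + v - l *: (l *: U w + U v) = (1 - l * mu) *: v.
  have e1 : l *: w + v - l *: (l *: U w + U v) = l *: (w - l *: U w) + (v - l *: U v).
    by rewrite scalerDr scalerBr opprD addrACA.
  have e2 : U v = T mu v + mu *: v by rewrite /T subrK.
  rewrite e1 ew e2; move: (T mu v) => z.
  by rewrite scalerDr scalerA opprD addrCA addNKr scalerBl scale1r.
by rewrite scalerA mulVf// scale1r.
Qed.

Lemma lin_span_stable x : lin_span W x -> lin_span W (U x).
Proof.
apply: (@lin_span_ind _ (fun x => lin_span W (U x))).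
  split; first by rewrite linear_map0; exact: (lin_span_subspace _).1.
  by move=> k y z hy hz; rewrite U_lin; exact: (lin_span_subspace _).2.
move=> v [Mv [mu [m hm]]]; apply: (@gen_eigenvector_in_span mu m); first exact: M_inv.
have : iter m (T mu) (T mu v) = 0 by rewrite -iterSr iterS hm /T linear_map0 scaler0 subr0.
have -> : U v = mu *: v + T mu v by rewrite /T addrC subrK.
by rewrite iterT_lin hm scaler0 add0r.
Qed.

Let iterT_add mu m n x : iter m (T mu) x = 0 -> iter (n + m) (T mu) x = 0.
Proof. by rewrite iterD => ->; exact: iterT_0. Qed.

(** The generalized eigenvectors of eigenvalue other than 1 / l are removed from the
    right-hand side by resolvent_gen_eigenvector. The others are collected in one vector
    killed by a power of U - 1 / l, and then so is what is left of y. *)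
Lemma lin_span_resolvent (l : K) y : l != 0 -> M y ->
  lin_span W (y - l *: U y) -> lin_span W y.
Proof.
move=> l0 My [n [c [v [hv e]]]].
suff main z ee m : M z -> M ee -> iter m (T l^-1) ee = 0 ->
    z - l *: U z = ee + \sum_(i < n) c i *: v i -> lin_span W z.
  by apply: (@main y 0 0%N) => //; [exact: M_sub.1|rewrite add0r].
elim: n c v hv {e} z ee m => [|n IH] c v hv z ee m Mz Me he ez.
  apply: (@gen_eigenvector_in_span l^-1 m.+1) => //.
  have hT : T l^-1 z = - l^-1 *: ee + 0.
    rewrite big_ord0 addr0 in ez; rewrite -ez scalerBr scalerA mulNr mulVf// scaleNr.
    by rewrite scaleN1r opprK addr0 addrC.
  by rewrite iterSr hT iterT_lin he iterT_0 scaler0 addr0.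
rewrite big_ord_recl addrA in ez.
have [Mv [mu [k hk]]] := hv ord0.
have Mcv : M (c ord0 *: v ord0) by exact: linear_subspaceZ.
have hk' : iter k (T mu) (c ord0 *: v ord0) = 0.
  by rewrite -[_ *: _]addr0 iterT_lin hk iterT_0 scaler0 addr0.
have hv' i : W (v (lift ord0 i)) by exact: hv.
have [lmu|lmu] := eqVneq (1 - l * mu) 0.
  have muE : mu = l^-1.
    by apply: (mulfI l0); rewrite divff//; apply/eqP; rewrite eq_sym -subr_eq0 lmu.
  apply: (IH (fun i => c (lift ord0 i)) _ hv' z (ee + c ord0 *: v ord0) (k + m)%N) => //.
    exact: linear_subspaceD.
  rewrite -[ee]scale1r iterT_lin (iterT_add k he) scaler0 add0r addnC.
  by rewrite -muE; exact: iterT_add.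
have [w [Mw hw ew]] := resolvent_gen_eigenvector Mcv hk' lmu.
have -> : z = w + (z - w) by rewrite addrC subrK.
apply: linear_subspaceD; first exact: lin_span_subspace.
  exact: gen_eigenvector_in_span hw.
apply: (IH (fun i => c (lift ord0 i)) _ hv' (z - w) ee m) => //; first exact: linear_subspaceB.
rewrite linear_mapB.
have -> : z - w - l *: (U z - U w) = (z - l *: U z) - (w - l *: U w).
  by rewrite scalerBr !opprD !opprK addrACA.
rewrite ew ez.
by rewrite addrAC addrK.
Qed.

End Span.

(** * The Hilbert space of square summable sequences *)

Section Hilbert.
Context {R : realType} (nu : nat -> {posnum R}).
Local Notation C := R[i].
Local Notation H := (L2 nu).
Implicit Types (x y z f : H).

Lemma rnormL2 x : rnorm x = l2norm nu x.
Proof. by []. Qed.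

Lemma L2_ext x y : (forall n, x n = y n) -> x = y.
Proof. by move=> h; apply/val_inj/funext. Qed.

Definition sqsum (u : nat -> C) N : R := \sum_(0 <= n < N) normc (u n) ^+ 2 * (nu n)%:num.

Lemma sqsum_ge0 u N : 0 <= sqsum u N.
Proof. by apply: sumr_ge0 => n _; rewrite mulr_ge0// sqr_ge0. Qed.

Lemma square_summableP (u : nat -> C) (B : R) : 0 <= B -> (forall N, sqsum u N <= B ^+ 2) ->
  square_summable nu u /\ l2norm nu u <= B.
Proof.
move=> B0 h.
have hE : (sqnormE nu u <= (B ^+ 2)%:E)%E.
  apply: lime_le.
    by apply: is_cvg_nneseries => n _ _; rewrite lee_fin mulr_ge0// sqr_ge0.
  by apply: nearW => N; rewrite sumEFin lee_fin; exact: h.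
split; first exact: le_lt_trans hE (ltry _).
apply: le_trans (_ : Num.sqrt (B ^+ 2) <= _); last by rewrite sqrtr_sqr ger0_norm.
apply: ler_wsqrtr; rewrite -lee_fin fineK//.
by rewrite ge0_fin_numE ?sqnormE_ge0//; exact: le_lt_trans hE (ltry _).
Qed.

Lemma square_summable_sqsum (u : nat -> C) N : square_summable nu u ->
  sqsum u N <= l2norm nu u ^+ 2.
Proof.
move=> su; rewrite /l2norm sqr_sqrtr ?fine_ge0 ?sqnormE_ge0//.
rewrite -lee_fin fineK ?sqnormE_fin// /sqsum -sumEFin.
by apply: nneseries_lim_ge => n _ _; rewrite lee_fin mulr_ge0// sqr_ge0.
Qed.

Lemma L2_square_summable x : square_summable nu x.
Proof. exact/asboolP/(L2P x). Qed.

Lemma sqsum_le x N : sqsum x N <= rnorm x ^+ 2.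
Proof. exact/square_summable_sqsum/L2_square_summable. Qed.

Lemma L2_make (u : nat -> C) (B : R) : 0 <= B -> (forall N, sqsum u N <= B ^+ 2) ->
  exists x : H, (forall n, x n = u n) /\ rnorm x <= B.
Proof.
move=> B0 /(square_summableP B0)[su hB].
by exists (MkL2 (introT (asboolP _) su)); split.
Qed.

Lemma coord_le x n : normc (x n) * Num.sqrt (nu n)%:num <= rnorm x.
Proof.
have h := sqsum_le x n.+1.
rewrite -(@ler_pXn2r _ 2)// ?nnegrE ?mulr_ge0 ?normc_ge0 ?sqrtr_ge0 ?rnorm_ge0//.
apply: le_trans h; rewrite exprMn sqr_sqrtr// /sqsum big_nat_recr//= lerDr.
exact: sqsum_ge0.
Qed.

(** Sum the inequality 2 p q <= t p^2 + q^2 / t for the optimal t. *)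
Lemma cauchy_schwarz_sum x y N :
  \sum_(0 <= n < N) normc (x n) * normc (y n) * (nu n)%:num <= rnorm x * rnorm y.
Proof.
have [x0|x0] := eqVneq (rnorm x) 0.
  rewrite x0 mul0r (rnorm_eq0 x0) big1// => n _.
  by rewrite normc0 !mul0r.
have [y0|y0] := eqVneq (rnorm y) 0.
  rewrite y0 mulr0 (rnorm_eq0 y0) big1// => n _.
  by rewrite normc0 mulr0 mul0r.
have xp : 0 < rnorm x by rewrite lt_neqAle eq_sym x0 rnorm_ge0.
have yp : 0 < rnorm y by rewrite lt_neqAle eq_sym y0 rnorm_ge0.
pose t := rnorm y / rnorm x; have t0 : 0 < t by rewrite divr_gt0.
apply: le_trans (_ : (t * sqsum x N + t^-1 * sqsum y N) / 2 <= _).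
  rewrite /sqsum !mulr_sumr -big_split /= mulr_suml; apply: ler_sum => n _.
  have n0 : 0 <= (nu n)%:num by [].
  set a := normc (x n); set b := normc (y n).
  have key : 2 * (a * b) <= t * a ^+ 2 + t^-1 * b ^+ 2.
    have : 0 <= t^-1 * (t * a - b) ^+ 2 by rewrite mulr_ge0 ?sqr_ge0// invr_ge0 ltW.
    have -> : t^-1 * (t * a - b) ^+ 2 = t * a ^+ 2 - 2 * (a * b) + t^-1 * b ^+ 2.
      by field; rewrite gt_eqF.
    by clear; lra.
  by have := ler_wpM2r n0 key; clear; lra.
rewrite ler_pdivrMr//.
apply: le_trans (_ : t * rnorm x ^+ 2 + t^-1 * rnorm y ^+ 2 <= _).
  by apply: lerD; rewrite ler_wpM2l ?invr_ge0 ?(ltW t0)// sqsum_le.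
rewrite le_eqVlt; apply/orP; left; apply/eqP; rewrite /t; field.
by rewrite x0 y0.
Qed.

Definition dot_psum x y N : C := \sum_(0 <= n < N) x n * (y n)^*%C * ((nu n)%:num)%:C%C.

Lemma normc_nu n : normc ((nu n)%:num%:C%C : C) = (nu n)%:num.
Proof. by rewrite normc_real ger0_norm. Qed.

Lemma tends_limn (u : nat -> C) (l : C) : tends (fun N => \sum_(0 <= n < N) u n) l ->
  limn (series u) = l.
Proof. by move=> /tendsP h; exact: (cvg_lim (@norm_hausdorff _ _) h). Qed.

Lemma tends_dot x y : tends (dot_psum x y) (dot x y).
Proof.
have [l hl] : exists l, tends (dot_psum x y) l.
  apply: (@complex_complete R _ (rnorm x * rnorm y)) => N.
  apply: le_trans (cauchy_schwarz_sum x y N); apply: ler_sum => n _.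
  by rewrite rnormC !normcM normc_conj normc_nu.
by rewrite /dot (tends_limn hl).
Qed.

Lemma dot_le x y : normc (dot x y) <= rnorm x * rnorm y.
Proof.
rewrite -rnormC; apply: tends_rnorm_le (tends_dot x y) _ => N.
apply: le_trans (rnorm_sum _ _ _) _; apply: le_trans (cauchy_schwarz_sum x y N).
by apply: ler_sum => n _; rewrite rnormC !normcM normc_conj normc_nu.
Qed.

Lemma dot_linear (k : C) x y z : dot (k *: x + y) z = k * dot x z + dot y z.
Proof.
apply: tends_unique (tends_dot _ _) _.
have := tendsD (tendsZ k (tends_dot x z)) (tends_dot y z).
apply: (tends_eventually (m := 0%N)) => N _.
rewrite /dot_psum scaler_sumr -big_split /=; apply: eq_bigr => n _.
transitivity ((k * x n + y n) * (z n)^*%C * ((nu n)%:num)%:C%C) => //.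
by rewrite /GRing.scale /=; ring.
Qed.

Lemma dot0l z : dot 0 z = 0.
Proof. by have := dot_linear (-1) 0 0 z; rewrite scaler0 addr0 mulN1r addNr. Qed.

Lemma dotDl x y z : dot (x + y) z = dot x z + dot y z.
Proof. by have := dot_linear 1 x y z; rewrite scale1r mul1r. Qed.

Lemma dotZl k x z : dot (k *: x) z = k * dot x z.
Proof. by have := dot_linear k x 0 z; rewrite !addr0 dot0l addr0. Qed.

Lemma dotBl x y z : dot (x - y) z = dot x z - dot y z.
Proof. by rewrite dotDl -scaleN1r dotZl mulN1r. Qed.

Lemma dot_suml (I : Type) (r : seq I) (P : pred I) (F : I -> H) z :
  dot (\sum_(i <- r | P i) F i) z = \sum_(i <- r | P i) dot (F i) z.
Proof. by elim/big_rec2: _ => [|i u v _ <-]; rewrite ?dot0l ?dotDl. Qed.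

Lemma dotC x y : dot y x = (dot x y)^*%C.
Proof.
apply: tends_unique (tends_dot _ _) _.
move=> e e0; have [N hN] := tends_dot x y e0; exists N => n Nn.
have -> : dot_psum y x n = (dot_psum x y n)^*%C.
  rewrite /dot_psum rmorph_sum /=; apply: eq_bigr => k _.
  case: (x k) => p q; case: (y k) => u v.
  by apply/eqP; rewrite eq_complex /=; apply/andP; split; apply/eqP; ring.
by rewrite -rmorphB /= rnormC normc_conj -rnormC hN.
Qed.

Lemma tends_dotl (u : nat -> H) l z : tends u l -> tends (fun n => dot (u n) z) (dot l z).
Proof.
move=> /tends_dist h; apply: (@tends_squeeze _ _ _ _ (fun n => rnorm (u n - l) * rnorm z)).
  by rewrite -(mul0r (rnorm z)); apply: cvgM => //; exact: cvg_cst.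
by move=> n; rewrite -dotBl rnormC dot_le.
Qed.

Lemma dot_self x : dot x x = (rnorm x ^+ 2)%:C%C.
Proof.
have sx := L2_square_summable x.
have hR : (fun N => sqsum x N) @ \oo --> rnorm x ^+ 2.
  rewrite rnormL2 /l2norm sqr_sqrtr ?fine_ge0 ?sqnormE_ge0//.
  have cv : (fun N => (sqsum x N)%:E) @ \oo --> (fine (sqnormE nu x))%:E.
    rewrite fineK ?sqnormE_fin//.
    have -> : (fun N => (sqsum x N)%:E) =
        (fun N => \sum_(0 <= n < N) (normc (x n) ^+ 2 * (nu n)%:num)%:E)%E.
      by apply/funext => N; rewrite sumEFin.
    by apply: is_cvg_nneseries => n _ _; rewrite lee_fin mulr_ge0// sqr_ge0.
  exact: fine_cvg cv.
apply: tends_unique (tends_dot _ _) _.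
apply: (@tends_squeeze _ _ _ _ (fun N => `|sqsum x N - rnorm x ^+ 2|)).
  exact: cvg_dist0.
move=> N; have -> : dot_psum x x N = (sqsum x N)%:C%C.
  rewrite /dot_psum /sqsum rmorph_sum /=; apply: eq_bigr => n _.
  by rewrite -sqr_normc rmorphM rmorphXn.
by rewrite -rmorphB /= rnormC normc_real.
Qed.

Lemma cvg_sqr (u : nat -> R) (l : R) :
  u @ \oo --> l -> (fun n => u n ^+ 2) @ \oo --> l ^+ 2.
Proof. by move=> h; have : (fun n => u n * u n) @ \oo --> l * l by exact: cvgM. Qed.

Lemma cvg_sum_nat (f : nat -> nat -> R) (l : nat -> R) M :
  (forall n, (fun K => f K n) @ \oo --> l n) ->
  (fun K => \sum_(0 <= n < M) f K n) @ \oo --> \sum_(0 <= n < M) l n.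
Proof.
move=> h; elim: M => [|M IH].
  by rewrite big_geq//; under eq_fun do rewrite big_geq//; exact: cvg_cst.
rewrite big_nat_recr//=; under eq_fun do rewrite big_nat_recr//=.
exact: cvgD.
Qed.

(** The sum is formed coordinatewise. The bounds on the tails hold for finitely many
    coordinates at a time and pass to the limit. *)
Lemma L2_complete : summable_complete H.
Proof.
move=> Y B hB.
have hc n : exists l, tends (fun N => \sum_(0 <= k < N) Y k n) l.
  have s0 : 0 < Num.sqrt (nu n)%:num by rewrite sqrtr_gt0.
  apply: (@complex_complete R _ (B / Num.sqrt (nu n)%:num)) => N.
  rewrite ler_pdivlMr// mulr_suml; apply: le_trans (hB N).
  by apply: ler_sum => k _; rewrite rnormC coord_le.
have [y hy] := choice hc.
have sumE m N n : (\sum_(m <= k < N) Y k) n = \sum_(m <= k < N) Y k n.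
  by elim/big_rec2: _ => // k u v _ <-.
have Y0 k : 0 <= rnorm (Y k) by exact: rnorm_ge0.
have tail (J : nat) (E : R) : 0 <= E ->
    (forall K, (J <= K)%N -> \sum_(J <= k < K) rnorm (Y k) <= E) ->
    forall M, sqsum (fun n => y n - \sum_(0 <= k < J) Y k n) M <= E ^+ 2.
  move=> E0 hE M.
  have hlim : (fun K => sqsum (fun n => \sum_(0 <= k < K + J) Y k n - \sum_(0 <= k < J) Y k n) M) @ \oo
     --> sqsum (fun n => y n - \sum_(0 <= k < J) Y k n) M.
    rewrite /sqsum; apply: cvg_sum_nat => n; apply: cvgM; last exact: cvg_cst.
    rewrite -rnormC; under eq_fun do rewrite -rnormC.
    apply: cvg_sqr; apply: tends_rnorm; apply: tendsB (tends_cst _).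
    exact: (tends_shift J (hy n)).
  rewrite -(cvg_lim (@Rhausdorff R) hlim); apply: limr_le; first exact: cvgP hlim.
  apply: nearW => K.
  have hKJ := hE (K + J)%N (leq_addl _ _).
  apply: le_trans (_ : rnorm (\sum_(J <= k < K + J) Y k) ^+ 2 <= _); last first.
    apply: lerXn2r; rewrite ?nnegrE ?rnorm_ge0//.
    by apply: le_trans (rnorm_sum _ _ _) _.
  apply: le_trans (sqsum_le _ M); rewrite le_eqVlt; apply/orP; left; apply/eqP.
  apply: eq_bigr => n _; congr (normc _ ^+ 2 * _).
  by rewrite sumE (big_cat_nat (leq0n J) (leq_addl K J))/= [LHS]addrAC subrr add0r.
have B0 : 0 <= B by have := hB 0%N; rewrite big_geq.
have [yy [hyy _]] : exists yy : H, (forall n, yy n = y n) /\ rnorm yy <= B.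
  apply: L2_make => // M.
  have := @tail 0%N B B0 _ M; under [sqsum _ M]eq_bigr => n _ do rewrite big_geq// subr0.
  by apply=> K _; exact: hB.
exists yy => e e0.
have e2 : 0 < e / 2 by rewrite divr_gt0.
have [N hN] := real_summable_tail Y0 hB e2.
exists N => J NJ.
apply: le_lt_trans (_ : e / 2 < e); last by move: e0; clear; lra.
rewrite rnorm_distC rnormL2.
have [] // := @square_summableP (yy - \sum_(0 <= k < J) Y k) (e / 2) (ltW e2).
move=> M; have := @tail J (e / 2) (ltW e2) (fun K _ => ltW (hN J K NJ)) M.
congr (_ <= _); apply: eq_bigr => n _; congr (normc _ ^+ 2 * _).
by rewrite -hyy -sumE.
Qed.

Lemma closure_rnorm (N : set H) x :
  (forall e : R, 0 < e -> exists2 y, N y & rnorm (x - y) < e) -> closure N x.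
Proof.
move=> h; move=> B /nbhs_ballP[[e e']] /=; rewrite ltcE /= => /andP[/eqP-> e0] hB.
have [y Ny hy] := h e e0; exists y; split => //; apply: hB.
by rewrite -ball_normE /ball_ /= normr_rnorm ltcR.
Qed.

Lemma closed_tends (N : set H) (u : nat -> H) l : closed N -> (forall n, N (u n)) ->
  tends u l -> N l.
Proof.
move=> cN hu h; rewrite ((closure_id N).1 cN); apply: closure_rnorm => e e0.
have [n hn] := h e e0; exists (u n) => //.
by rewrite rnorm_distC hn.
Qed.

Lemma sqr_rnormD x y : rnorm (x + y) ^+ 2 = rnorm x ^+ 2 + 2 * complex.Re (dot x y) + rnorm y ^+ 2.
Proof.
have := dot_self (x + y); rewrite dotDl ![dot _ (x + y)]dotC !dotDl !rmorphD /=.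
rewrite -!dotC !dot_self [dot y x]dotC => /(congr1 (@complex.Re R)) /=.
by case: (dot x y) => a b /= <-; ring.
Qed.

Lemma dotNr x y : dot x (- y) = - dot x y.
Proof. by rewrite dotC -scaleN1r dotZl mulN1r rmorphN /= -dotC. Qed.

Lemma parallelogram x y : rnorm (x + y) ^+ 2 + rnorm (x - y) ^+ 2 = 2 * rnorm x ^+ 2 + 2 * rnorm y ^+ 2.
Proof.
have h1 := sqr_rnormD x y; have h2 := sqr_rnormD x (- y).
move: h1 h2; rewrite dotNr rnormN => -> ->.
by case: (dot x y) => a b /=; ring.
Qed.

(** A minimizing sequence for the distance of x to N is Cauchy by the parallelogram law;
    f is the difference of x and its limit. *)
Lemma projection (N : set H) x : linear_subspace N -> ~ closure N x ->
  exists f, (forall y, N y -> dot y f = 0) /\ dot x f != 0.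
Proof.
move=> hN hx.
pose E := [set rnorm (x - y) | y in N]%classic.
have E0 : E !=set0 by exists (rnorm (x - 0)); exists 0 => //; exact: hN.1.
have Elb : has_lbound E by exists 0 => _ [y _ <-]; exact: rnorm_ge0.
pose d := inf E.
have d_le y : N y -> d <= rnorm (x - y).
  by move=> Ny; apply: ge_inf => //; exists y.
have d0 : 0 <= d by apply: lb_le_inf => // _ [y _ <-]; exact: rnorm_ge0.
have p4 k : 0 < 4^-1 ^+ k :> R by rewrite exprn_gt0// invr_gt0.
have [Y hY] : exists Y : nat -> H, forall k, N (Y k) /\ rnorm (x - Y k) < d + 4^-1 ^+ k.
  suff h : forall k, exists y, N y /\ rnorm (x - y) < d + 4^-1 ^+ k.
    by have [Y hY] := choice h; exists Y.
  move=> k; have [_ [y Ny <-] hy] := @inf_adherent R E _ (p4 k) (conj E0 Elb).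
  by exists y.
have NY k := (hY k).1.
have sqY k : rnorm (x - Y k) ^+ 2 <= d ^+ 2 + (2 * d + 1) * 4^-1 ^+ k.
  have h4 : 4^-1 ^+ k <= 1 :> R by rewrite exprn_ile1// ?invr_ge0// invf_le1// ler1n.
  have h := ltW (hY k).2.
  apply: le_trans (_ : (d + 4^-1 ^+ k) ^+ 2 <= _).
    by apply: lerXn2r; rewrite ?nnegrE ?rnorm_ge0 ?addr_ge0// ltW.
  have := mulr_ge0 (ltW (p4 k)) (_ : 0 <= 1 - 4^-1 ^+ k); rewrite subr_ge0 => /(_ h4).
  by clear; lra.
have real_aux (D a b c e p q : R) : D ^+ 2 <= a -> b <= D ^+ 2 + p -> c <= D ^+ 2 + q ->
    q <= p -> 2 ^+ 2 * a + e = 2 * b + 2 * c -> e <= 4 * p by clear; lra.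
have step k : rnorm (Y k.+1 - Y k) <= 2 * Num.sqrt (2 * d + 1) * 2^-1 ^+ k.
  have d1 : 0 <= 2 * d + 1 by move: d0; clear; lra.
  rewrite -(@ler_pXn2r _ 2)// ?nnegrE ?rnorm_ge0 ?mulr_ge0 ?sqrtr_ge0 ?exprn_ge0 ?invr_ge0//.
  have -> : (2 * Num.sqrt (2 * d + 1) * 2^-1 ^+ k) ^+ 2 = 4 * (2 * d + 1) * 4^-1 ^+ k.
    rewrite !exprMn sqr_sqrtr// exprAC; congr (_ * _ * _ ^+ k); first by clear; lra.
    by clear; lra.
  have := parallelogram (x - Y k) (x - Y k.+1).
  have -> : x - Y k - (x - Y k.+1) = Y k.+1 - Y k by rewrite opprB addrC addrA subrK.
  have -> : x - Y k + (x - Y k.+1) = (2 : C) *: (x - (2^-1 : C) *: (Y k + Y k.+1)).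
    rewrite scalerBr scalerA divff ?pnatr_eq0// scale1r addrACA -opprD.
    by rewrite scaler_nat mulr2n.
  have n2 : normc (2 : C) = 2.
    by rewrite -[2 : C](rmorph_nat (real_complex R)) normc_real normr_nat.
  rewrite rnormZ n2 exprMn.
  have hd : d ^+ 2 <= rnorm (x - (2^-1 : C) *: (Y k + Y k.+1)) ^+ 2.
    apply: lerXn2r; rewrite ?nnegrE ?rnorm_ge0//; apply: d_le.
    by apply: linear_subspaceZ => //; apply: linear_subspaceD.
  have h1 := sqY k; have h2 := sqY k.+1.
  have h3 : (2 * d + 1) * 4^-1 ^+ k.+1 <= (2 * d + 1) * 4^-1 ^+ k.
    by rewrite ler_wpM2l// exprS ler_piMl ?(ltW (p4 k))// invf_le1// ?ler1n ?ltr0n.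
  by rewrite -mulrA => h4; exact: (real_aux _ _ _ _ _ _ _ hd h1 h2 h3 h4).
have [y hy] : exists y, tends Y y.
  have hs n : \sum_(0 <= k < n) rnorm (Y k.+1 - Y k) <= 2 * Num.sqrt (2 * d + 1) * 2.
    apply: le_trans (_ : \sum_(0 <= k < n) 2 * Num.sqrt (2 * d + 1) * 2^-1 ^+ k <= _).
      exact: ler_sum.
    rewrite -mulr_sumr ler_wpM2l ?mulr_ge0 ?sqrtr_ge0//.
    have := @geo_sum_le R 2^-1 0 n; rewrite expr0.
    have -> : 1 - 2^-1 = 2^-1 :> R by clear; lra.
    by rewrite invrK mul1r; apply; clear; lra.
  have [l hl] := L2_complete hs.
  exists (l + Y 0%N); have := tendsD hl (tends_cst (Y 0%N)).
  apply: (tends_eventually (m := 0%N)) => n _.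
  by rewrite telescope_sumr// subrK.
pose f := x - y.
have fd : rnorm f <= d.
  have h1 := tends_rnorm (tendsB (tends_cst x) hy).
  have h2 : (fun k => d + 4^-1 ^+ k) @ \oo --> d.
    rewrite -[X in _ --> X]addr0; apply: cvgD; first exact: cvg_cst.
    by apply: cvg_expr; rewrite ger0_norm ?invr_ge0// invf_lt1// ltr1n.
  rewrite -(cvg_lim (@Rhausdorff R) h1) -[leRHS](cvg_lim (@Rhausdorff R) h2).
  apply: ler_lim; [exact: cvgP h1|exact: cvgP h2|].
  by apply: nearW => k; exact: ltW (hY k).2.
have dle z : N z -> d <= rnorm (z + f).
  move=> Nz; have h1 := tends_rnorm (tendsD (tends_cst z) (tendsB (tends_cst x) hy)).
  rewrite -[leRHS](cvg_lim (@Rhausdorff R) h1).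
  apply: limr_ge; first exact: cvgP h1.
  apply: nearW => k; have -> : z + (x - Y k) = x - (Y k - z) by rewrite opprB addrCA addrA.
  by apply: d_le; exact: linear_subspaceB.
have orth z : N z -> dot z f = 0.
  move=> Nz; apply/eqP; apply: contraT => w0; exfalso.
  set w := dot z f in w0; pose t := (rnorm z ^+ 2 + 1)^-1.
  have n2 : 0 < rnorm z ^+ 2 + 1 by rewrite ltr_wpDl// sqr_ge0.
  have t0 : 0 < t by rewrite invr_gt0.
  pose c : C := - (t%:C%C * w^*%C).
  have h := dle _ (linear_subspaceZ c hN Nz).
  have h2 : rnorm f ^+ 2 <= rnorm (c *: z + f) ^+ 2.
    by apply: lerXn2r; rewrite ?nnegrE ?rnorm_ge0// (le_trans fd).
  have nw := normc_gt0 w0.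
  have e1 : complex.Re (c * w) = - (t * normc w ^+ 2).
    rewrite /c; case: (w) => p q /=; rewrite sqr_sqrtr ?addr_ge0 ?sqr_ge0//; ring.
  have e2 : normc c = t * normc w.
    by rewrite /c normcN normcM normc_conj normc_real gtr0_norm.
  move: h2; rewrite (sqr_rnormD (c *: z) f) dotZl -/w e1 rnormZ e2.
  have tn : t * rnorm z ^+ 2 <= 1.
    by rewrite /t mulrC ler_pdivrMr// mul1r lerDl.
  have p : 0 < t * normc w ^+ 2 by rewrite mulr_gt0// exprn_gt0.
  have := ler_wpM2l (ltW p) tn; move: p; clear; lra.
exists f; split=> //.
have yf : dot y f = 0.
  apply: tends_unique (tends_dotl f hy) _.
  apply: (tends_eventually (m := 0%N)) (tends_cst (0 : C)) => n _.
  by rewrite orth.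
have -> : dot x f = dot f f by rewrite [in RHS]/f dotBl -/f yf subr0.
rewrite dot_self; apply/eqP => -[] /eqP; rewrite sqrf_eq0 => /eqP/rnorm_eq0 f0.
apply: hx; apply: closure_rnorm => e e0.
have [n hn] := hy e e0; exists (Y n) => //.
have -> : x = y by apply/eqP; rewrite -subr_eq0 -/f f0.
by rewrite rnorm_distC; exact: hn.
Qed.

End Hilbert.

(** * Resolvents with cancelled poles *)

Section Removal.
Context {R : realType}.
Local Notation C := R[i].
Context {V : normedModType C} (V_complete : summable_complete V).
Context (U : V -> V) (K : R) (M : set V).
Context (U_lin : forall k x y, U (k *: x + y) = k *: U x + U y).
Context (U_bd : forall x, rnorm (U x) <= K * rnorm x).
Context (M_closed : forall (v : nat -> V) y, (forall n, M (v n)) -> tends v y -> M y).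
Context (M_sub : linear_subspace M) (M_inv : forall x, M x -> M (U x)).
Context (x : V) (Mx : M x).
Local Notation W := [set x | M x /\ gen_eigenvector U x]%classic.
Context (phi : V -> C) (phi_lin : forall k x y, phi (k *: x + y) = k * phi x + phi y).
Context (phi_tends : forall v y, tends v y -> tends (fun n => phi (v n)) (phi y)).
Context (phi_W : forall y, lin_span W y -> phi y = 0).

(** The Taylor coefficients at 0 of l |-> phi ((I - l U)^-1 x). *)
Definition orbit_coef k : C := phi (iter k U x).

(** The function phi ((I - l U)^-1 x) is represented as F / u by means of a power
    series Y such that (I - l U) Y(l) = u(l) x + n. The vector n, on whose orbit phi
    vanishes, leaves room for the values of Y that are subtracted when zeros of u are
    removed. *)
Definition resolvent_state (r : R) (u F : nat -> C) : Prop :=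
  u 0%N = 1 /\ exists (Y : nat -> V) (n : V) (B : R),
  [/\ lin_span W n, Y 0%N = x + n,
     forall k, Y k.+1 = U (Y k) + u k.+1 *: x,
     coef_le Y r B & forall k, F k = phi (Y k)].

Let phi_D y z : phi (y + z) = phi y + phi z.
Proof. by have := phi_lin 1 y z; rewrite scale1r mul1r. Qed.

Let phi_Z k y : phi (k *: y) = k * phi y.
Proof.
have phi_0 : phi 0 = 0 by have := phi_lin (-1) 0 0; rewrite scaler0 addr0 mulN1r addNr.
by have := phi_lin k y 0; rewrite phi_0 !addr0.
Qed.

Let phi_sum (n : nat) (F : nat -> V) :
  phi (\sum_(0 <= i < n) F i) = \sum_(0 <= i < n) phi (F i).
Proof.
elim: n => [|n IH]; last by rewrite !big_nat_recr//= phi_D IH.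
by rewrite !big_geq//; have := phi_Z 0 0; rewrite scale0r mul0r.
Qed.

Lemma tends_map (v : nat -> V) y : tends v y -> tends (fun k => U (v k)) (U y).
Proof.
move=> /tends_dist h; apply: (@tends_squeeze _ _ _ _ (fun n => K * rnorm (v n - y))).
  by rewrite -(mulr0 K); apply: cvgM => //; exact: cvg_cst.
by move=> n; rewrite -(linear_mapB U_lin); exact: U_bd.
Qed.

(** Unfolding the recurrence, Y is the Cauchy product of u with the orbit of x plus the
    orbit of n, and the latter stays in the kernel of phi. *)
Lemma resolvent_state_conv r u F : resolvent_state r u F ->
  forall k, cprod u orbit_coef k = F k.
Proof.
move=> [u0 [Y [n [B [hn hY0 hY _ hF]]]]] k; rewrite hF.
have hU j : lin_span W (iter j U n).
  by elim: j => //= j; exact: lin_span_stable.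
have -> : Y k = (\sum_(0 <= i < k.+1) u i *: iter (k - i) U x) + iter k U n.
  elim: k => [|k IH]; first by rewrite big_nat1 u0 scale1r /= hY0.
  rewrite hY IH linear_mapD// addrAC /= [in RHS]big_nat_recr //= subnn; congr (_ + _ + _).
  have -> : U (\sum_(0 <= i < k.+1) u i *: iter (k - i) U x) =
      \sum_(0 <= i < k.+1) U (u i *: iter (k - i) U x).
    by elim/big_rec2: _ => [|i p q _ <-]; [exact: linear_map0|exact: linear_mapD].
  by apply: eq_big_nat => i /andP[_ hi]; rewrite linear_mapZ// subSn.
rewrite phi_D (phi_W (hU k)) addr0 phi_sum big_mkord; apply: eq_bigr => i _.
by rewrite phi_Z.
Qed.

Lemma resolvent_state_mem (u : nat -> C) (Y : nat -> V) n : lin_span W n -> Y 0%N = x + n ->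
  (forall k, Y k.+1 = U (Y k) + u k.+1 *: x) -> forall k, M (Y k).
Proof.
move=> hn h0 hS; elim=> [|k IH].
  rewrite h0; apply: linear_subspaceD => //.
  by apply: (@lin_span_ind _ _ _ _ M_sub _ n hn) => v [].
by rewrite hS; apply: linear_subspaceD => //; [exact: M_inv|exact: linear_subspaceZ].
Qed.

(** At a zero l of u the vector y = Y(l) satisfies (I - l U) y = n, so that it belongs to
    the span of the generalized eigenvectors and F(l) = phi y = 0. Then
    (Y(z) - y) / (1 - z / l) and n - y form a representation with denominator
    u(z) / (1 - z / l); its coefficients are bounded by zero_quotient_bound. *)
Lemma resolvent_state_div r u F l : 0 < r -> resolvent_state r u F -> l != 0 ->
  normc l <= 4^-1 * r -> tends (psum u l) 0 ->
  tends (psum F l) 0 /\ resolvent_state r (zero_quotient l u) (zero_quotient l F).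
Proof.
move=> r0 [u0 [Y [n [B [hn hY0 hY hB hF]]]]] l0 hl hul.
have h40 : 0 <= (4^-1 : R) by rewrite invr_ge0.
have h41 : (4^-1 : R) < 1 by rewrite invf_lt1// ltr1n.
have [y hy] := psum_cvg V_complete r0 hB hl h40 h41.
have MY := resolvent_state_mem hn hY0 hY.
have My : M y.
  apply: M_closed _ hy => k; rewrite /psum.
  elim/big_ind: _ => [||i _]; first exact: M_sub.1.
    by move=> *; exact: linear_subspaceD.
  exact: linear_subspaceZ.
have hyn : y - l *: U y = n.
  have h1 : tends (fun k => psum Y l k.+1 - l *: U (psum Y l k)) (y - l *: U y).
    apply: tendsB; last exact/tendsZ/tends_map.
    have := tends_shift 1 hy; congr tends; apply/funext => k.
    by rewrite addn1.
  have h2 : tends (fun k => psum u l k.+1 *: x + n) (0 *: x + n).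
    apply: tendsD (tends_cst n).
    have hu1 : tends (fun k => psum u l k.+1) 0.
      have := tends_shift 1 hul; congr tends; apply/funext => k.
      by rewrite addn1.
    apply: (@tends_squeeze _ _ _ _ (fun k => rnorm (psum u l k.+1) * rnorm x)).
      rewrite -(mul0r (rnorm x)); apply: cvgM (cvg_cst _).
      have -> : (0 : R) = rnorm (0 : C) by rewrite rnorm0.
      exact: tends_rnorm.
    by move=> k; rewrite scale0r subr0 rnormZ rnormC.
  rewrite scale0r add0r in h2; apply: tends_unique h1 _.
  apply: (tends_eventually (m := 0%N)) h2 => k _.
  elim: k => [|k IH].
    rewrite /psum !big_nat1 !big_geq//.
    rewrite (linear_map0 U_lin) scaler0 subr0 !expr0 hY0 u0 scale1r.
    by rewrite !scale1r.
  have e1 : psum Y l k.+2 = psum Y l k.+1 + l ^+ k.+1 *: (U (Y k) + u k.+1 *: x).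
    by rewrite [LHS]/psum big_nat_recr//= hY.
  have e2 : psum u l k.+2 = psum u l k.+1 + l ^+ k.+1 * u k.+1.
    by rewrite [LHS]/psum big_nat_recr.
  have e3 : U (psum Y l k.+1) = U (psum Y l k) + l ^+ k *: U (Y k).
    by rewrite {1}/psum big_nat_recr//= linear_mapD// linear_mapZ.
  rewrite e1 e2 e3 scalerDl [_ + _ + n]addrAC IH.
  rewrite !scalerDr [l *: (l ^+ k *: _)]scalerA -exprS scalerA.
  move: (psum Y l k.+1) (l *: U _) (l ^+ k.+1 *: _) (_ *: x) => p q v w.
  by rewrite opprD addrACA [v + w]addrC addrK addrAC.
have Wy : lin_span W y.
  by apply: (@lin_span_resolvent _ _ _ _ U_lin M_sub M_inv l) => //; rewrite hyn.
split.
  have := phi_tends hy; rewrite phi_W//; congr tends; apply/funext => k.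
  by rewrite /psum phi_sum; apply: eq_bigr => i _; rewrite phi_Z hF.
(* The coefficients of (Y(z) - y) / (1 - z / l). *)
pose Z k := zero_quotient l Y k - l ^- k *: y.
have ZS k : Z k.+1 = Y k.+1 + l^-1 *: Z k.
  by rewrite /Z /= scalerBr scalerA -invfM -exprS addrA.
have Z0 : Z 0%N = x + (n - y) by rewrite /Z /= expr0 invr1 scale1r hY0 addrA.
have ZB : coef_le Z r (B / 3) by move=> k; exact: (zero_quotient_bound k l0 r0 hl hB hy).
move: Z ZS Z0 ZB => Z ZS Z0 ZB.
have UZS k : U (Z k.+1) = U (Y k.+1) + l^-1 *: U (Z k) by rewrite ZS (linear_mapD U_lin) (linear_mapZ U_lin).
(* The recurrence for Z amounts to this identity. *)
have key k : l^-1 *: Z k + U (Y k) = U (Z k) + (l^-1 * zero_quotient l u k) *: x.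
  elim: k => [|k IH].
    have -> : U (Z 0%N) = U (Y 0%N) - U y.
      by rewrite Z0 addrA -hY0 (linear_mapB U_lin).
    have -> : U y = l^-1 *: (y - n) by rewrite -hyn opprB addrCA subrr addr0 scalerA mulVf// scale1r.
    rewrite Z0 /= u0 mulr1 !scalerDr !scalerN; move: (U _) (_ *: _) (_ *: _) (_ *: _) => p q v w.
    by rewrite opprB; move: (v - q) => z; rewrite [LHS]addrC addrA addrAC.
  rewrite UZS ZS /= mulrDr scalerDl -[(l^-1 * (l^-1 * _)) *: x]scalerA.
  have -> : (l^-1 * zero_quotient l u k) *: x = l^-1 *: Z k + U (Y k) - U (Z k) by rewrite IH addrC addKr.
  rewrite scalerDr (hY k) scalerDr [l^-1 *: (_ - U (Z k))]scalerBr [l^-1 *: (_ *: Z k + _)]scalerDr scalerA.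
  rewrite -[(l^-1 * u k.+1) *: x]scalerA.
  move: (_ *: Z k) (l^-1 *: U (Y k)) (l^-1 *: U (Z k)) (_ *: (_ *: x)) (U (_ + _)) => p q v w z.
  rewrite addrACA [v + _]addrC subrK [LHS]addrC -[RHS]addrA; congr (_ + _).
  by rewrite [q + w]addrC -addrA [q + p]addrC.
split=> //; exists Z, (n - y), (B / 3); split.
- by apply: linear_subspaceB => //; exact: lin_span_subspace.
- exact: Z0.
- move=> k; by rewrite ZS hY /= scalerDl addrAC [U (Y k) + _]addrC key addrAC addrA.
- exact: ZB.
- elim=> [|k IH] /=; first by rewrite hF Z0 addrA -hY0 -scaleN1r addrC phi_lin (phi_W Wy) mulr0 add0r.
  by rewrite IH ZS phi_D phi_Z hF.
Qed.

End Removal.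

(** * Formal resolvents of a rank one perturbation *)

Section Formal.
Context {R : realType}.
Local Notation C := R[i].
Context {V : normedModType C}.
Implicit Types (Y v : nat -> V) (u : nat -> C).

(** Multiplication of a power series by its variable. *)
Definition delay {W : zmodType} (Y : nat -> W) k : W := if k is k'.+1 then Y k' else 0.

(** The identity (I - z T) Y(z) = v(z) of formal power series. *)
Definition formal_solution (T : V -> V) Y v := forall k, Y k = T (delay Y k) + v k.

Lemma cprod_delay u Y k : cprod u (delay Y) k = delay (cprod u Y) k.
Proof.
case: k => [|k]; first by rewrite /cprod big_ord1 scaler0.
rewrite /cprod big_ord_recr /= subnn scaler0 addr0; apply: eq_bigr => i _.
by rewrite subSn// -ltnS.
Qed.

Lemma cprodr_delta u (x : V) k : cprod u (fun j => (j == 0%N)%:R *: x) k = u k *: x.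
Proof.
rewrite /cprod big_ord_recr /= subnn eqxx scale1r big1 ?add0r// => i _.
by rewrite subn_eq0 leqNgt ltn_ord scale0r scaler0.
Qed.

Lemma cprodC u w k : cprod u w k = cprod w u k.
Proof.
rewrite /cprod (reindex_inj rev_ord_inj) /=; apply: eq_bigr => i _.
by rewrite subSS subKn ?leq_ord//; exact: mulrC.
Qed.

Lemma cprod_scaler u w (x : V) k : cprod u (fun j => w j *: x) k = cprod u w k *: x.
Proof. by rewrite /cprod scaler_suml; apply: eq_bigr => i _; rewrite scalerA. Qed.

Lemma cprodDr u Y v k : cprod u (fun j => Y j + v j) k = cprod u Y k + cprod u v k.
Proof. by rewrite /cprod -big_split; apply: eq_bigr => i _; rewrite scalerDr. Qed.

Lemma cprodNr u Y k : cprod u (fun j => - Y j) k = - cprod u Y k.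
Proof. by rewrite /cprod -sumrN; apply: eq_bigr => i _; rewrite scalerN. Qed.

Lemma psum_delay (Y : nat -> V) l n : psum (delay Y) l n.+1 = l *: psum Y l n.
Proof.
rewrite /psum big_nat_recl//= scaler0 add0r scaler_sumr; apply: eq_bigr => i _.
by rewrite scalerA exprS.
Qed.

Lemma tends_succ (Y : nat -> V) y : tends Y y -> tends (fun n => Y n.+1) y.
Proof.
by move=> h; have := tends_shift 1 h; congr tends; apply/funext => n; rewrite addn1.
Qed.

Lemma tends_scaler u c (x : V) : tends u c -> tends (fun n => u n *: x) (c *: x).
Proof.
move=> /tends_dist h; apply: (@tends_squeeze _ _ _ _ (fun n => rnorm (u n - c) * rnorm x)).
  by rewrite -(mul0r (rnorm x)); exact: cvgM h (cvg_cst _).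
by move=> n; rewrite -scalerBl rnormZ rnormC.
Qed.

Lemma psum_scaler u l (x : V) n : psum (fun k => u k *: x) l n = psum u l n *: x.
Proof. by rewrite /psum scaler_suml; apply: eq_bigr => i _; rewrite scalerA. Qed.

Section Linear.
Context (T : V -> V) (T_lin : forall k x y, T (k *: x + y) = k *: T x + T y).

Lemma cprod_map u Y k : cprod u (fun j => T (Y j)) k = T (cprod u Y k).
Proof.
rewrite /cprod; elim/big_rec2: _ => [|i p q _ ->]; first by rewrite (linear_map0 T_lin).
by rewrite T_lin.
Qed.

Lemma psum_map Y l n : psum (fun j => T (Y j)) l n = T (psum Y l n).
Proof.
rewrite /psum; elim/big_rec2: _ => [|i p q _ ->]; first by rewrite (linear_map0 T_lin).
by rewrite T_lin.
Qed.

Lemma formal_solution_cprod u Y v : formal_solution T Y v ->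
  formal_solution T (cprod u Y) (cprod u v).
Proof.
move=> h k; rewrite -cprod_delay -cprod_map -cprodDr.
by apply: eq_bigr => i _; rewrite -h.
Qed.

Lemma formal_solution_orbit (x : V) :
  formal_solution T (fun j => iter j T x) (fun j => (j == 0%N)%:R *: x).
Proof.
case=> [|k] /=; first by rewrite (linear_map0 T_lin) add0r scale1r.
by rewrite scale0r addr0.
Qed.

Lemma formal_solution_psum Y v l n : formal_solution T Y v ->
  psum Y l n.+1 - l *: T (psum Y l n) = psum v l n.+1.
Proof.
move=> h; rewrite -psum_map -psum_delay.
have -> : psum (delay (fun j => T (Y j))) l n.+1 = psum (fun j => T (delay Y j)) l n.+1.
  by apply: eq_bigr => -[|i] _ //=; rewrite (linear_map0 T_lin).
rewrite /psum -sumrB; apply: eq_bigr => i _.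
by rewrite -scalerBr {1}h addrC addKr.
Qed.

Lemma formal_solution_lim (K : R) Y v l y w : (forall x, rnorm (T x) <= K * rnorm x) ->
  formal_solution T Y v -> tends (psum Y l) y -> tends (psum v l) w -> y - l *: T y = w.
Proof.
move=> T_bd h hy hw; apply: tends_unique (tends_succ hw).
have := tendsB (tends_succ hy) (tendsZ l (tends_map T_lin T_bd hy)).
by apply: (tends_eventually (m := 0%N)) => n _; exact: formal_solution_psum.
Qed.

End Linear.

Section Perturbation.
Context (T : V -> V) (T_lin : forall k x y, T (k *: x + y) = k *: T x + T y).
Context (phi : V -> C) (phi_lin : forall k x y, phi (k *: x + y) = k * phi x + phi y).
Context (a x : V) (p : nat -> C).

Let L y := T y + phi y *: a.

(** The power series p(z) (I - z T)^-1 y. *)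
Definition scaled_resolvent (y : V) := cprod p (fun j => iter j T y).

(** The power series p(z) (1 - z phi ((I - z T)^-1 a)). *)
Definition perturbation_factor k := p k - delay (fun j => phi (scaled_resolvent a j)) k.

(** Up to the factor p(z)^2 this is the perturbation determinant of I - z L with respect
    to I - z T. *)
Definition perturbation_det := cprod perturbation_factor p.

(** The Sherman-Morrison formula for (I - z L)^-1 x, with the denominators cleared: this
    is the resolvent multiplied by perturbation_det(z). *)
Definition perturbed_resolvent k :=
  cprod perturbation_factor (scaled_resolvent x) k +
  cprod (delay (fun j => phi (scaled_resolvent x j))) (scaled_resolvent a) k.

Lemma scaled_resolvent_solution y : formal_solution T (scaled_resolvent y) (fun k => p k *: y).
Proof.
move=> k; have := formal_solution_cprod T_lin p (formal_solution_orbit T_lin y) k.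
by rewrite cprodr_delta.
Qed.

Let phi0 : phi 0 = 0.
Proof. by have := phi_lin (-1) 0 0; rewrite scaler0 addr0 mulN1r addNr. Qed.

Lemma perturbation_linear k y z : L (k *: y + z) = k *: L y + L z.
Proof. by rewrite /L T_lin phi_lin scalerDl scalerDr scalerA addrACA. Qed.

Lemma perturbed_formal_solution y v : formal_solution T y v ->
  formal_solution L y (fun k => v k - delay (fun j => phi (y j)) k *: a).
Proof.
move=> h k; rewrite {1}h /L.
have -> : phi (delay y k) = delay (fun j => phi (y j)) k by case: k => //=; exact: phi0.
by rewrite [RHS]addrACA subrr addr0.
Qed.

Lemma perturbed_resolvent_solution :
  formal_solution L perturbed_resolvent (fun k => perturbation_det k *: x).
Proof.
have h1 := formal_solution_cprod perturbation_linear perturbation_factor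
  (perturbed_formal_solution (scaled_resolvent_solution x)).
have h2 := formal_solution_cprod perturbation_linear (delay (fun j => phi (scaled_resolvent x j)))
  (perturbed_formal_solution (scaled_resolvent_solution a)).
move=> k; rewrite {1}/perturbed_resolvent h1 h2.
have -> : delay perturbed_resolvent k = 1 *: delay (cprod perturbation_factor (scaled_resolvent x)) k +
   delay (cprod (delay (fun j => phi (scaled_resolvent x j))) (scaled_resolvent a)) k.
  by case: k => [|k] /=; rewrite scale1r ?addr0.
rewrite perturbation_linear scale1r addrACA; congr (_ + _).
rewrite cprodDr cprodNr !cprod_scaler.
have -> : cprod (delay (fun j => phi (scaled_resolvent x j)))
   (fun k0 => p k0 *: a - delay (fun j => phi (scaled_resolvent a j)) k0 *: a) k =
   cprod perturbation_factor (delay (fun j => phi (scaled_resolvent x j))) k *: a.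
  rewrite [in RHS]cprodC -cprod_scaler; apply: eq_bigr => i _.
  by rewrite scalerBl.
by rewrite subrK.
Qed.

End Perturbation.

End Formal.

(** * The resolvent of a multiplication operator *)

Section FactorPoly.
Context {R : realType}.
Local Notation C := R[i].
Implicit Types (ts : seq C) (r B : R).

Definition factor_poly ts : {poly C} := \prod_(t <- ts) (1 - t *: 'X).

Definition factor_coef ts k : C := (factor_poly ts)`_k.

Definition factor_bound r ts : R := \prod_(t <- ts) (1 + r * normc t).

Lemma factor_bound_ge1 r ts : 0 <= r -> 1 <= factor_bound r ts.
Proof.
move=> r0; rewrite /factor_bound; elim: ts => [|t ts IH]; first by rewrite big_nil.
by rewrite big_cons mulr_ege1// lerDl mulr_ge0// normc_ge0.
Qed.

Lemma factor_coef0 ts : factor_coef ts 0 = 1.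
Proof.
rewrite /factor_coef -horner_coef0 horner_prod big1// => t _.
by rewrite !(hornerE, mulr0, subr0).
Qed.

Lemma factor_cprod_le ts (g : nat -> C) r B : 0 < r -> coef_le g r B ->
  coef_le (cprod (factor_coef ts) g) r (factor_bound r ts * B).
Proof.
move=> r0 hg; have B0 := coef_le_ge0 hg.
rewrite /factor_coef /factor_bound /factor_poly; elim: ts => [|t ts IH] k.
  rewrite !big_nil mul1r /cprod big_ord_recl coef1 scale1r subn0.
  by rewrite big1 ?addr0// => i _; rewrite coef1 scale0r.
rewrite !big_cons cprod_linear_factor rnormC.
set Q := \prod_(j <- ts) (1 + r * normc j) in IH *.
set h := cprod _ g in IH *.
have h0 := IH k; rewrite rnormC in h0.
have Q0 : 0 <= Q * B.
  by apply: mulr_ge0 => //; apply: le_trans ler01 _; apply: factor_bound_ge1; exact: ltW.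
apply: le_trans (_ : normc (h k) * r ^+ k + r * normc t * (Q * B) <= _); last first.
  by move: h0; clear; lra.
case: k h0 => [|k] h0; first by rewrite subr0 lerDl mulr_ge0// mulr_ge0 ?normc_ge0// ltW.
have h1 := IH k; rewrite rnormC in h1.
apply: le_trans (ler_wpM2r _ (normcB _ _)) _; first by rewrite exprn_ge0// ltW.
rewrite mulrDl lerD2l normcM exprS.
have -> : normc t * normc (h k) * (r * r ^+ k) = r * normc t * (normc (h k) * r ^+ k) by ring.
by rewrite ler_wpM2l// mulr_ge0 ?normc_ge0// ltW.
Qed.

Lemma factor_coef_le ts r : 0 < r -> coef_le (factor_coef ts) r (factor_bound r ts).
Proof.
move=> r0 k.
have hd : coef_le (fun j => (j == 0%N)%:R *: (1 : C)) r 1.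
  case=> [|j]; first by rewrite scale1r rnormC normc1 mulr1.
  by rewrite scale0r rnorm0 mul0r.
have := factor_cprod_le ts r0 hd k.
by rewrite cprodr_delta mulr1 [_ *: 1]mulr1.
Qed.

(** If t is one of the factors, then 1 - t X cancels the geometric series of t, and
    otherwise the geometric series is bounded. *)
Lemma factor_geom_le ts t r : 0 < r -> (t \in ts) || (normc t * r <= 1) ->
  coef_le (cprod (factor_coef ts) (fun j => t ^+ j)) r (factor_bound r ts).
Proof.
move=> r0 /orP[tts|ht]; last first.
  rewrite -[factor_bound _ _]mulr1; apply: factor_cprod_le => // k.
  rewrite rnormC normcX -exprMn; apply: exprn_ile1 => //.
  by rewrite mulr_ge0 ?normc_ge0// ltW.
move=> k.
have eP : factor_poly ts = (1 - t *: 'X) * factor_poly (rem t ts).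
  by rewrite /factor_poly (perm_big _ (perm_to_rem tts)) big_cons.
have -> : cprod (factor_coef ts) (fun j => t ^+ j) k = factor_coef (rem t ts) k.
  rewrite /factor_coef eP cprod_linear_factor.
  case: k => [|k]; first by rewrite subr0 /cprod big_ord1 [_ *: _]mulr1.
  rewrite /cprod big_ord_recr /= subnn [_ *: t ^+ 0]mulr1 addrAC mulr_sumr.
  rewrite -sumrB big1 ?add0r// => i _.
  by rewrite subSn ?leq_ord// exprS /GRing.scale /= mulrCA subrr.
apply: le_trans (factor_coef_le _ r0 k) _.
rewrite /factor_bound (perm_big _ (perm_to_rem tts)) big_cons ler_peMl//.
  by apply: le_trans ler01 (factor_bound_ge1 _ _); exact: ltW.
by rewrite lerDl mulr_ge0 ?normc_ge0// ltW.
Qed.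

Lemma factor_coef_tends ts l : tends (psum (factor_coef ts) l) (factor_poly ts).[l].
Proof.
apply: (tends_eventually (m := size (factor_poly ts))) (tends_cst _) => n hn.
rewrite (horner_coef_wide _ hn) /psum big_mkord; apply: eq_bigr => i _.
exact: mulrC.
Qed.

Lemma factor_poly_neq0 ts l : (forall t, t \in ts -> 1 - l * t != 0) ->
  (factor_poly ts).[l] != 0.
Proof.
move=> h; rewrite /factor_poly horner_prod prodf_seq_neq0; apply/allP => t /h.
by rewrite !hornerE [t * l]mulrC.
Qed.

Lemma coef_le_delay (v : nat -> C) r B : 0 < r -> coef_le v r B -> coef_le (delay v) r (r * B).
Proof.
move=> r0 h [|k] /=; first by rewrite rnorm0 mul0r mulr_ge0 ?(coef_le_ge0 h)// ltW.
by rewrite exprS mulrCA ler_wpM2l// ltW.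
Qed.

End FactorPoly.

Section Multiplication.
Context {R : realType} (nu : nat -> {posnum R}).
Local Notation C := R[i].
Local Notation H := (L2 nu).
Implicit Types (x y : H).
Context (s : nat -> C) (A : H -> H) (A_mul : forall (x : H) n, A x n = s n * x n).

Lemma rnorm_le_coord (c : R) x y : 0 <= c -> (forall n, normc (y n) <= c * normc (x n)) ->
  rnorm y <= c * rnorm x.
Proof.
move=> c0 h; rewrite [rnorm y]rnormL2.
have cx0 : 0 <= c * rnorm x by rewrite mulr_ge0// rnorm_ge0.
apply: (square_summableP cx0 _).2 => N.
apply: le_trans (_ : c ^+ 2 * sqsum nu x N <= _); last first.
  by rewrite exprMn ler_wpM2l ?sqr_ge0// sqsum_le.
rewrite /sqsum mulr_sumr; apply: ler_sum => n _.
rewrite mulrA -exprMn ler_wpM2r//; apply: lerXn2r; rewrite ?nnegrE ?normc_ge0//.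
by rewrite mulr_ge0// normc_ge0.
Qed.

Lemma multiplication_linear (k : C) x y : A (k *: x + y) = k *: A x + A y.
Proof.
apply: L2_ext => n; rewrite A_mul.
transitivity (s n * (k * x n + y n)) => //.
transitivity (k * A x n + A y n) => //.
by rewrite !A_mul; ring.
Qed.

Lemma cprod_coord (u : nat -> C) (Y : nat -> H) k n :
  cprod u Y k n = cprod u (fun j => Y j n) k.
Proof. by rewrite /cprod; elim/big_rec2: _ => // i p q _ <-. Qed.

Lemma scaled_resolvent_coord (p : nat -> C) x k n :
  scaled_resolvent A p x k n = cprod p (fun j => s n ^+ j) k * x n.
Proof.
rewrite /scaled_resolvent cprod_coord /cprod mulr_suml; apply: eq_bigr => i _.
have -> : forall j, iter j A x n = s n ^+ j * x n.
  by elim=> [|j IH]; rewrite ?mul1r//= A_mul IH exprS mulrA.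
exact: mulrA.
Qed.

Lemma coef_le_dot (Y : nat -> H) (f : H) r B : 0 < r -> coef_le Y r B ->
  coef_le (fun k => dot (Y k) f) r (B * rnorm f).
Proof.
move=> r0 h k; rewrite rnormC.
apply: le_trans (_ : rnorm (Y k) * rnorm f * r ^+ k <= _).
  by rewrite ler_wpM2r ?dot_le// exprn_ge0// ltW.
by rewrite mulrAC ler_wpM2r ?rnorm_ge0.
Qed.

Lemma coef_leB (u v : nat -> C) r B1 B2 : coef_le u r B1 -> coef_le v r B2 -> 0 < r ->
  coef_le (fun k => u k - v k) r (B1 + B2).
Proof.
move=> h1 h2 r0 k; apply: le_trans (_ : (rnorm (u k) + rnorm (v k)) * r ^+ k <= _).
  by rewrite ler_wpM2r ?rnormB// exprn_ge0// ltW.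
by rewrite mulrDl lerD.
Qed.

Context (a b : H) (r : R) (ts : seq C).
Context (r0 : 0 < r) (ts_cover : forall n, (s n \in ts) || (normc (s n) * r <= 1)).

Local Notation p := (factor_coef ts).
Local Notation Q := (factor_bound r ts).
Local Notation phi := (fun y => dot y b).
Local Notation alpha := (rnorm a * rnorm b).

Let Q1 : 1 <= Q. Proof. by apply: factor_bound_ge1; exact: ltW. Qed.

Lemma scaled_resolvent_le x : coef_le (scaled_resolvent A p x) r (Q * rnorm x).
Proof.
move=> k; have rk : 0 < r ^+ k by rewrite exprn_gt0.
rewrite -ler_pdivlMr// mulrAC; apply: rnorm_le_coord.
  by rewrite divr_ge0// (ltW rk, le_trans ler01).
move=> n; rewrite scaled_resolvent_coord normcM ler_wpM2r ?normc_ge0//.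
by rewrite ler_pdivlMr// -rnormC; apply: factor_geom_le.
Qed.

Lemma perturbation_factor_le : coef_le (perturbation_factor A phi a p) r (Q * (1 + r * alpha)).
Proof.
have -> : Q * (1 + r * alpha) = Q + r * (Q * rnorm a * rnorm b) by ring.
apply: coef_leB => //; first exact: factor_coef_le.
apply: coef_le_delay => //; apply: coef_le_dot => //; exact: scaled_resolvent_le.
Qed.

Lemma perturbation_det_le :
  coef_le (perturbation_det A phi a p) (2^-1 * r) (Q ^+ 2 * (1 + r * alpha)).
Proof.
have -> : Q ^+ 2 * (1 + r * alpha) = Q * (1 + r * alpha) * Q by ring.
by apply: coef_le_cprod => //; [exact: perturbation_factor_le|exact: factor_coef_le].
Qed.

Lemma perturbed_resolvent_le x :
  coef_le (perturbed_resolvent A phi a x p) (2^-1 * r) (Q ^+ 2 * (1 + r * alpha) * (2 * rnorm x)).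
Proof.
have h1 := coef_le_cprod r0 perturbation_factor_le (scaled_resolvent_le x).
have h2 := coef_le_cprod r0 (coef_le_delay r0 (coef_le_dot b r0 (scaled_resolvent_le x)))
  (scaled_resolvent_le a).
have r2 : 0 <= 2^-1 * r by rewrite mulr_ge0 ?invr_ge0// ltW.
move=> k; apply: le_trans (ler_wpM2r _ (rnormD _ _)) _; first by rewrite exprn_ge0.
rewrite mulrDl; apply: le_trans (lerD (h1 k) (h2 k)) _.
rewrite -subr_ge0; apply: le_trans (_ : 0 <= Q ^+ 2 * rnorm x) _.
  by rewrite mulr_ge0 ?sqr_ge0// rnorm_ge0.
by rewrite le_eqVlt; apply/orP; left; apply/eqP; ring.
Qed.

End Multiplication.

(** * Counting the eigenvalues of a Schatten class operator *)

Section Counting.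
Context {R : realType} (nu : nat -> {posnum R}).
Local Notation C := R[i].
Local Notation H := (L2 nu).
Implicit Types (x y u : H) (e f : nat -> H).

Lemma dotZr (k : C) x y : dot x (k *: y) = k^*%C * dot x y.
Proof. by rewrite dotC dotZl rmorphM /= -dotC. Qed.

Lemma orthonormal_norm e k : Defs.orthonormal e -> rnorm (e k) = 1.
Proof.
move=> /(_ k k); rewrite eqxx dot_self => /(congr1 (@complex.Re R)) /= /eqP.
by rewrite (pexpr_eq1 (ltn0Sn 1) (rnorm_ge0 _)) => /eqP.
Qed.

Lemma pythagoras f (c : nat -> C) n : Defs.orthonormal f ->
  rnorm (\sum_(0 <= k < n) c k *: f k) ^+ 2 = \sum_(0 <= k < n) normc (c k) ^+ 2.
Proof.
move=> hf; elim: n => [|n IH]; first by rewrite !big_geq// rnorm0 expr0n.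
rewrite !big_nat_recr //= sqr_rnormD IH rnormZ (orthonormal_norm _ hf) mulr1.
suff -> : dot (\sum_(0 <= i < n) c i *: f i) (c n *: f n) = 0 by rewrite mulr0 addr0.
rewrite dot_suml big1_seq//.
move=> k /andP[_]; rewrite mem_index_iota => /andP[_ kn].
by rewrite dotZl dotZr hf (ltn_eqF kn) !mulr0.
Qed.

Lemma bessel e u n : Defs.orthonormal e ->
  \sum_(0 <= k < n) normc (dot u (e k)) ^+ 2 <= rnorm u ^+ 2.
Proof.
move=> he; pose w n := u - \sum_(0 <= k < n) dot u (e k) *: e k.
suff -> : rnorm u ^+ 2 = rnorm (w n) ^+ 2 + \sum_(0 <= k < n) normc (dot u (e k)) ^+ 2.
  by rewrite lerDr sqr_ge0.
elim: n => [|n IH]; first by rewrite /w !big_geq// subr0 addr0.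
rewrite IH big_nat_recr//= addrA addrAC; congr (_ + _).
have -> : w n = w n.+1 + dot u (e n) *: e n.
  by rewrite /w big_nat_recr//= opprD addrA subrK.
rewrite sqr_rnormD rnormZ (orthonormal_norm _ he) mulr1 dotZr.
have -> : dot (w n.+1) (e n) = 0.
  rewrite /w dotBl big_nat_recr//= dotDl dotZl he eqxx mulr1 dot_suml big1_seq ?add0r ?subrr//.
  move=> k /andP[_]; rewrite mem_index_iota => /andP[_ kn].
  by rewrite dotZl he (ltn_eqF kn) mulr0.
by rewrite mulr0 mulr0 addr0.
Qed.

Lemma unit_vector n : exists d : H, forall m, d m = (m == n)%:R.
Proof.
have [] := @L2_make R nu (fun m => (m == n)%:R) (Num.sqrt (nu n)%:num); rewrite ?sqrtr_ge0//; last first.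
  by move=> d [hd _]; exists d.
move=> N; rewrite sqr_sqrtr//.
suff -> : sqsum nu (fun m => (m == n)%:R) N = if (n < N)%N then (nu n)%:num else 0.
  by case: ifP.
rewrite /sqsum; elim: N => [|N IH]; first by rewrite big_geq.
rewrite big_nat_recr//= IH ltnS; case: (ltngtP N n) => h.
- by rewrite normc0 expr0n mul0r addr0.
- by rewrite normc0 expr0n mul0r addr0.
- by rewrite normc1 expr1n mul1r add0r h.
Qed.

Context (s : nat -> C) (A : H -> H) (A_mul : forall (x : H) n, A x n = s n * x n).

(** There are more unknowns than equations. *)
Lemma coordinate_kernel (J B : seq nat) e : uniq J -> (size B < size J)%N ->
  exists u : H, [/\ u != 0, forall m, m \notin J -> u m = 0 &
    forall k, k \in B -> dot u (e k) = 0].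
Proof.
move=> uJ hBJ; have [d hd] := choice unit_vector.
pose M : 'M[C]_(size J, size B) := \matrix_(i, k) dot (d (nth 0%N J i)) (e (nth 0%N B k)).
have hk : kermx M != 0.
  by rewrite -mxrank_eq0 mxrank_ker subn_eq0 -ltnNge (leq_ltn_trans (rank_leq_col M)).
have /rowV0Pn[v /sub_kermxP hv v0] := hk.
exists (\sum_i v 0 i *: d (nth 0%N J i)).
have coord m : (\sum_i v 0 i *: d (nth 0%N J i) : H) m = \sum_i v 0 i * (m == nth 0%N J i)%:R.
  by elim/big_rec2: _ => // i p q _ <-; rewrite -hd.
split.
- apply: contra v0 => /eqP u0; apply/eqP/rowP => i; rewrite mxE.
  have := coord (nth 0%N J i); rewrite u0 (bigD1 i)//= eqxx mulr1 big1 ?addr0//.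
  by move=> j ji; rewrite nth_uniq//= eq_sym -val_eqE in ji *; rewrite (negbTE ji) mulr0.
- move=> m mJ; rewrite coord big1// => i _.
  case: eqP => [e1|]; last by rewrite mulr0.
  by move: mJ; rewrite e1 mem_nth.
- move=> k kB; have kB' : (index k B < size B)%N by rewrite index_mem.
  have := congr1 (fun N : 'rV_(size B) => N 0 (Ordinal kB')) hv.
  rewrite !mxE dot_suml => h; rewrite -[RHS]h; apply: eq_bigr => i _.
  by rewrite mxE dotZl /= nth_index.
Qed.

(** Let B index the singular values that are at least eps / 2. If J had more elements than
    B, some nonzero u supported on J would be orthogonal to the vectors e_k with k in B.
    Then |A u| >= eps |u| because A is diagonal, and |A u| <= (eps / 2) |u| by the
    Schmidt expansion. *)
Lemma schatten_count (p : R) : 0 < p -> schatten p A ->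
  exists2 Sm : R, 0 <= Sm & forall (eps : R) (J : seq nat), 0 < eps -> uniq J ->
    (forall n, n \in J -> eps <= normc (s n)) -> (size J)%:R * (eps / 2) `^ p <= Sm.
Proof.
move=> p0 [mu [e [f [mu0 [he hf] hA hsum]]]].
have fin : (\sum_(0 <= k <oo) (mu k `^ p)%:E)%E \is a fin_num.
  by rewrite ge0_fin_numE// nneseries_ge0// => n _ _; rewrite lee_fin powR_ge0.
pose Sm := fine (\sum_(0 <= k <oo) (mu k `^ p)%:E)%E.
have hSm N : \sum_(0 <= k < N) mu k `^ p <= Sm.
  rewrite -lee_fin /Sm fineK// -sumEFin; apply: nneseries_lim_ge => n _ _.
  by rewrite lee_fin powR_ge0.
have Sm0 : 0 <= Sm by have := hSm 0%N; rewrite big_geq.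
exists Sm => // eps J eps0 uJ hJ.
have e2 : 0 < eps / 2 by rewrite divr_gt0.
have ep : 0 < (eps / 2) `^ p by exact: powR_gt0.
have [N hN] := real_summable_tail (fun k => powR_ge0 (mu k) p) hSm ep.
have mu_small k : (N <= k)%N -> mu k < eps / 2.
  move=> Nk; rewrite ltNge; apply/negP => hk.
  have := hN k k.+1 Nk; rewrite big_nat1 ltNge => /negP; apply.
  by apply: ge0_ler_powR; rewrite ?nnegrE ?(ltW p0) ?(ltW e2).
pose B := [seq k <- iota 0 N | eps / 2 <= mu k].
suff sB : (size J <= size B)%N.
  apply: le_trans (hSm N).
  apply: le_trans (_ : (size B)%:R * (eps / 2) `^ p <= _).
    by rewrite ler_wpM2r ?ler_nat// ltW.
  rewrite (bigID (fun k => eps / 2 <= mu k)) /= -[leLHS]addr0.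
  apply: lerD; last by apply: sumr_ge0 => k _; exact: powR_ge0.
  rewrite -big_filter {1}/index_iota subn0 -/B mulr_natl.
  have -> : (eps / 2) `^ p *+ size B = \sum_(k <- B) (eps / 2) `^ p.
    by rewrite big_const_seq count_predT iter_addr_0.
  rewrite big_seq [leRHS]big_seq; apply: ler_sum => k; rewrite mem_filter => /andP[hk _].
  by apply: ge0_ler_powR; rewrite ?nnegrE ?(ltW p0) ?(ltW e2).
rewrite leqNgt; apply/negP => hlt.
have [u [u0 uJ0 uB]] := coordinate_kernel e uJ hlt.
have low : rnorm u <= eps^-1 * rnorm (A u).
  apply: rnorm_le_coord; first by rewrite invr_ge0 ltW.
  move=> n; have [/hJ nJ|/uJ0 ->] := boolP (n \in J); last first.
    by rewrite normc0 mulr_ge0 ?normc_ge0 ?invr_ge0// ltW.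
  rewrite A_mul normcM mulrA ler_peMl ?normc_ge0//.
  by rewrite mulrC ler_pdivlMr// mul1r.
have mu_dot k : normc ((mu k)%:C%C * dot u (e k)) <= eps / 2 * normc (dot u (e k)).
  rewrite normcM normc_real ger0_norm//.
  have [hk|hk] := leP (eps / 2) (mu k); last by rewrite ler_wpM2r ?normc_ge0// ltW.
  rewrite uB ?normc0 ?mulr0// mem_filter hk mem_iota /= add0n ltnNge.
  by apply/negP => /mu_small; rewrite ltNge hk.
have up : rnorm (A u) <= eps / 2 * rnorm u.
  apply: (tends_rnorm_le ((tendsP _ _).1 (hA u))) => n.
  rewrite -(@ler_pXn2r _ 2)// ?nnegrE ?(mulr_ge0 (ltW e2)) ?rnorm_ge0//.
  rewrite /series /= (pythagoras (fun k => (mu k)%:C%C * dot u (e k)) n hf).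
  apply: le_trans (_ : (eps / 2) ^+ 2 * \sum_(0 <= k < n) normc (dot u (e k)) ^+ 2 <= _).
    rewrite mulr_sumr; apply: ler_sum => k _; rewrite -exprMn.
    by apply: lerXn2r; rewrite ?nnegrE ?normc_ge0 ?(mulr_ge0 (ltW e2)) ?normc_ge0.
  by rewrite [leRHS]exprMn ler_wpM2l ?sqr_ge0// bessel.
have un : 0 < rnorm u.
  rewrite lt_neqAle rnorm_ge0 andbT eq_sym; apply: contra u0 => /eqP/rnorm_eq0 ->.
  exact: eqxx.
have : rnorm u <= 2^-1 * rnorm u.
  apply: le_trans low _.
  have -> : 2^-1 * rnorm u = eps^-1 * (eps / 2 * rnorm u) by field; rewrite gt_eqF.
  by rewrite ler_wpM2l// invr_ge0 ltW.
by rewrite -[leLHS]mul1r ler_pM2r// leNgt invf_lt1 ?ltr1n.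
Qed.

End Counting.

(** * Finite order of the orbit series *)

Lemma nat_upper_bound {R : realType} (x : R) : exists n : nat, x <= n%:R.
Proof. exists (Num.bound `|x|); apply: le_trans (ler_norm x) _.
exact: ltW (archi_boundP (normr_ge0 x)). Qed.

Lemma le_pow2_nat {R : realType} (x : R) : exists n : nat, x <= 2 ^+ n.
Proof.
have [n hn] := nat_upper_bound x; exists n; apply: le_trans hn _.
by rewrite -natrX ler_nat ltnW// ltn_expl.
Qed.

Lemma linear_le_pow2 {R : realType} (x : R) (k n : nat) : x <= n%:R ->
  1 + k%:R * x <= 2 ^+ (k * n).
Proof.
move=> xn; apply: le_trans (@succ_le_pow2 R (k * n)).
by rewrite -natr1 addrC lerD2r natrM ler_wpM2l.
Qed.

Lemma tends_bounded {R : realType} (s : nat -> R[i]) l : tends s l ->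
  exists2 S : R, 0 <= S & forall n, normc (s n) <= S.
Proof.
move=> h; have [N hN] := h 1 ltr01.
have nn i : 0 <= normc (s i) by exact: normc_ge0.
have S0 : 0 <= \sum_(0 <= i < N) normc (s i) by apply: sumr_ge0.
exists (1 + normc l + \sum_(0 <= i < N) normc (s i)).
  by rewrite !addr_ge0// normc_ge0.
move=> n; have [nN|Nn] := ltnP n N.
  rewrite (big_cat_nat (leq0n n) (ltnW nN))/= [X in _ + (_ + X)]big_ltn//=.
  have h1 : 0 <= \sum_(0 <= i < n) normc (s i) by apply: sumr_ge0.
  have h2 : 0 <= \sum_(n.+1 <= i < N) normc (s i) by apply: sumr_ge0.
  by move: h1 h2 (normc_ge0 l); clear; lra.
have h1 := ltW (hN n Nn); rewrite rnormC in h1.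
have := le_normcD (s n - l) l; rewrite subrK => h2.
by move: h1 h2 S0; clear; lra.
Qed.

Section Growth.
Context {R : realType} (nu : nat -> {posnum R}).
Local Notation C := R[i].
Local Notation H := (L2 nu).
Context (s : nat -> C) (s_tends : tends s 0).
Context (A : H -> H) (A_mul : forall (x : H) n, A x n = s n * x n).
Context (p : R) (p_gt0 : 0 < p) (A_schatten : schatten p A).

(** At most a multiple of r^q of the s_n exceed 1 / r in modulus, by schatten_count, and
    each of them contributes a factor 1 + r |s_n|, which is at most exponential in r. *)
Lemma factor_growth : exists c q : nat, forall r : nat, (0 < r)%N ->
  exists ts : seq C, [/\ forall n, (s n \in ts) || (normc (s n) * r%:R <= 1),
    forall t, t \in ts -> exists n, t = s n & factor_bound r%:R ts <= 2 ^+ (c * r ^ q)].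
Proof.
have [S S0 hS] := tends_bounded s_tends.
have [Sm Sm0 hSm] := schatten_count A_mul p_gt0 A_schatten.
have [sg hsg] := nat_upper_bound S.
have [sm hsm] := nat_upper_bound Sm.
have [q hq] := nat_upper_bound p.
exists (sg * (sm * 2 ^ q))%N, q.+1 => r r0.
have rR : 0 < r%:R :> R by rewrite ltr0n.
have ri : 0 < r%:R^-1 :> R by rewrite invr_gt0.
have [n0 hn0] := s_tends ri.
pose J := [seq n <- iota 0 n0 | r%:R^-1 < normc (s n)].
have JJ n : n \in J -> r%:R^-1 <= normc (s n) by rewrite mem_filter => /andP[/ltW].
have sJ : (size J <= sm * 2 ^ q * r ^ q)%N.
  have := hSm _ J ri (filter_uniq _ (iota_uniq _ _)) JJ.
  have pw : 0 < (2 * r%:R) `^ p :> R by rewrite powR_gt0// mulr_gt0.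
  have -> : (r%:R^-1 / 2) `^ p = ((2 * r%:R) `^ p)^-1 :> R.
    apply: (mulfI (lt0r_neq0 pw)); rewrite divff ?gt_eqF// -powRM ?mulr_ge0 ?(ltW ri)//.
    have -> : 2 * r%:R * (r%:R^-1 / 2) = 1 :> R by field; rewrite gt_eqF.
    by rewrite powR1.
  rewrite ler_pdivrMr// => h; rewrite -(ler_nat R); apply: le_trans h _.
  rewrite -mulnA -expnMn natrM; apply: ler_pM; rewrite ?(ltW pw)//.
  rewrite natrX natrM -powR_mulrn ?mulr_ge0//; apply: ler_powR => //.
  by rewrite -natrM ler1n muln_gt0.
exists (map s J); split.
- move=> n; have [h|h] := ltP r%:R^-1 (normc (s n)); last by rewrite -ler_pdivlMr// mul1r h orbT.
  rewrite map_f// mem_filter h mem_iota /= add0n ltnNge; apply/negP => /hn0.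
  by rewrite subr0 rnormC ltNge (ltW h).
- by move=> t /mapP[n _ ->]; exists n.
- rewrite /factor_bound big_map.
  apply: le_trans (_ : \prod_(j <- J) 2 ^+ (r * sg) <= _).
    apply: ler_prod => j _; apply/andP; split; first by rewrite addr_ge0// mulr_ge0// normc_ge0.
    by apply: linear_le_pow2; exact: le_trans (hS j) hsg.
  rewrite big_const_seq count_predT iter_mulr_1 -exprM.
  apply: ler_weXn2l; first by rewrite ler1n.
  have := leq_mul (leqnn (r * sg)) sJ; rewrite expnS.
  by move: (size J) (2 ^ q)%N (r ^ q)%N => j u v; clear; lia.
Qed.

Context (a b x f : H) (M : set H).
Local Notation L := (fun y => A y + dot y b *: a).
Context (M_closed : closed M) (M_sub : linear_subspace M) (M_inv : forall y, M y -> M (L y)).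
Context (Mx : M x).
Context (f_orth : forall y, lin_span [set z | M z /\ gen_eigenvector L z]%classic y -> dot y f = 0).

Lemma multiplication_bounded : exists K, forall y, rnorm (A y) <= K * rnorm y.
Proof.
have [S S0 hS] := tends_bounded s_tends; exists S => y.
by apply: rnorm_le_coord => // n; rewrite A_mul normcM ler_wpM2r ?normc_ge0.
Qed.

Lemma dot_functional k y z : dot (k *: y + z) b = k * dot y b + dot z b.
Proof. exact: dot_linear. Qed.

Let L_linear k y z : L (k *: y + z) = k *: L y + L z.
Proof. exact: (perturbation_linear (multiplication_linear A_mul) dot_functional a). Qed.

Let phi y := dot y b.

Lemma perturbed_state (r : R) ts : 0 < r ->
  (forall n, (s n \in ts) || (normc (s n) * r <= 1)) ->
  resolvent_state L M x (fun y => dot y f) (2^-1 * r)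
    (perturbation_det A phi a (factor_coef ts))
    (fun k => dot (perturbed_resolvent A phi a x (factor_coef ts) k) f).
Proof.
move=> r0 hcov.
have hY := perturbed_resolvent_solution (multiplication_linear A_mul) dot_functional a x (factor_coef ts).
have hu0 : perturbation_det A phi a (factor_coef ts) 0%N = 1.
  rewrite /perturbation_det /cprod big_ord1 /perturbation_factor /= subr0.
  by rewrite factor_coef0 [LHS]mulr1.
split=> //; have hB := perturbed_resolvent_le A_mul a b r0 hcov x.
exists (perturbed_resolvent A phi a x (factor_coef ts)), 0; eexists; split; last by [].
- exact: (lin_span_subspace _).1.
- rewrite hY (linear_map0 L_linear) add0r addr0 -[RHS]scale1r; congr (_ *: _); exact: hu0.
- by move=> k; rewrite hY.
- exact: hB.
Qed.

(** The orbit series is a function of finite order. The explicit representation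
    perturbed_state has bounds that are exponential in a power of the radius by
    factor_growth, and the zeros of its denominator are removed by
    resolvent_state_div. *)
Lemma orbit_growth : exists c q : nat, forall r : nat, (0 < r)%N ->
  coef_le (orbit_coef L x (fun y => dot y f)) r%:R (2 ^+ (c * r ^ q)).
Proof.
have [KA hKA] := multiplication_bounded.
pose K := KA + rnorm b * rnorm a.
have L_bounded y : rnorm (L y) <= K * rnorm y.
  apply: le_trans (rnormD _ _) _; rewrite /K mulrDl lerD// rnormZ.
  apply: le_trans (ler_wpM2r (rnorm_ge0 a) (dot_le y b)) _.
  by rewrite le_eqVlt; apply/orP; left; apply/eqP; ring.
have MC (v : nat -> H) y : (forall n, M (v n)) -> tends v y -> M y by exact: closed_tends.
have [c [q hc]] := factor_growth.
have [ka hka] := nat_upper_bound (rnorm a * rnorm b).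
have [g hg] := le_pow2_nat (2 * rnorm x * rnorm f).
have [sc hsc] := nat_upper_bound (2 * @shrink_cst R).
have [cc hcc] := le_pow2_nat (2 * @cartan_cst R).
pose c1 := (2 * c + ka + g)%N.
(* The radius k * r compensates for the factors 2^-1 and shrink_cst^-1. *)
pose k := sc.+1.
exists (2 + cc * (c1 * k ^ q.+1))%N, q.+1 => r r0.
pose r1 := (k * r)%N.
have r10 : (0 < r1)%N by rewrite muln_gt0 r0.
have r1R : 0 < r1%:R :> R by rewrite ltr0n.
have [ts [hcov hts hQ]] := hc r1 r10.
set Q := factor_bound r1%:R ts in hQ.
have Q1 : 1 <= Q by apply: factor_bound_ge1; exact: ltW.
pose N := (c1 * r1 ^ q.+1)%N.
have hexp : (c * r1 ^ q * 2 + r1 * ka + g <= N)%N.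
  rewrite /N /c1 expnS; have X0 : (0 < r1 ^ q)%N by rewrite expn_gt0 r10.
  move: r10 X0; move: (r1 ^ q)%N => X r10 X0.
  have h1 : (X <= r1 * X)%N by rewrite leq_pmull.
  have h2 : (r1 <= r1 * X)%N by rewrite leq_pmulr.
  have h3 : (1 <= r1 * X)%N by rewrite muln_gt0 r10.
  move: h1 h2 h3; move: (r1 * X)%N => Z h1 h2 h3.
  have := leq_mul (leqnn (c * 2)) h1; have := leq_mul (leqnn ka) h2.
  have := leq_mul (leqnn g) h3; clear; lia.
have a0 : 0 <= rnorm a * rnorm b by rewrite mulr_ge0 ?rnorm_ge0.
have hE : Q ^+ 2 * (1 + r1%:R * (rnorm a * rnorm b)) * 2 ^+ g <= 2 ^+ N.
  apply: le_trans (_ : 2 ^+ (c * r1 ^ q * 2 + r1 * ka + g) <= _); last first.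
    by apply: ler_weXn2l => //; rewrite ler1n.
  rewrite !exprD ler_pM2r ?exprn_gt0//; apply: ler_pM; rewrite ?sqr_ge0 ?addr_ge0 ?(mulr_ge0 (ltW r1R))//.
    by rewrite exprM; apply: lerXn2r; rewrite ?nnegrE ?exprn_ge0// (le_trans ler01).
  exact: linear_le_pow2.
have Qa : 0 <= Q ^+ 2 * (1 + r1%:R * (rnorm a * rnorm b)).
  by rewrite mulr_ge0 ?sqr_ge0 ?addr_ge0 ?(mulr_ge0 (ltW r1R)).
have hE1 : Q ^+ 2 * (1 + r1%:R * (rnorm a * rnorm b)) <= 2 ^+ N.
  by apply: le_trans hE; rewrite ler_peMr// exprn_ege1// ler1n.
have h2r : 0 < 2^-1 * r1%:R :> R by rewrite mulr_gt0.
pose P := factor_coef ts.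
have st := perturbed_state r1R hcov.
pose f_lin k' y z := @dot_linear R nu k' y z f.
pose f_tends v y := @tends_dotl R nu v y f.
have main := division_growth h2r (fun u F (h : resolvent_state L M x (fun y => dot y f) _ u F) => h.1)
  (@resolvent_state_conv R H L M L_linear M_inv x _ f_lin f_orth (2^-1 * r1%:R))
  (fun u F l => resolvent_state_div (@L2_complete R nu) L_linear L_bounded MC M_sub M_inv Mx
     f_lin f_tends f_orth h2r) st.
have hu : coef_le (perturbation_det A phi a P) (2^-1 * r1%:R) (2 ^+ N).
  apply: coef_leW hE1 (perturbation_det_le A_mul a b r1R hcov) => //; exact: ltW.
have hF : coef_le (fun j => dot (perturbed_resolvent A phi a x P j) f) (2^-1 * r1%:R) (2 ^+ N).
  apply: coef_leW (coef_le_dot f h2r (perturbed_resolvent_le A_mul a b r1R hcov x)) => //.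
  apply: le_trans hE; by rewrite -[leLHS]mulrA ler_wpM2l.
have hr : r%:R <= shrink_cst^-1 * (2^-1 * r1%:R) :> R.
  have : 0 < @shrink_cst R.
    by rewrite /shrink_cst !mulr_gt0// (lt_le_trans _ cartan_cst_ge4).
  move: hsc; move: (@shrink_cst R) => S hS S0; rewrite ler_pdivlMl//.
  rewrite -(@ler_pM2l _ 2)// !mulrA divff ?pnatr_eq0// mul1r /r1 natrM ler_wpM2r//.
  by apply: le_trans hS _; rewrite ler_nat.
apply: coef_leW (main N hu hF) => //.
have cc0 : 0 <= 2 * @cartan_cst R by rewrite mulr_ge0// (le_trans _ cartan_cst_ge4).
apply: le_trans (_ : 2 ^+ 2 * 2 ^+ (cc * N) <= _).
  apply: ler_pM; rewrite ?exprn_ge0//; first by rewrite -natrX ler_nat.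
  by rewrite exprM; apply: lerXn2r; rewrite ?nnegrE ?exprn_ge0.
rewrite -exprD; apply: ler_weXn2l; first by rewrite ler1n.
rewrite /N /r1 expnMn mulnDl !mulnA leq_add2r leq_pmulr// expn_gt0 r0 //.
Qed.

End Growth.

(** * Smallness of the orbit series and spectral synthesis *)

(** The identity says that y = w + q / (kappa - d), where kappa - d stays away from 0. *)
Lemma small_of_identity {R : realType} (kappa : R[i]) (G delta : R) :
  kappa != 0 -> 0 <= G -> 0 < delta ->
  exists2 e : R, 0 < e & forall y w d q : R[i],
    (kappa - d) * y = (kappa - d) * w + q ->
    normc d <= e -> normc w <= e -> normc q <= e * (G + e) -> normc y <= delta.
Proof.
move=> k0 G0 d0; have nk := normc_gt0 k0; set nu := normc kappa in nk.
have G1 : 0 < G + 1 by rewrite ltr_wpDl.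
pose e3 := delta * nu / (4 * (G + 1)).
have e30 : 0 < e3 by rewrite divr_gt0 ?mulr_gt0.
pose e := Num.min (Num.min 1 (nu / 2)) (Num.min (delta / 2) e3).
have e0 : 0 < e by rewrite !lt_min ltr01 e30 !divr_gt0.
exists e => // y w d q hy hd hw hq.
have e1 : e <= 1 by rewrite !ge_min lexx.
have e2 : e <= nu / 2 by rewrite !ge_min lexx orbT.
have e4 : e <= delta / 2 by rewrite !ge_min lexx !orbT.
have e5 : e <= e3 by rewrite !ge_min lexx !orbT.
have hk : nu / 2 <= normc (kappa - d).
  have := le_normcD (kappa - d) d; rewrite subrK -/nu.
  by move: e2 hd; clear; lra.
have kd0 : kappa - d != 0.
  apply/eqP => h; rewrite h normc0 in hk; move: hk nk; clear; lra.
have -> : y = w + q / (kappa - d).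
  by apply: (mulfI kd0); rewrite hy mulrDr mulrC; congr (_ + _); rewrite mulrC divfK.
apply: le_trans (le_normcD _ _) _; rewrite normcM normcV.
suff : normc q / normc (kappa - d) <= delta / 2 by move: hw e4; clear; lra.
have nkd : 0 < normc (kappa - d) by exact: normc_gt0.
rewrite ler_pdivrMr//; apply: le_trans hq _.
apply: le_trans (_ : e3 * (G + 1) <= _); first by apply: ler_pM; rewrite ?(ltW e0) ?addr_ge0 ?(ltW e0) ?lerD2l.
have -> : e3 * (G + 1) = delta / 2 * (nu / 2) by rewrite /e3; field; rewrite gt_eqF.
by rewrite ler_wpM2l// divr_ge0// ltW.
Qed.

Lemma shift_identity {K : comPzRingType} {V : lmodType K} (l : K) (d ad a a' : V) :
  d - l *: ad = a -> (l *: d + a') - l *: (l *: ad + a) = a'.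
Proof. by move=> <-; rewrite [l *: ad + _]addrC subrK addrAC subrr add0r. Qed.

Section Smallness.
Context {R : realType} (nu : nat -> {posnum R}).
Local Notation C := R[i].
Local Notation H := (L2 nu).
Context (s : nat -> C) (s_neq0 : forall n, s n != 0) (s_tends : tends s 0).
Context (A : H -> H) (A_mul : forall (x : H) n, A x n = s n * x n).
Context (p : R) (p_gt0 : 0 < p) (A_schatten : schatten p A).

Definition off_spectrum (l : C) := forall n, 1 - l * s n != 0.

Lemma resolvent_coord (l : C) (v x : H) n : v - l *: A v = x -> (1 - l * s n) * v n = x n.
Proof.
move=> <-; transitivity (v n - l * A v n) => //.
by rewrite A_mul; ring.
Qed.

(** The coordinates of v are z_n / (1 - l * s_n), so that |(v, w)| is bounded by a sum as
    in good_points, with weights |z_n w_n| nu_n. *)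
Lemma good_resolvent_points (zws : seq (H * H)) (e : R) (K : nat) : 0 < e -> (0 < K)%N ->
  exists r0 : nat, forall r : nat, (r0 <= r)%N -> forall n (w : C), n.-primitive_root w ->
  exists (c : C) (bad : {set 'I_n}), [/\ normc c <= 2 * r%:R, (K * #|bad| <= n)%N &
    forall j : 'I_n, j \notin bad -> let l := c + (6 * r%:R)%:C%C * w ^+ j in
      off_spectrum l /\ forall z w v, (z, w) \in zws -> v - l *: A v = z -> normc (dot v w) <= e].
Proof.
move=> e0 K0.
pose t (zw : H * H) n : R := normc (zw.1 n) * normc (zw.2 n) * (nu n)%:num.
have t0 zw n : 0 <= t zw n by rewrite /t !mulr_ge0// normc_ge0.
pose m n : R := \sum_(zw <- zws) t zw n.
have m0 n : 0 <= m n by apply: sumr_ge0.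
have hm N : \sum_(0 <= n < N) m n <= \sum_(zw <- zws) rnorm zw.1 * rnorm zw.2.
  rewrite /m exchange_big /=; apply: ler_sum => zw _; exact: cauchy_schwarz_sum.
have [r0 hr0] := good_points m0 hm s_neq0 s_tends e0 K0.
exists r0 => r /hr0 h n w /h[c [bad [hc hb hgood]]].
exists c, bad; split => // j /hgood /= [hs hsum]; set l := c + _ in hs hsum *.
split=> // z w' v hin hv.
rewrite -rnormC; apply: tends_rnorm_le (tends_dot v w') _ => N.
apply: le_trans (rnorm_sum _ _ _) _; apply: le_trans (hsum N).
apply: ler_sum => i _; rewrite rnormC !normcM normc_conj normc_nu.
have d0 : 0 < normc (1 - l * s i) by exact: normc_gt0.
rewrite ler_pdivlMr//; apply: le_trans (_ : t (z, w') i <= _).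
  by rewrite /t /= -(resolvent_coord i hv) normcM le_eqVlt; apply/orP; left; apply/eqP; ring.
by rewrite /m (big_rem _ hin) /= lerDl; apply: sumr_ge0.
Qed.

Context (a b x f : H) (M : set H).
Local Notation L := (fun y => A y + dot y b *: a).
Context (M_closed : closed M) (M_sub : linear_subspace M) (M_inv : forall y, M y -> M (L y)).
Context (Mx : M x).
Context (f_orth : forall y, lin_span [set z | M z /\ gen_eigenvector L z]%classic y -> dot y f = 0).

Local Notation g := (orbit_coef L x (fun y => dot y f)).
Let phi y := dot y b.

(** In terms of v = (I - l A)^-1 x and d = (I - l A)^-1 a this is the formula
    ((I - l L)^-1 x, f) = (v, f) + l (v, b) (d, f) / (1 - l (d, b)). It holds for the sum
    y of the orbit series at l, although I - l L is not known to be invertible there,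
    because the product of the series with the denominator is the numerator. *)
Lemma orbit_formula (l y : C) : off_spectrum l -> tends (psum g l) y ->
  exists v d : H, [/\ v - l *: A v = x, d - l *: A d = a &
    (1 - l * dot d b) * y = (1 - l * dot d b) * dot v f + l * dot v b * dot d f].
Proof.
move=> hl hy.
have [r hr] := nat_upper_bound (8 * normc l).
have r1 : (0 < r.+1)%N by [].
have [c [q hg]] := orbit_growth s_tends A_mul p_gt0 A_schatten M_closed M_sub M_inv Mx f_orth.
have [c' [q' hts]] := factor_growth s_tends A_mul p_gt0 A_schatten.
have {hts}[ts [hcov hts _]] := hts r.+1 r1.
have {}hg := hg r.+1 r1.
have r0 : 0 < r.+1%:R :> R by [].
have hlr : normc l <= 8^-1 * r.+1%:R by rewrite ler_pdivlMl// (le_trans hr)// ler_nat.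
pose P := factor_coef ts.
pose Pl := (factor_poly ts).[l].
have hP : tends (psum P l) Pl := factor_coef_tends ts l.
have Pl0 : Pl != 0.
  by apply: factor_poly_neq0 => t /hts[n ->]; exact: hl.
have hl4 : normc l <= 4^-1 * r.+1%:R.
  by apply: le_trans hlr _; rewrite ler_wpM2r// lef_pV2 ?posrE// ler_nat.
have hl4' : normc l <= 4^-1 * (2^-1 * r.+1%:R).
  apply: le_trans hlr _; rewrite mulrA ler_wpM2r//.
  by rewrite -invfM lef_pV2 ?posrE ?mulr_gt0// -natrM ler_nat.
have h40 : 0 <= 4^-1 :> R by rewrite invr_ge0.
have h41 : 4^-1 < 1 :> R by rewrite invf_lt1// ltr1n.
have [KA hKA] := multiplication_bounded s_tends A_mul.
have res z : exists v : H, v - l *: A v = z /\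
    tends (psum (scaled_resolvent A P z) l) (Pl *: v).
  have [w hw] := psum_cvg (@L2_complete R nu) r0 (scaled_resolvent_le A_mul r0 hcov z) hl4 h40 h41.
  exists (Pl^-1 *: w); rewrite scalerA divff// scale1r; split => //.
  have e : w - l *: A w = Pl *: z.
    have hz : tends (psum (fun k => P k *: z) l) (Pl *: z).
      have := tends_scaler z hP; apply: (tends_eventually (m := 0%N)) => n _.
      by rewrite psum_scaler.
    have hs := scaled_resolvent_solution (multiplication_linear A_mul) P z.
    exact: (formal_solution_lim (multiplication_linear A_mul) hKA hs hw hz).
  rewrite (linear_mapZ (multiplication_linear A_mul)) [l *: (_ *: _)]scalerA mulrC -scalerA -scalerBr e.
  by rewrite scalerA mulVf// scale1r.
have [v [hv tv]] := res x; have [d [hd td]] := res a.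
exists v, d; split => //.
have psum_dot (Y : nat -> H) (y0 w0 : H) : tends (psum Y l) y0 ->
    tends (psum (fun k => dot (Y k) w0) l) (dot y0 w0).
  move=> h; have := tends_dotl w0 h; apply: (tends_eventually (m := 0%N)) => n _.
  by rewrite /psum dot_suml; apply: eq_bigr => i _; rewrite dotZl.
have lim_delay (Y : nat -> C) y0 : tends (psum Y l) y0 -> tends (psum (delay Y) l) (l * y0).
  move=> h; have := tendsZ l h => h1 e e0; have [N hN] := h1 e e0; exists N.+1 => -[//|n] Nn.
  by rewrite psum_delay; exact: hN.
have tX := psum_dot _ _ b tv; have tA := psum_dot _ _ b td.
have tfac : tends (psum (perturbation_factor A phi a P) l) (Pl - l * dot (Pl *: d) b).
  have := tendsB hP (lim_delay _ _ tA); apply: (tends_eventually (m := 0%N)) => n _.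
  by rewrite /psum -sumrB; apply: eq_bigr => i _; rewrite -scalerBr.
have hfac := perturbation_factor_le A_mul a b r0 hcov.
have hPr := factor_coef_le ts r0.
have tdet := psum_cprod r0 hfac hPr hl4 tfac hP.
have tF := tendsD (psum_cprod r0 hfac (coef_le_dot f r0 (scaled_resolvent_le A_mul r0 hcov x)) hl4
    tfac (psum_dot _ _ f tv))
  (psum_cprod r0 (coef_le_delay r0 (coef_le_dot b r0 (scaled_resolvent_le A_mul r0 hcov x)))
    (coef_le_dot f r0 (scaled_resolvent_le A_mul r0 hcov a)) hl4 (lim_delay _ _ tX) (psum_dot _ _ f td)).
have r2 : 0 < 2^-1 * r.+1%:R :> R by rewrite mulr_gt0.
have hg2 : coef_le g (2^-1 * r.+1%:R) (2 ^+ (c * r.+1 ^ q)).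
  by apply: coef_leW hg => //; rewrite ler_piMl// invf_le1// ler1n.
have tF' := psum_cprod r2 (perturbation_det_le A_mul a b r0 hcov) hg2 hl4' tdet hy.
have st := perturbed_state A_mul a b x f M r0 hcov.
have L_linear := perturbation_linear (multiplication_linear A_mul) (dot_functional b) a.
have conv := resolvent_state_conv L_linear M_inv (fun k y z => dot_linear k y z f) f_orth st.
have hdot (u : nat -> C) (Y : nat -> H) k :
    dot (cprod u Y k) f = cprod u (fun j => dot (Y j) f) k.
  by rewrite /cprod dot_suml; apply: eq_bigr => i _; rewrite dotZl.
have key : (Pl - l * dot (Pl *: d) b) * dot (Pl *: v) f + l * dot (Pl *: v) b * dot (Pl *: d) f =
    (Pl - l * dot (Pl *: d) b) * Pl * y.
  apply: tends_unique tF _; move: tF'; apply: (tends_eventually (m := 0%N)) => n _.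
  rewrite /psum -big_split /=; apply: eq_bigr => k _.
  by rewrite conv -scalerDr /perturbed_resolvent dotDl !hdot.
move: key; rewrite !dotZl.
move: (dot v f) (dot v b) (dot d f) (dot d b) => vf vb df db h.
apply: (mulfI (mulf_neq0 Pl0 Pl0)); move: h.
have -> : (Pl - l * (Pl * db)) * Pl * y = Pl * Pl * ((1 - l * db) * y) by ring.
by move=> <-; ring.
Qed.

Lemma mostly_small_orbit (zws : seq (H * H)) (kappa : C) (G : R) : kappa != 0 -> 0 <= G ->
  (forall (e : R) (l y : C), 0 < e -> off_spectrum l -> tends (psum g l) y ->
    (forall z w v, (z, w) \in zws -> v - l *: A v = z -> normc (dot v w) <= e) ->
    exists w d q : C, [/\ (kappa - d) * y = (kappa - d) * w + q,
      normc d <= e, normc w <= e & normc q <= e * (G + e)]) ->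
  mostly_small g.
Proof.
move=> k0 G0 h e K e0 K0.
have [e' e'0 he'] := small_of_identity k0 G0 e0.
have [r0 hr0] := good_resolvent_points zws e'0 K0.
exists r0 => r /hr0 hr n w /hr [c [bad [hc hb hgood]]].
exists c, bad; split => // j /hgood[hl hzw] y hy.
have [w' [d [q [e1 e2 e3 e4]]]] := h _ _ _ e'0 hl hy hzw.
exact: he' e1 e2 e3 e4.
Qed.

(** Since a = A a', the vector l d + a' is (I - l A)^-1 a'. So l (d, .) is close to
    - (a', .) at good points, and 1 - l (d, b) is close to 1 + (a', b). *)
Lemma mostly_small_range (a' : H) : A a' = a -> 1 + dot a' b != 0 -> mostly_small g.
Proof.
move=> ha k0.
apply: (@mostly_small_orbit [:: (x, f); (x, b); (a', f); (a', b)] _ (rnorm a' * rnorm f)) k0 _ _.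
  by rewrite mulr_ge0 ?rnorm_ge0.
move=> e l y e0 hl hy hzw.
have [v [d [hv hd hform]]] := orbit_formula hl hy.
have hd' : (l *: d + a') - l *: A (l *: d + a') = a'.
  by rewrite (multiplication_linear A_mul) ha; exact: shift_identity.
have hdot u : l * dot d u = dot (l *: d + a') u - dot a' u by rewrite dot_linear addrK.
exists (dot v f), (dot (l *: d + a') b), (dot v b * (dot (l *: d + a') f - dot a' f)).
have e1 : 1 - l * dot d b = 1 + dot a' b - dot (l *: d + a') b.
  by rewrite hdot opprB addrA.
split.
- by rewrite -e1 hform -hdot; ring.
- by apply: (hzw a' b) => //; rewrite !inE eqxx !orbT.
- by apply: (hzw x f) => //; rewrite inE eqxx.
rewrite normcM; apply: ler_pM; rewrite ?normc_ge0//.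
  by apply: (hzw x b) => //; rewrite !inE eqxx orbT.
apply: le_trans (normcB _ _) _; rewrite addrC lerD ?dot_le//.
by apply: (hzw a' f) => //; rewrite !inE eqxx !orbT.
Qed.

(** The factor l is now moved to the other side: l (v, b) = (l A v, b') = (v - x, b'),
    and likewise 1 - l (d, b) = 1 + (a, b') - (d, b'). *)
Lemma mostly_small_corange (b' : H) : (forall z, dot (A z) b' = dot z b) ->
  1 + dot a b' != 0 -> mostly_small g.
Proof.
move=> hb k0.
apply: (@mostly_small_orbit [:: (x, f); (x, b'); (a, f); (a, b')] _ (rnorm x * rnorm b')) k0 _ _.
  by rewrite mulr_ge0 ?rnorm_ge0.
move=> e l y e0 hl hy hzw.
have [v [d [hv hd hform]]] := orbit_formula hl hy.
have hdot u z : u - l *: A u = z -> l * dot u b = dot u b' - dot z b'.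
  by move=> <-; rewrite dotBl dotZl hb opprB addrC subrK.
exists (dot v f), (dot d b'), ((dot v b' - dot x b') * dot d f).
have e1 : 1 - l * dot d b = 1 + dot a b' - dot d b'.
  by rewrite (hdot _ _ hd) opprB addrA.
split.
- by rewrite -e1 hform (hdot _ _ hv).
- by apply: (hzw a b') => //; rewrite !inE eqxx !orbT.
- by apply: (hzw x f) => //; rewrite inE eqxx.
rewrite normcM mulrC; apply: ler_pM; rewrite ?normc_ge0//.
  by apply: (hzw a f) => //; rewrite !inE eqxx !orbT.
apply: le_trans (normcB _ _) _; rewrite addrC lerD ?dot_le//.
by apply: (hzw x b') => //; rewrite !inE eqxx orbT.
Qed.

End Smallness.

Lemma limn_dot {R : realType} {nu : nat -> {posnum R}} (x y : L2 nu) (u : nat -> R[i]) :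
  (forall n, u n = x n * (y n)^*%C * ((nu n)%:num)%:C%C) -> limn (series u) = dot x y.
Proof. by move=> h; rewrite /dot; congr (limn (series _)); apply/funext. Qed.

Theorem theorem2p3 (R : realType) (s : nat -> R[i]) (nu : nat -> {posnum R})
  (s_inj : injective s) (s_neq0 : forall n, s n != 0)
  (s_cvg0 : s @ \oo --> (0 : R[i]))
  (nu_finite : (\sum_(0 <= n <oo) ((nu n)%:num)%:E < +oo)%E)
  (A : L2 nu -> L2 nu) (A_mul : forall (x : L2 nu) n, A x n = s n * x n)
  (p : R) (p_gt0 : 0 < p) (A_schatten : schatten p A)
  (a b : L2 nu)
  (hab : ((forall n, a n != 0) /\
            square_summable nu (fun n => a n * (s n)^-1)) \/
         ((forall n, b n != 0) /\
            square_summable nu (fun n => b n * (s n)^-1)))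
  (hsum : limn (series (fun n =>
            a n * (b n)^*%C * (s n)^-1 * ((nu n)%:num)%:C%C)) <> -1) :
  spectral_synthesis (fun x => A x + rank_one a b x).
Proof.
have s_tends : tends s 0 by exact/tendsP.
move=> M M_closed M_sub M_inv.
set W := [set x | M x /\ _]%classic.
have WM : lin_span W `<=` M by apply: (lin_span_ind M_sub) => x [].
apply/seteqP; split; last first.
  by rewrite [X in _ `<=` X]((closure_id M).1 M_closed); exact: closureS.
move=> x Mx; apply: contrapT => /(projection (lin_span_subspace W))[f [f_orth xf0]].
suff small : mostly_small (orbit_coef (fun x => A x + dot x b *: a) x (fun y => dot y f)).
  have [c [q growth]] :=
    orbit_growth s_tends A_mul p_gt0 A_schatten M_closed M_sub M_inv Mx f_orth.
  by have := finite_order_vanish growth small; apply/eqP.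
case: hab => [[_ ha]|[_ hb]].
- pose a' := MkL2 (introT (asboolP _) ha) : L2 nu.
  apply: (mostly_small_range s_neq0 s_tends A_mul p_gt0 A_schatten M_closed M_sub M_inv Mx f_orth (a' := a')).
    by apply: L2_ext => n; rewrite A_mul /= mulrC divfK.
  apply/eqP => k0; apply: hsum; rewrite (@limn_dot _ _ a' b).
    by apply/eqP; rewrite -addr_eq0 addrC k0.
  by move=> n /=; ring.
- have hb' : square_summable nu (fun n => b n * (s n)^*%C^-1).
    move: hb; congr (_ < _)%E; apply: eq_eseriesr => n _.
    by rewrite !normcM !normcV normc_conj.
  pose b' := MkL2 (introT (asboolP _) hb') : L2 nu.
  (* The conjugate of s_n is what makes (A z, b') equal to (z, b). *)
  have conj_b' n : (b' n)^*%C = (b n)^*%C * (s n)^-1.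
    by rewrite /= rmorphM /= fmorphV /= conjcK.
  apply: (mostly_small_corange s_neq0 s_tends A_mul p_gt0 A_schatten M_closed M_sub M_inv Mx f_orth (b' := b')).
    move=> z; apply: limn_dot => n; rewrite conj_b' A_mul.
    by field; exact: s_neq0.
  apply/eqP => k0; apply: hsum; rewrite (@limn_dot _ _ a b').
    by apply/eqP; rewrite -addr_eq0 addrC k0.
  by move=> n; rewrite conj_b'; ring.
Qed.
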